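(* Let $\mathcal{G}$ be a periodic graph and let $p\in(2,6)$. Then, for every $\mu>0$, $$-\infty<\mathcal{E}_{\mathcal{G}}(\mu)<0,$$ and there always exists a ground state with mass $\mu$, i.e., a function $u\in H^1_\mu(\mathcal{G})$ such that $E(u,\mathcal{G})=\mathcal{E}_{\mathcal{G}}(\mu)$.
   Context: Metric graphs. A connected metric graph $\mathcal{G}=(V(\mathcal{G}),E(\mathcal{G}))$ is a connected space made up of segments (the edges) glued together at some points (the vertices) according to the topology of the graph; multiple edges and self-loops are allowed. Each edge $e$ is identified with an interval $I_e=[0,\ell_e]$, $0<\ell_e<+\infty$, through a coordinate $x_e$. A compact graph is a metric graph with finitely many vertices and edges, all of finite length. Periodic graphs. Let $\mathcal{K}$ be a connected compact graph, $D,R\subset V(\mathcal{K})$ two non-empty sets with $D\cap R=\emptyset$, and $\sigma:D\to R$ a bijection. Take copies $\{\mathcal{K}_i\}_{i\in\mathbb{Z}}$ of $\mathcal{K}$, with $D_i,R_i\subset V(\mathcal{K}_i)$ the corresponding copies of $D,R$, and regard $\sigma$ as a map from $D_i$ to $R_{i+1}$ for every $i\in\mathbb{Z}$. On the disjoint union $\mathbb{G}=\bigcup_{i\in\mathbb{Z}}\mathcal{K}_i$ consider the equivalence relation $\sim$ that identifies each $v\in D_i$ with $\sigma(v)\in R_{i+1}$, for every $i\in\mathbb{Z}$ (and no other distinct points). The quotient $\mathcal{G}=\mathbb{G}/\!\sim$ is called a periodic graph with periodicity cell $\mathcal{K}$ and pasting rule $\sigma$. It is assumed throughout that a periodic graph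 has at least one vertex of degree at least $3$. Function spaces. A function $u:\mathcal{G}\to\mathbb{R}$ is a family $\{u_e\}_{e\in E(\mathcal{G})}$ with $u_e:I_e\to\mathbb{R}$. $L^p(\mathcal{G})$ is the space of functions with $u_e\in L^p(I_e)$ for all $e$ and $\|u\|_{L^p(\mathcal{G})}^p=\int_{\mathcal{G}}|u|^p\,dx=\sum_{e}\int_{I_e}|u_e|^p\,dx_e<\infty$. $H^1(\mathcal{G})$ is the space of continuous functions $u:\mathcal{G}\to\mathbb{R}$ with $u_e\in H^1(I_e)$ for all $e$ and $u,u'\in L^2(\mathcal{G})$. All functions are real-valued. For $\mu>0$, $H^1_\mu(\mathcal{G})=\{u\in H^1(\mathcal{G}):\|u\|_{L^2(\mathcal{G})}^2=\mu\}$. Energy. $E(u,\mathcal{G})=\frac12\int_{\mathcal{G}}|u'|^2\,dx-\frac1p\int_{\mathcal{G}}|u|^p\,dx$ and $\mathcal{E}_{\mathcal{G}}(\mu)=\inf_{u\in H^1_\mu(\mathcal{G})}E(u,\mathcal{G})$. *)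

(* Defs.v *)
From HB Require Import structures.
From Stdlib Require Export Relation_Operators.
From mathcomp Require Export all_boot all_order all_algebra generic_quotient.
From mathcomp Require Export all_classical all_reals all_analysis.
Set Implicit Arguments.
Unset Strict Implicit.
Unset Printing Implicit Defensive.
Import Order.TTheory GRing.Theory Num.Theory.
Import numFieldNormedType.Exports.
Local Open Scope quotient_scope.
Local Open Scope classical_set_scope.
Local Open Scope ring_scope.

(* The edge [e] is the interval [0, len e]; [ends e false] is the vertex at
   coordinate [0] and [ends e true] the one at coordinate [len e].  Multiple
   edges and self-loops are allowed.  The graph is compact when [V] and [E]
   are finite types. *)
Record metric_graph (R : realType) (V E : choiceType) := MetricGraph {
  ends : E -> bool -> V;
  len : E -> R;
  len_gt0 : forall e, 0 < len e }.

Definition connected_graph (R : realType) (V E : choiceType)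
    (G : metric_graph R V E) : Prop :=
  forall v w : V,
    clos_refl_sym_trans V
      (fun a b => exists e, ends G e false = a /\ ends G e true = b) v w.

(* A pair [(e, b)] is an end of the edge [e], so a self-loop is counted twice
   in the star of its vertex; the degree of [v] is the cardinal of its star. *)
Definition star (R : realType) (V E : choiceType) (G : metric_graph R V E)
    (v : V) : set (E * bool) :=
  [set h | ends G h.1 h.2 = v].

Definition degree_ge (R : realType) (V E : choiceType)
    (G : metric_graph R V E) (n : nat) (v : V) : Prop :=
  (`I_n #<= star G v)%card.

(* The vertex [v] of the copy [K_i] is the pair [(v, i)]. *)
Definition paste (V : choiceType) (D : set V) (sigma : V -> V)
    (x y : V * int) : Prop :=
  D x.1 /\ y = (sigma x.1, x.2 + 1).

Definition glue (V : choiceType) (D : set V) (sigma : V -> V) :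
    rel (V * int) :=
  fun x y => `[< clos_refl_sym_trans (V * int) (paste D sigma) x y >].

Section Glue.
Variables (V : choiceType) (D : set V) (sigma : V -> V).

Lemma glue_refl : reflexive (glue D sigma).
Proof. by move=> x; apply/asboolP; exact: rst_refl. Qed.

Lemma glue_sym : symmetric (glue D sigma).
Proof. by move=> x y; apply/asboolP/asboolP; exact: rst_sym. Qed.

Lemma glue_trans : transitive (glue D sigma).
Proof.
move=> y x z /asboolP xy /asboolP yz; apply/asboolP.
exact: rst_trans xy yz.
Qed.

Definition glue_equiv : equiv_rel (V * int) :=
  EquivRel (glue D sigma) glue_refl glue_sym glue_trans.

End Glue.

Definition periodic_vertex (V : choiceType) (D : set V) (sigma : V -> V) :
    choiceType :=
  {eq_quot (glue_equiv D sigma)}.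

Definition periodic_graph (R : realType) (V E : choiceType)
    (K : metric_graph R V E) (D : set V) (sigma : V -> V) :
    metric_graph R (periodic_vertex D sigma) (E * int)%type :=
  @MetricGraph R (periodic_vertex D sigma) (E * int)%type
    (fun e b => \pi_({eq_quot (glue_equiv D sigma)}) (ends K e.1 b, e.2))
    (fun e => len K e.1)
    (fun e => len_gt0 K e.1).

Section Edge.
Variables (R : realType) (l : R).
Local Notation leb := (@lebesgue_measure R).

Definition edge_Lpow (p : R) (f : R -> R) : \bar R :=
  (\int[leb]_(x in `[0%R, l]) (`|f x| `^ p)%:E)%E.

Definition edge_Lp (p : R) (f : R -> R) : Prop :=
  measurable_fun `[0, l] f /\ (edge_Lpow p f < +oo)%E.

(* [C^1_c(0, l)], the test functions in Brezis' definition of Sobolev spaces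
   on an interval. *)
Definition test_fun (phi : R -> R) : Prop :=
  [/\ forall x, derivable phi x 1,
      continuous (derive1 phi) &
      exists a b, [/\ 0 < a, b < l & forall x, x \notin `[a, b] -> phi x = 0]].

Definition is_weak_deriv (f g : R -> R) : Prop :=
  edge_Lp 2 g /\
  forall phi, test_fun phi ->
    \int[leb]_(x in `[0, l]) (f x * derive1 phi x) =
    - \int[leb]_(x in `[0, l]) (g x * phi x).

Definition edge_H1 (f : R -> R) : Prop :=
  edge_Lp 2 f /\ exists g, is_weak_deriv f g.

(* The weak derivative is unique up to a null set. *)
Definition weak_deriv (f : R -> R) : R -> R :=
  xget (cst 0) [set g | is_weak_deriv f g].

End Edge.

Section FunctionSpaces.
Variables (R : realType) (V E : choiceType) (G : metric_graph R V E).
Implicit Types u : E -> R -> R.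

(* A function on [G] is a family [u] indexed by the edges; only the values of
   [u e] on [0, len e] are relevant. *)

Definition Lpow (p : R) u : \bar R :=
  \esum_(e in [set: E]) edge_Lpow (len G e) p (u e).

Definition Lp (p : R) u : Prop :=
  (forall e, edge_Lp (len G e) p (u e)) /\ (Lpow p u < +oo)%E.

Definition end_val u (h : E * bool) : R :=
  u h.1 (if h.2 then len G h.1 else 0).

Definition graph_continuous u : Prop :=
  (forall e, {within `[0, len G e], continuous (u e)}) /\
  (forall h h', ends G h.1 h.2 = ends G h'.1 h'.2 ->
     end_val u h = end_val u h').

Definition graph_deriv u : E -> R -> R :=
  fun e => weak_deriv (len G e) (u e).

Definition H1 : set (E -> R -> R) :=
  [set u | [/\ graph_continuous u, forall e, edge_H1 (len G e) (u e),
               Lp 2 u & Lp 2 (graph_deriv u)]].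

Definition H1_mass (mu : R) : set (E -> R -> R) :=
  [set u | H1 u /\ Lpow 2 u = mu%:E].

Definition energy (p : R) u : \bar R :=
  ((2^-1)%:E * Lpow 2 (graph_deriv u) - (p^-1)%:E * Lpow p u)%E.

Definition ground_energy (p mu : R) : \bar R :=
  ereal_inf [set energy p u | u in H1_mass mu].

End FunctionSpaces.

(* Main.v *)
Require Import Defs.
From mathcomp Require Import all_boot all_order all_algebra.
From mathcomp Require Import all_classical all_reals all_analysis.
From mathcomp Require Import measurable_realfun ring lra.
Set Implicit Arguments.
Unset Strict Implicit.
Unset Printing Implicit Defensive.
Import Order.TTheory GRing.Theory Num.Theory.
Import numFieldNormedType.Exports.
Local Open Scope classical_set_scope.
Local Open Scope ring_scope.

(** The energy is invariant under the translation of the cells, so a minimizing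
    sequence can lose compactness by spreading out, by running off to infinity
    or by splitting into distant pieces.  Each of these is excluded below.

    Bounds.  The cell is finite, so all edges have length at least some [d > 0], and
    averaging over an interval of length [c <= d] around a point bounds the
    square of the function there by [2 mass / c + 2 c kin] ([H1_sup]).  The best
    [c] makes the supremum of order [kin ^ (1/4)] at fixed mass; since [p < 6]
    the potential term is then sublinear in the kinetic one, and the energy is
    bounded from below and controls the kinetic term ([coercive]).  For the
    upper bound, a tent that climbs by 1 per cell over [2n] cells, scaled to mass
    [mu], has potential term larger than the kinetic one by a factor of order
    [n ^ (3 - p/2)], so its energy is negative for [n] large
    ([negative_energy]).

    Scaling.  Let [I < 0] be the infimum.  Multiplying a function of mass
    [m <= mu] by a constant so that its mass becomes [mu] shows that its energy
    is at least [(m / mu) I], with a gain proportional to its potential term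
    when [m < mu] ([En_scaled], [En_ge_part]).  It plays the part of strict subadditivity.

    Tightness.  As [I < 0], a function of nearly minimal energy exceeds a fixed
    positive constant somewhere ([nonvanishing]), and a translation brings that
    point into the cell 0.  Among [N] successive layers of cells one carries at
    most the [N]-th part of the mass and of the kinetic term
    ([shell_pigeonhole]); cutting there splits the function into an inner and an
    outer part with almost the same total energy ([En_split]).  The inner part
    has a potential term bounded from below, so the gain from scaling would be
    too large if its mass were not close to [mu]: the mass outside a fixed
    number of cells is small ([tightness]).

    Compactness.  The limit is taken along an ultrafilter finer than all sets of
    near-minimizers, along which bounded quantities converge without passing to
    subsequences.  The functions are uniformly Hoelder continuous, hence
    converge uniformly on each edge, and with tightness they are Cauchy in the
    mass norm ([near_cauchy_mass]).  The potential terms are then nearly equal,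
    and as the midpoint of two near-minimizers has energy at least [I] the
    parallelogram identity makes them Cauchy in the kinetic norm as well
    ([near_cauchy]).  A sequence extracted from the ultrafilter converges to a
    function of mass at most [mu] and energy at most [I], and the scaling bound
    forces its mass to be [mu] ([ulim_minimizer]).

    All this rests on the fundamental theorem of calculus for weak derivatives
    on an edge ([weak_deriv_FTC]), obtained by testing with smoothed indicators
    of intervals, and on the closedness of the weak derivative
    ([H1_edge_closed]).  Cauchy-Schwarz and Minkowski inequalities are replaced
    by weighted inequalities between quadratic forms.  The connectedness of the
    cell provides an edge. *)

(** * Smoothed steps as test functions *)

Section Calculus.
Variable R : realType.
Implicit Types (x y t h e a b : R).

(** A quadratic error bound, valid for all increments, avoids case distinctions
    at the points where a function is defined piecewise. *)
Lemma is_derive_quadratic_error (F : R -> R) t d C :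
  (forall h, `|F (t + h) - F t - h * d| <= C * h ^+ 2) ->
  is_derive t 1 F d.
Proof.
move=> HF.
suff H : (fun h => h^-1 *: (F (h *: (1:R) + t) - F t)) @ 0^' --> d.
  by apply: DeriveDef; [apply/cvg_ex; exists d | apply/cvg_lim].
apply/cvgrPdist_le => e e0.
have C0 : 0 <= C by have := HF 1; rewrite expr1n mulr1; apply: le_trans.
near=> h.
have h0 : h != 0 by near: h; exact: nbhs_dnbhs_neq.
rewrite [h *: 1]mulr1 [_ *: _]/(_ * _).
have -> : d - h^-1 * (F (h + t) - F t) = - h^-1 * (F (t + h) - F t - h * d).
  by rewrite (addrC h); field.
rewrite normrM normrN normfV.
rewrite mulrC ler_pdivrMr ?normr_gt0//.
apply: (le_trans (HF h)).
rewrite -real_normK ?num_real// expr2 mulrA ler_wpM2r//.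
have : `|h| <= e / (C + 1).
  near: h; apply: nbhs_dnbhs; apply/nbhs_ballP => /=.
  exists (e / (C + 1)) => /=; first by rewrite divr_gt0// ltr_wpDl.
  by move=> z; rewrite /ball /= sub0r normrN => /ltW.
rewrite ler_pdivlMr ?ltr_wpDl// => /(le_trans _); apply.
by rewrite mulrC ler_wpM2l// lerDl.
Unshelve. all: by end_near. Qed.

Definition ramp (t : R) : R := Num.max 0 t.

Lemma ramp_sqr_derive b t :
  is_derive t 1 (fun t => ramp (t - b) ^+ 2) (2 * ramp (t - b)).
Proof.
apply: (@is_derive_quadratic_error _ _ _ 1) => h; rewrite /ramp.
rewrite ler_norml; case: (lerP (t - b) 0) => h1; case: (lerP (t + h - b) 0) => h2; nra.
Qed.

(** The continuous bump of integral 1 supported in [[0, 2e]]: a second difference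
    of [ramp]. *)
Definition tent e t := (ramp t - 2 * ramp (t - e) + ramp (t - 2 * e)) / e ^+ 2.
(** The primitive of [tent], as a second difference of squares of [ramp]; it
    climbs from 0 to 1 over [[0, 2e]]. *)
Definition step e t :=
  (ramp t ^+ 2 - 2 * ramp (t - e) ^+ 2 + ramp (t - 2 * e) ^+ 2) / (2 * e ^+ 2).

Lemma continuous_ramp : continuous ramp.
Proof.
move=> t; rewrite /ramp; apply: (@continuous_max _ _ (cst 0) id) => //.
exact: cst_continuous.
Qed.

Lemma tent_ge0 e t : 0 < e -> 0 <= tent e t.
Proof.
move=> e0; rewrite /tent divr_ge0 ?sqr_ge0//; rewrite /ramp.
by case: (lerP t 0) => h1; case: (lerP (t - e) 0) => h2; case: (lerP (t - 2 * e) 0) => h3; lra.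
Qed.

Lemma tent_out e t : 0 < e -> (t <= 0) || (2 * e <= t) -> tent e t = 0.
Proof.
move=> e0 h; apply/eqP; rewrite /tent mulf_eq0; apply/orP; left; apply/eqP; rewrite /ramp.
by case: (lerP t 0) h => h1 /= h; case: (lerP (t - e) 0) => h2; case: (lerP (t - 2 * e) 0) => h3; lra.
Qed.

Lemma step_eq0 e t : 0 < e -> t <= 0 -> step e t = 0.
Proof.
move=> e0 h; rewrite /step /ramp.
by rewrite !max_l ?expr0n ?mulr0 ?subr0 ?addr0 ?mul0r//; lra.
Qed.

Lemma step_eq1 e t : 0 < e -> 2 * e <= t -> step e t = 1.
Proof.
move=> e0 h; rewrite /step /ramp !max_r; try lra.
by field; rewrite gt_eqF.
Qed.

Lemma step_itv e t : 0 < e -> 0 <= step e t <= 1.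
Proof.
move=> e0; have e20 : 0 < 2 * e ^+ 2 by rewrite mulr_gt0// exprn_gt0.
rewrite /step ler_pdivrMr// mul1r divr_ge0 ?(ltW e20)//; rewrite /ramp;
case: (lerP t 0) => h1; case: (lerP (t - e) 0) => h2; case: (lerP (t - 2 * e) 0) => h3; nra.
Qed.

Lemma step_derive e a t : 0 < e -> is_derive t 1 (fun t => step e (t - a)) (tent e (t - a)).
Proof.
move=> e0; rewrite /step.
have E : (fun t0 => (ramp (t0 - a) ^+ 2 - 2 * ramp (t0 - a - e) ^+ 2 + ramp (t0 - a - 2 * e) ^+ 2) / (2 * e ^+ 2))
  = (2 * e ^+ 2)^-1 \*: ((fun t0 => ramp (t0 - a) ^+ 2) - 2 \*: (fun t0 => ramp (t0 - (a + e)) ^+ 2) + (fun t0 => ramp (t0 - (a + 2 * e)) ^+ 2)).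
  apply/funext => z.
  rewrite -[RHS]/((2 * e ^+ 2)^-1 * (ramp (z - a) ^+ 2 - 2 * ramp (z - (a + e)) ^+ 2 + ramp (z - (a + 2 * e)) ^+ 2)).
  by rewrite mulrC !opprD !addrA.
rewrite E.
have h1 := ramp_sqr_derive a; have h2 := ramp_sqr_derive (a + e); have h3 := ramp_sqr_derive (a + 2 * e).
apply: is_derive_eq.
rewrite /tent /GRing.scale /= !opprD !addrA.
by field; rewrite gt_eqF.
Qed.

Lemma continuous_tent e a : continuous (fun t => tent e (t - a)).
Proof.
move=> t; rewrite /tent.
have aux b : continuous_at t (fun t => ramp (t - b)).
  apply: (@continuous_comp _ _ _ (fun t => t - b) ramp); last exact: continuous_ramp.
  by apply: cvgB; [exact: cvg_id|exact: cvg_cst].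
apply: cvgM; last exact: cvg_cst.
have -> : (fun t0 : R => ramp (t0 - a) - 2 * ramp (t0 - a - e) + ramp (t0 - a - 2 * e))
  = (fun t0 => ramp (t0 - a) - 2 * ramp (t0 - (a + e)) + ramp (t0 - (a + 2 * e))).
  by apply/funext => z; rewrite !opprD !addrA.
rewrite -!(addrA t) -!opprD.
apply: cvgD; last exact: aux.
apply: cvgB; first exact: aux.
by apply: cvgM; [exact: cvg_cst|exact: aux].
Qed.

(** These test functions approximate the indicator of [[x, y]]; their support
    stays away from both ends of the edge because the steps climb to the right
    of [x] and of [y]. *)
Lemma test_fun_steps l x y e : 0 < e -> 0 < x -> x < y -> y + 2 * e < l ->
  test_fun l (fun t => step e (t - x) - step e (t - y)) /\
  derive1 (fun t => step e (t - x) - step e (t - y)) =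
  (fun t => tent e (t - x) - tent e (t - y)).
Proof.
move=> e0 x0 xy yl.
have D t : is_derive t 1 (fun t => step e (t - x) - step e (t - y)) (tent e (t - x) - tent e (t - y)).
  by have h1 := @step_derive e x t e0; have h2 := @step_derive e y t e0; exact: is_deriveB.
have E : derive1 (fun t => step e (t - x) - step e (t - y)) =
  (fun t => tent e (t - x) - tent e (t - y)).
  by apply/funext => t; rewrite derive1E; apply: derive_val.
split => //; split.
- by move=> t; apply: ex_derive.
- rewrite E => t; apply: cvgB; exact: continuous_tent.
- exists x, (y + 2 * e); split => // t; rewrite in_itv /= negb_and -!ltNge => /orP[h|h].
    by rewrite !step_eq0 ?subr0//; lra.
  by rewrite !step_eq1 ?subrr//; lra.
Qed.

End Calculus.

(** * Square-integrable functions on an edge *)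

Section SquareIntegrable.
Variables (R : realType) (l : R).
Local Notation mu := (@lebesgue_measure R).
Local Notation I := (`[0%R, l]%classic : set (measurableTypeR R)).
Local Notation meas := (@measurable_fun _ _ (measurableTypeR R) R I).
Implicit Types (f g h : R -> R) (a b c : R).

Definition int_on f := mu.-integrable I (EFin \o f).
Definition L2 f := meas f /\ int_on (fun x => f x ^+ 2).

Lemma mI : measurable I. Proof. exact: measurable_itv. Qed.
Hint Resolve mI : core.

Lemma int_meas f : int_on f -> meas f.
Proof. by move=> /(@measurable_int _ _ _ _ _ _) /measurable_EFinP. Qed.

Lemma int_on_cont f : {within I, continuous f} -> int_on f.
Proof. by move=> cf; apply: continuous_compact_integrable => //; exact: segment_compact. Qed.

Lemma int_on_cst c : int_on (fun=> c).
Proof. by apply: int_on_cont; apply: continuous_subspaceT => x; exact: cvg_cst. Qed.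

Lemma int_on_le f g : meas f -> int_on g ->
  (forall x, I x -> `|f x| <= g x) -> int_on f.
Proof.
move=> mf ig fg; apply: le_integrable ig => //; first exact/measurable_EFinP.
by move=> x Ix /=; rewrite lee_fin (le_trans (fg x Ix))// ler_norm.
Qed.

Lemma int_on_scale a f : int_on f -> int_on (fun x => a * f x).
Proof. by move=> hf; have := integrableZl mI a hf; apply: eq_integrable. Qed.

Lemma int_on_lin a b f g : int_on f -> int_on g -> int_on (fun x => a * f x + b * g x).
Proof.
move=> hf hg; have := integrableD mI (int_on_scale a hf) (int_on_scale b hg).
exact: eq_integrable.
Qed.

Lemma Rint_lin a b f g : int_on f -> int_on g ->
  \int[mu]_(x in I) (a * f x + b * g x) = a * \int[mu]_(x in I) f x + b * \int[mu]_(x in I) g x.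
Proof.
move=> hf hg; rewrite RintegralD//; [|exact: int_on_scale..].
by rewrite !RintegralZl.
Qed.

Lemma int_on_ext f g : (forall x, I x -> f x = g x) -> int_on f -> int_on g.
Proof.
move=> fg; apply: eq_integrable => // x; rewrite inE => Ix /=.
by rewrite fg.
Qed.

Lemma Rint_ext f g : (forall x, I x -> f x = g x) ->
  \int[mu]_(x in I) f x = \int[mu]_(x in I) g x.
Proof. by move=> fg; apply: eq_Rintegral => x; rewrite inE; exact: fg. Qed.

Lemma L2_ext f g : (forall x, I x -> f x = g x) -> L2 f -> L2 g.
Proof.
move=> fg [mf hf]; split.
  by apply: eq_measurable_fun mf => x; rewrite inE; exact: fg.
by apply: int_on_ext hf => x Ix; rewrite fg.
Qed.

Lemma L2_cont f : {within I, continuous f} -> L2 f.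
Proof.
move=> cf; split; first exact: (int_meas (int_on_cont cf)).
apply: int_on_cont => x; apply: cvgM; exact: cf.
Qed.

(** By [2 |f g| <= f^2 + g^2]. *)
Lemma L2_mul f g : L2 f -> L2 g -> int_on (fun x => f x * g x).
Proof.
move=> [mf hf] [mg hg]; apply: int_on_le (int_on_lin 1 1 hf hg) _.
  exact: measurable_funM.
move=> x Ix; rewrite ler_norml; nra.
Qed.

Lemma L2_cst c : L2 (fun=> c).
Proof. by apply: L2_cont; apply: continuous_subspaceT => x; exact: cvg_cst. Qed.

Lemma L2_int f : L2 f -> int_on f.
Proof.
move=> hf; have := L2_mul hf (L2_cst 1).
by apply: int_on_ext => x _; rewrite mulr1.
Qed.

Lemma L2_lin a b f g : L2 f -> L2 g -> L2 (fun x => a * f x + b * g x).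
Proof.
move=> hf hg; split.
  by apply: measurable_funD; apply: measurable_funM => //; [case: hf|case: hg].
have := int_on_lin 1 1 (int_on_lin (a ^+ 2) (b ^+ 2) hf.2 hg.2) (int_on_lin (2 * a * b) 0 (L2_mul hf hg) (int_on_cst 0)).
by apply: int_on_ext => x _ /=; ring.
Qed.

Lemma L2_norm f : L2 f -> L2 (fun x => `|f x|).
Proof.
move=> [mf hf]; split; first exact: measurableT_comp.
by apply: int_on_ext hf => x _; rewrite real_normK ?num_real.
Qed.

Lemma L2_bounded f h (C : R) : L2 f -> meas h -> (forall x, I x -> `|h x| <= C) ->
  L2 (fun x => h x * f x).
Proof.
move=> [mf hf] mh hC; split; first exact: measurable_funM.
apply: int_on_le (int_on_lin (C ^+ 2) 0 hf (int_on_cst 0)) _.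
  apply: (@measurable_funX _ _ _ _ (fun x => h x * f x)).
  exact: measurable_funM.
move=> x Ix /=; rewrite mul0r addr0 ger0_norm ?sqr_ge0// exprMn ler_wpM2r ?sqr_ge0//.
by rewrite -real_normK ?num_real// ler_pXn2r ?nnegrE//; try exact: hC; exact: (le_trans _ (hC x Ix)).
Qed.

(** The power [`^ 2] with a real exponent agrees with the square. *)
Lemma edge_Lp2P f : edge_Lp l 2 f <-> L2 f.
Proof.
rewrite /edge_Lp /edge_Lpow /L2 /int_on.
have E : forall x, `|f x| `^ 2 = `|f x ^+ 2|.
  by move=> x; rewrite powR_mulrn// normrX.
split=> -[mf hf]; split => //.
  apply/integrableP; split.
    apply/measurable_EFinP; exact: measurable_funX.
  by under eq_integral do rewrite /= -E.
case/integrableP: hf => _; congr (_ < _)%E; apply: eq_integral => x _ /=.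
by rewrite E.
Qed.

Lemma edge_Lpow2E f : L2 f -> edge_Lpow l 2 f = (\int[mu]_(x in I) (f x ^+ 2))%:E.
Proof.
move=> [mf hf]; rewrite /edge_Lpow /Rintegral fineK; last exact: integrable_fin_num.
by apply: eq_integral => x _; rewrite powR_mulrn// real_normK ?num_real.
Qed.

Lemma Rint_le f g : int_on f -> int_on g -> (forall x, I x -> f x <= g x) ->
  \int[mu]_(x in I) f x <= \int[mu]_(x in I) g x.
Proof. by move=> hf hg fg; apply: le_Rintegral. Qed.

Lemma Rint_cst c : 0 <= l -> \int[mu]_(x in I) c = c * l.
Proof.
move=> l0; rewrite Rintegral_cst//.
by have := @lebesgue_measure_itv R `[0, l]; rewrite /= lte_fin => ->; case: ltP => h1 /=; rewrite ?subr0//; have -> : l = 0 by [apply: le_anti; rewrite h1 l0].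
Qed.

(** Integrate [|f| <= c + f^2 / c].  With the parameter [c] at hand this serves
    in place of the Cauchy-Schwarz inequality against the constant 1. *)
Lemma Rint_abs_le f c : 0 <= l -> 0 < c -> L2 f ->
  \int[mu]_(x in I) `|f x| <= c * l + \int[mu]_(x in I) (f x ^+ 2) / c.
Proof.
move=> l0 c0 hf; rewrite -Rint_cst// mulrC.
have := Rint_lin 1 c^-1 (int_on_cst c) hf.2; rewrite !mul1r => <-.
apply: Rint_le.
- exact: L2_int (L2_norm hf).
- have := int_on_lin 1 c^-1 (int_on_cst c) hf.2.
  by apply: int_on_ext => x _; rewrite mul1r.
- move=> x _; rewrite -real_normK ?num_real//.
  have: 0 <= (`|f x| - c) ^+ 2 / c by rewrite divr_ge0 ?sqr_ge0// ltW.
  have -> : (`|f x| - c) ^+ 2 / c = c^-1 * `|f x| ^+ 2 - 2 * `|f x| + c by field; rewrite gt_eqF.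
  have := normr_ge0 (f x); lra.
Qed.

Lemma Rint_dominated (F : nat -> R -> R) f g : (forall n, meas (F n)) ->
  int_on g -> (forall n x, I x -> `|F n x| <= g x) ->
  (forall x, I x -> F n x @[n --> \oo] --> f x) ->
  \int[mu]_(x in I) F n x @[n --> \oo] --> \int[mu]_(x in I) f x.
Proof.
move=> mF hg Fg Ff; apply: fine_cvg; rewrite /Rintegral.
have mf : meas f by exact: (measurable_fun_cvg mF Ff).
have hf : int_on f.
  apply: int_on_le hg _ => // x Ix.
  have := Ff x Ix; move/cvg_norm => h.
  rewrite -(cvg_lim _ h)//; apply: limr_le.
    by apply/cvg_ex; eexists; exact: h.
  by near=> n; exact: Fg.
rewrite fineK; last exact: integrable_fin_num.
apply: (@dominated_cvg _ _ _ mu I mI (fun n x => (F n x)%:E) (EFin \o f) (EFin \o g)) => //.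
- by move=> n; exact/measurable_EFinP.
- by move=> x Ix; apply: cvg_EFin; [exact: nearW|exact: Ff].
Unshelve. all: by end_near. Qed.

End SquareIntegrable.

(** * The fundamental theorem of calculus for weak derivatives *)

Section WeakDerivative.
Variables (R : realType) (l : R).
Hypothesis l0 : 0 < l.
Local Notation mu := (@lebesgue_measure R).
Local Notation I := (`[0%R, l]%classic : set (measurableTypeR R)).
Implicit Types (f g h phi : R -> R) (a b c x y : R).

Let mI' : measurable I. Proof. exact: mI. Qed.
Hint Resolve mI' : core.

Lemma cont_cvgM f g : {within I, continuous f} -> {within I, continuous g} ->
  {within I, continuous (fun x => f x * g x)}.
Proof. by move=> cf cg x; apply: cvgM; [exact: cf|exact: cg]. Qed.

Lemma cont_on f : continuous f -> {within I, continuous f}.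
Proof. exact: continuous_subspaceT. Qed.

Lemma Rint_derive F f : (forall x, is_derive x 1 F (f x)) -> continuous f ->
  \int[mu]_(x in I) f x = F l - F 0.
Proof.
move=> dF cf; have cF : continuous F.
  move=> x; apply: differentiable_continuous; apply/derivable1_diffP.
  by have := dF x; case.
rewrite /Rintegral (@continuous_FTC2 _ f F 0 l l0)//.
- exact: cont_on.
- split.
  + by move=> x _; have := dF x; case.
  + by apply: cvg_at_right_filter; exact: cF.
  + by apply: cvg_at_left_filter; exact: cF.
- by move=> x _; rewrite derive1E; apply: derive_val.
Qed.

Lemma Rint_tent e x : 0 < e -> 0 < x -> x + 2 * e < l ->
  \int[mu]_(t in I) tent e (t - x) = 1.
Proof.
move=> e0 x0 xl.
rewrite (@Rint_derive (fun t => step e (t - x)) (fun t => tent e (t - x)) (fun t => step_derive x t e0)).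
- by rewrite step_eq1 ?step_eq0 ?subr0//; lra.
- exact: continuous_tent.
Qed.

Lemma int_on_tent e x : int_on l (fun t => tent e (t - x)).
Proof. apply: int_on_cont; apply: cont_on; exact: continuous_tent. Qed.

(** The tents concentrate at [x] and have integral 1. *)
Lemma tent_average f x (e : nat -> R) : {within I, continuous f} -> 0 < x < l ->
  (forall n, 0 < e n) -> e n @[n --> \oo] --> 0 ->
  \int[mu]_(t in I) (f t * tent (e n) (t - x)) @[n --> \oo] --> f x.
Proof.
move=> cf /andP[x0 xl] e0 ecvg.
have cfx : {for x, continuous f}.
  have /(continuous_within_itvP _ l0)[h _ _] := cf.
  by apply: h; rewrite in_itv/= x0 xl.
apply/cvgrPdist_le => eps eps0.
have /cvgrPdist_le/(_ eps eps0) /nbhs_ballP[d /= d0 Hd] := cfx.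
near=> n.
have en : 2 * e n < d.
  have : `|0 - e n| <= d / 4.
    by near: n; move/cvgrPdist_le: ecvg; apply; rewrite divr_gt0.
  by rewrite sub0r normrN gtr0_norm//; lra.
have enl : x + 2 * e n < l.
  have : `|0 - e n| <= (l - x) / 4.
    by near: n; move/cvgrPdist_le: ecvg; apply; rewrite divr_gt0// subr_gt0.
  by rewrite sub0r normrN gtr0_norm//; lra.
have -> : f x = \int[mu]_(t in I) (f x * tent (e n) (t - x)).
  by rewrite RintegralZl// ?Rint_tent ?mulr1//; exact: int_on_tent.
have i1 : int_on l (fun t => f t * tent (e n) (t - x)).
  by apply: int_on_cont; apply: cont_cvgM => //; apply: cont_on; exact: continuous_tent.
have i2 : int_on l (fun t => f x * tent (e n) (t - x)).
  by apply: int_on_scale; exact: int_on_tent.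
have i3 : int_on l (fun t => f x * tent (e n) (t - x) - f t * tent (e n) (t - x)).
  have := int_on_lin 1 (-1) i2 i1; apply: int_on_ext => t _; lra.
rewrite -RintegralB//.
apply: (le_trans (le_normr_Rintegral _ _)) => //.
have -> : eps = \int[mu]_(t in I) (eps * tent (e n) (t - x)).
  by rewrite RintegralZl// ?Rint_tent ?mulr1//; exact: int_on_tent.
apply: Rint_le.
- by have := integrable_norm i3; apply: eq_integrable.
- by apply: int_on_scale; exact: int_on_tent.
- move=> t _; rewrite -mulrBl normrM [`|tent _ _|]ger0_norm ?tent_ge0//.
  have [tx|tx] := boolP ((t - x <= 0) || (2 * e n <= t - x)).
    by rewrite tent_out// !mulr0.
  apply: ler_wpM2r; first exact: tent_ge0.
  apply: Hd; rewrite /ball/=; move: tx; rewrite negb_or -!ltNge => /andP[h1 h2].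
  by rewrite ltr_norml; lra.
Unshelve. all: by end_near. Qed.

Lemma weak_deriv_L2 f g : is_weak_deriv l f g -> L2 l g.
Proof. by case=> /edge_Lp2P. Qed.

(** The definition of the weak derivative, tested with the smoothed indicators of
    [[x, y]]: on the left the tents tend to the point values, on the right
    dominated convergence applies. *)
Lemma weak_deriv_FTC_oo f g x y : {within I, continuous f} -> is_weak_deriv l f g ->
  0 < x -> x < y -> y < l ->
  f y - f x = \int[mu]_(t in I) (g t * (\1_(`]x, y]%classic : set R) t)).
Proof.
move=> cf fg x0 xy yl.
have Lg := weak_deriv_L2 fg.
pose e n := (l - y) / 4 * (n.+1%:R)^-1 : R.
have d0 : 0 < (l - y) / 4 by rewrite divr_gt0// subr_gt0.
have e0 n : 0 < e n by rewrite mulr_gt0// invr_gt0.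
have el n : y + 2 * e n < l.
  have : e n <= (l - y) / 4 by rewrite ler_piMr ?(ltW d0)// invf_le1// ler1n.
  by lra.
have ecvg : e n @[n --> \oo] --> 0.
  rewrite -(mulr0 ((l - y) / 4)); apply: cvgMr; exact: cvg_harmonic.
pose phi n t := step (e n) (t - x) - step (e n) (t - y).
have phiT n : test_fun l (phi n) by have [] := test_fun_steps (e0 n) x0 xy (el n).
have phiD n : derive1 (phi n) = (fun t => tent (e n) (t - x) - tent (e n) (t - y)).
  by have [] := test_fun_steps (e0 n) x0 xy (el n).
have c1 := tent_average cf _ e0 ecvg.
have H n : \int[mu]_(t in I) (f t * tent (e n) (t - x)) - \int[mu]_(t in I) (f t * tent (e n) (t - y)) = - \int[mu]_(t in I) (g t * phi n t).
  rewrite -(fg.2 _ (phiT n)) phiD -RintegralB//.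
  - by apply: Rint_ext => t _; rewrite mulrBr.
  - by apply: int_on_cont; apply: cont_cvgM => //; apply: cont_on; exact: continuous_tent.
  - by apply: int_on_cont; apply: cont_cvgM => //; apply: cont_on; exact: continuous_tent.
have L1 : (\int[mu]_(t in I) (f t * tent (e n) (t - x)) - \int[mu]_(t in I) (f t * tent (e n) (t - y))) @[n --> \oo] --> f x - f y.
  by apply: cvgB; apply: c1; lra.
have cphi n : continuous (phi n).
  move=> t; apply: differentiable_continuous; apply/derivable1_diffP.
  by have [h _ _] := phiT n; exact: h.
have L2' : (- \int[mu]_(t in I) (g t * phi n t)) @[n --> \oo] --> - \int[mu]_(t in I) (g t * (\1_(`]x, y]%classic : set R) t)).
  apply: cvgN; apply: (@Rint_dominated _ _ _ _ (fun t => `|g t|)).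
  - move=> n; apply: measurable_funM; first by case: Lg.
    by apply: int_meas; apply: int_on_cont; apply: cont_on; exact: cphi.
  - exact: L2_int (L2_norm Lg).
  - move=> n t _; rewrite normrM ler_piMr//.
    have /andP[h1 h2] := step_itv (t - x) (e0 n).
    have /andP[h3 h4] := step_itv (t - y) (e0 n).
    by rewrite ler_norml /phi; lra.
  - move=> t _; apply: cvgMr.
    have S a b : step (e n) (a - b) @[n --> \oo] --> (if b < a then 1 else 0 : R).
      case: ltP => ab.
        apply: cvg_near_cst; near=> n; rewrite step_eq1//.
        have : `|0 - e n| <= (a - b) / 2.
          by near: n; move/cvgrPdist_le: ecvg; apply; rewrite divr_gt0// subr_gt0.
        by rewrite sub0r normrN gtr0_norm//; lra.
      by apply: cvg_near_cst; near=> n; rewrite step_eq0// subr_le0.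
    have -> : \1_(`]x, y]%classic : set R) t = (if x < t then 1 else 0) - (if y < t then 1 else 0) :> R.
      rewrite indicE mem_setE in_itv/=.
      by case: (ltP x t) => h1; case: (ltP y t) => h2; rewrite /= ?subr0 ?subrr//; lra.
    by apply: cvgB; exact: S.
rewrite (funext H) in L1.
have E : f x - f y = - \int[mu]_(t in I) (g t * (\1_(`]x, y]%classic : set R) t)).
  by exact: (cvg_unique (@norm_hausdorff _ R) L1 L2').
by rewrite -opprB E opprK.
Unshelve. all: by end_near. Qed.

Lemma Rint_indic h x y : int_on l h -> 0 <= x -> y <= l ->
  \int[mu]_(t in I) (h t * (\1_(`]x, y]%classic : set R) t)) = \int[mu]_(t in `]x, y]) h t.
Proof.
move=> hh x0 yl.
have -> : (`]x, y]%classic : set R) = I `&` `]x, y].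
  apply/seteqP; split => t /=; rewrite !in_itv/=; last by case.
  by move=> /andP[h1 h2]; split; lra.
rewrite Rintegral_mkcondr; apply: eq_Rintegral => t tI.
rewrite patchE indicE in_setI tI /=.
by case: (t \in _); rewrite ?mulr1 ?mulr0.
Qed.

Lemma int_on_indic h x y : int_on l h -> int_on l (fun t => h t * (\1_(`]x, y]%classic : set R) t)).
Proof.
move=> hh; apply: int_on_le (integrable_norm hh) _.
  by apply: measurable_funM; [exact: int_meas|exact: measurable_indic].
move=> t _ /=; rewrite normrM ler_piMr//.
by rewrite indicE; case: (t \in _); rewrite ?normr1 ?normr0.
Qed.

(** The values at the ends follow by continuity. *)
Lemma cont_const_itv h : {within I, continuous h} ->
  (forall x y, 0 < x -> x < y -> y < l -> h x = h y) -> forall x, I x -> h x = h 0.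
Proof.
move=> /(continuous_within_itvP _ l0)[_ h0 hl] H x.
have Hc z : 0 < z < l -> h z = h (l / 2).
  move=> /andP[z0 zl]; have [zl2|zl2|->//] := ltgtP z (l / 2).
    by apply: H => //; lra.
  by apply/esym; apply: H => //; lra.
have E0 : h 0 = h (l / 2).
  apply: (cvg_unique (@norm_hausdorff _ R) h0).
  apply: cvg_near_cst; near=> z; apply: Hc; apply/andP; split.
    by near: z; exact: nbhs_right_gt.
  by near: z; exact: nbhs_right_lt.
have El : h l = h (l / 2).
  apply: (cvg_unique (@norm_hausdorff _ R) hl).
  apply: cvg_near_cst; near=> z; apply: Hc; apply/andP; split.
    by near: z; exact: nbhs_left_gt.
  by near: z; exact: nbhs_left_lt.
rewrite /= in_itv/= => /andP[]; rewrite !le_eqVlt => /predU1P[<-//|x0] /predU1P[->|xl].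
  by rewrite E0.
by rewrite E0; apply: Hc; rewrite x0.
Unshelve. all: by end_near. Qed.

Lemma Rint_sub h x y : int_on l h -> 0 <= x -> x <= y -> y <= l ->
  \int[mu]_(t in `[0, y]) h t - \int[mu]_(t in `[0, x]) h t = \int[mu]_(t in `]x, y]) h t.
Proof.
move=> hh x0 xy yl.
rewrite (@Rintegral_itvB R h (BLeft 0) (BRight y) x)//.
apply: (integrableS mI' (@mI R y) _ hh).
by move=> t /=; rewrite !in_itv/= => /andP[-> ]/le_trans; apply.
Qed.

(** The difference between [f] and the primitive of [g] is continuous on the
    closed edge and constant inside, hence constant. *)
Lemma weak_deriv_FTC f g x y : {within I, continuous f} -> is_weak_deriv l f g ->
  0 <= x -> x <= y -> y <= l ->
  f y - f x = \int[mu]_(t in I) (g t * (\1_(`]x, y]%classic : set R) t)).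
Proof.
move=> cf fg x0 xy yl; have ig := L2_int (weak_deriv_L2 fg).
rewrite Rint_indic// -Rint_sub//.
pose G z := \int[mu]_(t in `[0, z]) g t.
suff H z : I z -> f z - G z = f 0 - G 0.
  have := H y; have := H x; rewrite /G /= !in_itv/= => h1 h2.
  have /h1 := (introT andP (conj x0 (le_trans xy yl))).
  have /h2 := (introT andP (conj (le_trans x0 xy) yl)).
  move=> /eqP; rewrite subr_eq => /eqP -> /eqP; rewrite subr_eq => /eqP ->.
  by rewrite opprD addrACA subrr add0r.
apply: (@cont_const_itv (fun z => f z - G z)) => [u|u v u0 uv vl].
  by apply: cvgB; [exact: cf|exact: (parameterized_integral_continuous (ltW l0) ig)].
have := weak_deriv_FTC_oo cf fg u0 uv vl.
rewrite Rint_indic ?ltW// -Rint_sub ?ltW//; rewrite /G; lra.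
Qed.

Lemma Rint_indic1 x y : 0 <= x -> x <= y -> y <= l ->
  \int[mu]_(t in I) (\1_(`]x, y]%classic : set R) t) = y - x.
Proof.
move=> x0 xy yl.
have := @Rint_indic (fun=> 1) x y (@int_on_cst R l 1) x0 yl.
under eq_Rintegral do rewrite mul1r.
move=> ->; rewrite Rintegral_cst// mul1r.
have := @lebesgue_measure_itv R `]x, y]; rewrite /= lte_fin => ->.
case: ltP => //= h; have -> : x = y by [apply: le_anti; rewrite h xy].
by rewrite subrr.
Qed.

(** The Cauchy-Schwarz inequality on [[x, y]], by expanding the integral of
    [(g - c)^2]. *)
Lemma weak_deriv_hoelder f g x y : {within I, continuous f} -> is_weak_deriv l f g ->
  0 <= x -> x <= y -> y <= l ->
  (f y - f x) ^+ 2 <= (y - x) * \int[mu]_(t in I) (g t ^+ 2).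
Proof.
move=> cf fg x0; rewrite le_eqVlt => /predU1P[->|xy] yl.
  by rewrite !subrr expr0n mul0r.
have Lg := weak_deriv_L2 fg; have ig := L2_int Lg.
rewrite (weak_deriv_FTC cf fg x0 (ltW xy) yl).
set s : R -> R := \1_ _; set D := \int[mu]_(t in I) _; set T := \int[mu]_(t in I) _.
have yx : 0 < y - x by rewrite subr_gt0.
have is1 : int_on l s.
  have := @int_on_indic (fun=> 1) x y (@int_on_cst R l 1).
  by apply: int_on_ext => t _; rewrite mul1r.
(* the mean of [g] over the interval *)
pose c := D / (y - x).
have : 0 <= \int[mu]_(t in I) (1 * (1 * (g t ^+ 2) + (- (2 * c)) * (g t * s t)) + c ^+ 2 * s t).
  apply: Rintegral_ge0 => t _; rewrite /s indicE; case: (t \in _) => /=.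
    have := sqr_ge0 (g t - c); lra.
  by have := sqr_ge0 (g t); lra.
have i1 : int_on l (fun t => g t * s t) by exact: int_on_indic.
rewrite Rint_lin//; last by apply: int_on_lin => //; case: Lg.
rewrite Rint_lin//; last by case: Lg.
rewrite (Rint_indic1 x0 (ltW xy) yl) -/T -/D.
have -> : 1 * (1 * T + - (2 * c) * D) + c ^+ 2 * (y - x) = T - D ^+ 2 / (y - x).
  by rewrite /c; field; rewrite gt_eqF.
by rewrite subr_ge0 ler_pdivrMr// mulrC.
Qed.

(** The difference of two weak derivatives has zero integral over every interval
    [[0, y]], so by Lebesgue differentiation it vanishes almost everywhere. *)
Lemma weak_deriv_unique f g1 g2 : {within I, continuous f} ->
  is_weak_deriv l f g1 -> is_weak_deriv l f g2 -> ae_eq mu I g1 g2.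
Proof.
move=> cf fg1 fg2.
have i1 := L2_int (weak_deriv_L2 fg1); have i2 := L2_int (weak_deriv_L2 fg2).
pose h := fun t => 1 * g1 t + (- 1) * g2 t.
have ih : int_on l h by exact: int_on_lin.
have ihT : mu.-integrable setT (EFin \o (h \_ I)).
  by rewrite -restrict_EFin; have /(integrable_mkcond _ mI') := ih.
have F0 x : \int[mu]_(t in `]-oo, x]) ((h \_ I) t) = 0.
  rewrite -Rintegral_mkcondr.
  have Z y : 0 <= y -> y <= l -> \int[mu]_(t in `[0, y]) h t = 0.
    move=> y0 yl; have := Rint_sub ih (lexx 0) y0 yl.
    rewrite set_itv1 Rintegral_set1 subr0 => ->.
    rewrite -Rint_indic//.
    have := weak_deriv_FTC cf fg1 (lexx 0) y0 yl.
    rewrite (weak_deriv_FTC cf fg2 (lexx 0) y0 yl) => E.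
    transitivity (\int[mu]_(t in I) (1 * (g1 t * (\1_(`]0, y]%classic : set R) t)) + -1 * (g2 t * (\1_(`]0, y]%classic : set R) t)))).
      by apply: Rint_ext => t _; rewrite /h; ring.
    by rewrite Rint_lin ?E; [lra|exact: int_on_indic..].
  have [x0|x0] := ltP x 0.
    rewrite (_ : _ `&` _ = set0) ?Rintegral_set0//.
    by apply/seteqP; split => t //=; rewrite !in_itv/=; lra.
  have [xl|xl] := leP x l.
    rewrite (_ : _ `&` _ = `[0, x]%classic) ?Z//.
    by apply/seteqP; split => t /=; rewrite !in_itv/=; lra.
  rewrite (_ : _ `&` _ = `[0, l]%classic) ?Z// ?ltW//.
  by apply/seteqP; split => t /=; rewrite !in_itv/=; lra.
have := @FTC1Ny R (h \_ I) _ _.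
case.
- by move=> y; apply: integrableS ihT => //.
- exact: (integrable_locally mI' ih).
move=> N [mN N0 HN]; exists N; split => //; apply: subset_trans HN => t /= H1 H2.
apply: H1 => It; have [_] := H2.
rewrite patchE mem_set// /h.
have -> : (fun x => \int[mu]_(t in `]-oo, x]) ((h \_ I) t)) = cst 0.
  by apply/funext => x; exact: F0.
by rewrite derive1_cst; lra.
Qed.

End WeakDerivative.

(** * Powers, and mass, kinetic and potential integrals on an edge *)

Section PowerFunction.
Variables (R : realType) (p : R).
Hypotheses (p_gt2 : 2 < p) (p_lt6 : p < 6).
Implicit Types (x y K c : R).

Lemma powR_le_mono q x y : 0 <= q -> 0 <= x -> x <= y -> x `^ q <= y `^ q.
Proof.
move=> q0 x0 xy; apply: ge0_ler_powR => //; rewrite nnegrE//.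
exact: le_trans xy.
Qed.

Lemma powR_le_sqr x K : `|x| <= K -> `|x| `^ p <= K `^ (p - 2) * x ^+ 2.
Proof.
move=> xK; have K0 : 0 <= K by apply: le_trans xK.
have [->|x0] := eqVneq x 0.
  by rewrite normr0 powR0 ?expr0n ?mulr0// gt_eqF// (lt_trans _ p_gt2).
have -> : `|x| `^ p = `|x| `^ (p - 2) * x ^+ 2.
  rewrite -[in RHS](real_normK (num_real x)) -(powR_mulrn 2 (normr_ge0 x)) -powRD ?subrK//.
  by rewrite normr_eq0 (negbTE x0) implybT.
by rewrite ler_wpM2r ?sqr_ge0// powR_le_mono// subr_ge0 ltW.
Qed.

(** By the mean value theorem the constant would be [p]; any constant serves, and
    6 has an elementary proof.  It is enough to treat [|y| <= |x|] and, by
    homogeneity, to compare [1 - t `^ p] with [1 - t] for [t] in [[0, 1]]. *)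
Lemma powR_sub_le x y K : `|x| <= K ->
  `|x| `^ p - `|y| `^ p <= 6 * K `^ (p - 2) * (`|x| * `|x - y|).
Proof.
move=> xK; have K0 : 0 <= K by apply: le_trans xK.
have RHS0 : 0 <= 6 * K `^ (p - 2) * (`|x| * `|x - y|).
  by rewrite !mulr_ge0// powR_ge0.
have [xy|yx] := leP `|x| `|y|.
  apply: le_trans RHS0; rewrite subr_le0; apply: ge0_ler_powR; rewrite ?nnegrE//.
  by apply: ltW; exact: lt_trans p_gt2.
have x0 : 0 < `|x| by apply: le_lt_trans yx.
pose t := `|y| / `|x|.
have t0 : 0 <= t by rewrite divr_ge0.
have t1 : t <= 1 by rewrite ler_pdivrMr// mul1r ltW.
have yE : `|y| = `|x| * t by rewrite /t mulrC divfK// gt_eqF.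
(* [p < 6] and [t <= 1] reduce the claim to an integer exponent *)
have t6 : t ^+ 6 <= t `^ p.
  have [->|tn0] := eqVneq t 0; first by rewrite expr0n powR_ge0.
  rewrite -powR_mulrn//; apply: ger_powR; [|exact: ltW].
  by rewrite lt_neqAle eq_sym tn0 t0.
rewrite yE powRM// -{1}[`|x| `^ p]mulr1 -mulrBr.
have h1 : 1 - t `^ p <= 6 * (1 - t).
  have : 1 - t ^+ 6 <= 6 * (1 - t).
    have [t2 t3 t4] : [/\ 0 <= t ^+ 2 <= 1, 0 <= t ^+ 3 <= 1 & 0 <= t ^+ 4 <= 1].
      by split; rewrite exprn_ge0// exprn_ile1.
    have t5 : 0 <= t ^+ 5 <= 1 by rewrite exprn_ge0// exprn_ile1.
    have -> : 1 - t ^+ 6 = (1 - t) * (1 + t + t ^+ 2 + t ^+ 3 + t ^+ 4 + t ^+ 5) by ring.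
    rewrite mulrC ler_wpM2r ?subr_ge0//; lra.
  by lra.
have h2 : `|x| `^ p <= K `^ (p - 2) * `|x| ^+ 2.
  by have := powR_le_sqr xK; rewrite -[in X in _ <= _ * X](real_normK (num_real x)).
have h3 : `|x| * (1 - t) <= `|x - y|.
  by rewrite mulrBr mulr1 -yE; apply: (le_trans (ler_norm _)); rewrite ler_dist_dist.
apply: (le_trans (ler_wpM2l (powR_ge0 _ _) h1)).
apply: (@le_trans _ _ (K `^ (p - 2) * `|x| ^+ 2 * (6 * (1 - t)))).
  by rewrite ler_wpM2r// mulr_ge0// subr_ge0.
have -> : K `^ (p - 2) * `|x| ^+ 2 * (6 * (1 - t)) = 6 * K `^ (p - 2) * (`|x| * (`|x| * (1 - t))) by ring.
by rewrite ler_wpM2l ?mulr_ge0 ?powR_ge0// ler_wpM2l.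
Qed.

(** The difference bound [powR_sub_le] is a local Lipschitz bound. *)
Lemma continuous_powR_norm : continuous (fun x => `|x| `^ p).
Proof.
move=> x; apply/cvgrPdist_le => e e0.
pose K := `|x| + 1.
pose C := 6 * K `^ (p - 2) * K.
have C0 : 0 <= C by rewrite !mulr_ge0 ?powR_ge0// addr_ge0.
near=> y.
have yx : `|x - y| <= 1.
  by near: y; apply/nbhs_ballP; exists 1 => //= z; rewrite /ball/= => /ltW.
have yC : `|x - y| * C <= e.
  rewrite (@le_trans _ _ (`|x - y| * (C + 1)))// ?ler_wpM2l ?lerDl//.
  rewrite -ler_pdivlMr ?ltr_wpDl//.
  near: y; apply/nbhs_ballP; exists (e / (C + 1)) => /=; first by rewrite divr_gt0 ?ltr_wpDl.
  by move=> z; rewrite /ball/= => /ltW.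
have xK : `|x| <= K by rewrite lerDl.
have yK : `|y| <= K.
  by rewrite -lerBlDl; apply: le_trans (lerB_dist _ _) _; rewrite distrC.
have h1 := powR_sub_le y xK; have h2 := powR_sub_le x yK.
have c0 : 0 <= 6 * K `^ (p - 2) by rewrite mulr_ge0 ?powR_ge0.
have h3 (z : R) : `|z| <= K -> 6 * K `^ (p - 2) * (`|z| * `|x - y|) <= `|x - y| * C.
  move=> zK; apply: le_trans (ler_wpM2l c0 (ler_wpM2r (normr_ge0 _) zK)) _.
  by rewrite /C mulrA mulrC.
have := h3 _ xK; have := h3 _ yK.
rewrite distrC in h2.
by rewrite ler_norml; lra.
Unshelve. all: by end_near. Qed.

End PowerFunction.

Section EdgeFunctionals.
Variables (R : realType) (l : R).
Hypothesis l0 : 0 < l.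
Local Notation mu := (@lebesgue_measure R).
Local Notation I := (`[0%R, l]%classic : set (measurableTypeR R)).
Implicit Types (f g h phi : R -> R) (a b c x y : R).

Let mI' : measurable I. Proof. exact: mI. Qed.
Hint Resolve mI' : core.

(** The functions of [H^1] on an edge, represented by their continuous version. *)
Definition H1_edge f := {within I, continuous f} /\ exists g, is_weak_deriv l f g.
(** The three integrals of an edge: mass [sqint], kinetic [dsqint] and
    potential [powint]. *)
Definition sqint f := \int[mu]_(x in I) (f x ^+ 2).
Definition dsqint f := sqint (weak_deriv l f).
Definition powint p f := \int[mu]_(x in I) (`|f x| `^ p).

Lemma weak_derivP f : H1_edge f -> is_weak_deriv l f (weak_deriv l f).
Proof. by case=> _ [g fg]; apply: (@xgetPex _ (cst 0) [set g | is_weak_deriv l f g]); exists g. Qed.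

(** The value does not depend on the choice made by [weak_deriv], by uniqueness. *)
Lemma dsqintE f g : {within I, continuous f} -> is_weak_deriv l f g -> dsqint f = sqint g.
Proof.
move=> cf fg; have fg' : is_weak_deriv l f (weak_deriv l f) by apply: weak_derivP; split => //; exists g.
have h := weak_deriv_unique l0 cf fg' fg.
have [m1 _] := weak_deriv_L2 fg'; have [m2 _] := weak_deriv_L2 fg.
rewrite /dsqint /sqint; congr fine; apply: ae_eq_integral => //.
- by apply/measurable_EFinP; exact: measurable_funX.
- by apply/measurable_EFinP; exact: measurable_funX.
- by case: h => N [mN N0 HN]; exists N; split => //; apply: subset_trans HN => t /= H1 H2; apply: H1 => It; rewrite H2.
Qed.

Lemma sqint_ge0 f : 0 <= sqint f.
Proof. by apply: Rintegral_ge0 => x _; exact: sqr_ge0. Qed.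

Lemma dsqint_ge0 f : 0 <= dsqint f. Proof. exact: sqint_ge0. Qed.

Lemma powint_ge0 p f : 0 <= powint p f.
Proof. by apply: Rintegral_ge0 => x _; exact: powR_ge0. Qed.

Lemma H1_edge_L2 f : H1_edge f -> L2 l f.
Proof. by case=> cf _; exact: L2_cont. Qed.

Lemma H1_edge_L2d f : H1_edge f -> L2 l (weak_deriv l f).
Proof. by move=> hf; apply: weak_deriv_L2; exact: weak_derivP. Qed.

(** Squared norms are quadratic forms.  Only the existence of the mixed
    coefficient [X] is recorded: the inequalities below are obtained by
    eliminating it between two values of [(a, b)]. *)
Lemma L2_quadratic f g : L2 l f -> L2 l g ->
  exists X, forall a b, sqint (fun x => a * f x + b * g x) = a ^+ 2 * sqint f + 2 * a * b * X + b ^+ 2 * sqint g.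
Proof.
move=> hf hg; exists (\int[mu]_(x in I) (f x * g x)) => a b; rewrite /sqint.
transitivity (\int[mu]_(x in I) (1 * (a ^+ 2 * f x ^+ 2 + b ^+ 2 * g x ^+ 2) + 1 * (2 * a * b * (f x * g x)))).
  by apply: Rint_ext => x _; ring.
rewrite Rint_lin; [|exact: int_on_lin hf.2 hg.2|exact/int_on_scale/L2_mul].
rewrite (Rint_lin _ _ hf.2 hg.2) RintegralZl//; last exact: L2_mul.
by rewrite !mul1r addrAC.
Qed.

Lemma test_fun_cont phi : test_fun l phi -> continuous phi.
Proof.
by case=> h _ _ t; apply: differentiable_continuous; apply/derivable1_diffP; exact: h.
Qed.

Lemma weak_deriv_lin a b f1 f2 g1 g2 : L2 l f1 -> L2 l f2 ->
  is_weak_deriv l f1 g1 -> is_weak_deriv l f2 g2 ->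
  is_weak_deriv l (fun x => a * f1 x + b * f2 x) (fun x => a * g1 x + b * g2 x).
Proof.
move=> hf1 hf2 fg1 fg2; have hg1 := weak_deriv_L2 fg1; have hg2 := weak_deriv_L2 fg2.
split; first by apply/edge_Lp2P; exact: L2_lin.
move=> phi tphi; have cphi := L2_cont (@cont_on R l _ (test_fun_cont tphi)).
have cdphi : L2 l (derive1 phi) by apply: L2_cont; apply: cont_on; case: tphi.
transitivity (\int[mu]_(x in I) (a * (f1 x * derive1 phi x) + b * (f2 x * derive1 phi x))).
  by apply: Rint_ext => x _; ring.
rewrite Rint_lin; [|exact: L2_mul..].
transitivity (- \int[mu]_(x in I) (a * (g1 x * phi x) + b * (g2 x * phi x))); last first.
  by congr (- _); apply: Rint_ext => x _; ring.
rewrite Rint_lin; [|exact: L2_mul..].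
by rewrite fg1.2// fg2.2//; ring.
Qed.

Lemma H1_edge_lin a b f g : H1_edge f -> H1_edge g -> H1_edge (fun x => a * f x + b * g x).
Proof.
move=> hf hg; split.
  by move=> x; apply: cvgD; (apply: cvgM; [exact: cvg_cst|]); [exact: hf.1|exact: hg.1].
exists (fun x => a * weak_deriv l f x + b * weak_deriv l g x).
by apply: weak_deriv_lin; [exact: H1_edge_L2|exact: H1_edge_L2|exact: weak_derivP|exact: weak_derivP].
Qed.

Lemma dsqint_quadratic f g : H1_edge f -> H1_edge g ->
  exists X, forall a b, dsqint (fun x => a * f x + b * g x) = a ^+ 2 * dsqint f + 2 * a * b * X + b ^+ 2 * dsqint g.
Proof.
move=> hf hg; have [X HX] := L2_quadratic (H1_edge_L2d hf) (H1_edge_L2d hg).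
exists X => a b; rewrite -HX; apply: dsqintE; first by case: (H1_edge_lin a b hf hg).
by apply: weak_deriv_lin; [exact: H1_edge_L2|exact: H1_edge_L2|exact: weak_derivP|exact: weak_derivP].
Qed.

Lemma sqint_quadratic f g : H1_edge f -> H1_edge g ->
  exists X, forall a b, sqint (fun x => a * f x + b * g x) = a ^+ 2 * sqint f + 2 * a * b * X + b ^+ 2 * sqint g.
Proof. by move=> hf hg; apply: L2_quadratic; exact: H1_edge_L2. Qed.

(** A test function vanishes at both ends of the edge, so its derivative has zero
    integral. *)
Lemma weak_deriv_cst1 : is_weak_deriv l (fun=> 1) (fun=> 0).
Proof.
split; first by apply/edge_Lp2P; exact: L2_cst.
move=> phi tphi.
have -> : \int[mu]_(x in I) (0 * phi x) = 0.
  by under eq_Rintegral do rewrite mul0r; rewrite Rint_cst ?mul0r// ltW.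
under eq_Rintegral do rewrite mul1r.
have [d cd [a [b [a0 bl out]]]] := tphi.
have dphi x : is_derive x 1 phi (derive1 phi x) by rewrite derive1E; apply: DeriveDef.
rewrite (Rint_derive l0 dphi cd).
by rewrite !out ?subrr ?oppr0// in_itv/= negb_and -!ltNge ?a0 ?bl ?orbT.
Qed.

Lemma H1_edge_cst1 : H1_edge (fun=> 1).
Proof.
split; first by apply: cont_on => x; exact: cvg_cst.
by exists (fun=> 0); exact: weak_deriv_cst1.
Qed.

(** The product of a test function with an affine function is again a test
    function, so the Leibniz rule for it gives the one for [f]. *)
Lemma weak_deriv_affine a b f g : L2 l f -> is_weak_deriv l f g ->
  is_weak_deriv l (fun x => (a + b * x) * f x) (fun x => 1 * ((a + b * x) * g x) + b * f x).
Proof.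
move=> hf fg; have hg := weak_deriv_L2 fg.
have dal (t : R) : is_derive t 1 (fun x => a + b * x) b.
  apply: (@is_derive_quadratic_error _ _ _ _ 0) => h.
  by rewrite mul0r (_ : _ - _ = 0) ?normr0//; ring.
have cal : continuous (fun x => a + b * x).
  by move=> t; apply: differentiable_continuous; apply/derivable1_diffP; have := dal t; case.
have mal := int_meas (int_on_cont (@cont_on R l _ cal)).
have [C alC] : exists C, forall x, I x -> `|a + b * x| <= C.
  exists (`|a| + `|b| * l) => x /=; rewrite in_itv/= => /andP[x0 xl].
  by apply: (le_trans (ler_normD _ _)); rewrite lerD2l normrM ler_wpM2l// ger0_norm.
have hag : L2 l (fun x => (a + b * x) * g x) by exact: L2_bounded alC.
split.
  by apply/edge_Lp2P; apply: L2_lin.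
move=> phi tphi; have cphi := test_fun_cont tphi.
have [dphi cdphi [u [v [u0 vl out]]]] := tphi.
have D (t : R) : is_derive t 1 (fun x => (a + b * x) * phi x) ((a + b * t) * derive1 phi t + phi t * b).
  have h1 : is_derive t 1 phi (derive1 phi t) by rewrite derive1E; apply: DeriveDef.
  have h2 := dal t; exact: (@is_deriveM _ _ (fun x => a + b * x) phi).
have DE : derive1 (fun x => (a + b * x) * phi x) = (fun t => (a + b * t) * derive1 phi t + phi t * b).
  by apply/funext => t; rewrite derive1E; have := D t; case.
have T : test_fun l (fun x => (a + b * x) * phi x).
  split.
  - by move=> t; have := D t; case.
  - rewrite DE => t; apply: cvgD; first by apply: cvgM; [exact: cal|exact: cdphi].
    by apply: cvgM; [exact: cphi|exact: cvg_cst].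
  - by exists u, v; split => // t /out ->; rewrite mulr0.
have := fg.2 _ T; rewrite DE.
have i1 : int_on l (fun x => (a + b * x) * f x * derive1 phi x).
  by apply: L2_mul; [exact: L2_bounded alC|apply: L2_cont; exact: cont_on].
have i2 : int_on l (fun x => f x * phi x).
  by apply: L2_mul => //; apply: L2_cont; exact: cont_on.
have i3 : int_on l (fun x => (a + b * x) * g x * phi x).
  by apply: L2_mul => //; apply: L2_cont; exact: cont_on.
have -> : \int[mu]_(x in I) (f x * ((a + b * x) * derive1 phi x + phi x * b)) =
  \int[mu]_(x in I) (1 * ((a + b * x) * f x * derive1 phi x) + b * (f x * phi x)).
  by apply: Rint_ext => x _; ring.
have -> : \int[mu]_(x in I) (g x * ((a + b * x) * phi x)) = \int[mu]_(x in I) ((a + b * x) * g x * phi x).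
  by apply: Rint_ext => x _; ring.
have -> : \int[mu]_(x in I) ((1 * ((a + b * x) * g x) + b * f x) * phi x) =
  \int[mu]_(x in I) (1 * ((a + b * x) * g x * phi x) + b * (f x * phi x)).
  by apply: Rint_ext => x _; ring.
rewrite !Rint_lin// => H.
rewrite !mul1r opprD -H mul1r; ring.
Qed.

Lemma H1_edge_affineM a b f : H1_edge f -> H1_edge (fun x => (a + b * x) * f x).
Proof.
move=> hf; split.
  apply: cont_cvgM; last by case: hf.
  apply: cont_on => t; apply: cvgD; first exact: cvg_cst.
  by apply: cvgM; [exact: cvg_cst|exact: cvg_id].
by eexists; apply: weak_deriv_affine; [exact: H1_edge_L2|exact: weak_derivP].
Qed.

Lemma H1_edge_affine a b : H1_edge (fun x => a + b * x).
Proof.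
by have := H1_edge_affineM a b H1_edge_cst1; under eq_fun do rewrite mulr1.
Qed.

End EdgeFunctionals.

(** * Estimates on an edge *)

Section EdgeEstimates.
Variables (R : realType) (l : R).
Hypothesis l0 : 0 < l.
Local Notation mu := (@lebesgue_measure R).
Local Notation I := (`[0%R, l]%classic : set (measurableTypeR R)).
Local Notation meas := (@measurable_fun _ _ (measurableTypeR R) R I).
Local Notation eM := (sqint l).
Local Notation eT := (dsqint l).
Local Notation eP := (powint l).
Local Notation edge_ok := (H1_edge l).
Implicit Types (f g h phi : R -> R) (a b c x y K d p : R).

Let mI' : measurable I. Proof. exact: mI. Qed.
Hint Resolve mI' : core.

Lemma edge_itvP x : I x <-> 0 <= x <= l.
Proof. by rewrite /= in_itv. Qed.

Lemma sqint_int f : edge_ok f -> int_on l (fun x => f x ^+ 2).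
Proof. by move=> /H1_edge_L2; case. Qed.

Lemma H1_edge_holder f x y : edge_ok f -> 0 <= x <= l -> 0 <= y <= l ->
  (f y - f x) ^+ 2 <= `|y - x| * eT f.
Proof.
move=> hf /andP[x0 xl] /andP[y0 yl].
have [xy|yx] := leP x y.
  rewrite ger0_norm ?subr_ge0//.
  exact: (weak_deriv_hoelder l0 hf.1 (weak_derivP hf)).
rewrite ltr0_norm ?subr_lt0// opprB -sqrrN opprB.
exact: (weak_deriv_hoelder l0 hf.1 (weak_derivP hf) _ (ltW yx)).
Qed.

(** Used to average over points near [x] when [x] may be close to an end of the
    edge. *)
Lemma subinterval x d : 0 <= x <= l -> 0 < d -> d <= l ->
  exists a, [/\ 0 <= a, a + d <= l & forall y, a < y <= a + d -> `|x - y| <= d].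
Proof.
move=> /andP[x0 xl] d0 dl; have [h|h] := leP x (l - d).
  exists x; split => //; first lra.
  by move=> y /andP[h1 h2]; rewrite ler_norml; lra.
exists (l - d); split; [lra|lra|].
by move=> y /andP[h1 h2]; rewrite ler_norml; lra.
Qed.

Lemma Rint_subinterval a d : 0 <= a -> 0 < d -> a + d <= l ->
  \int[mu]_(t in I) (\1_(`]a, a + d]%classic : set R) t) = d.
Proof.
move=> a0 d0 adl; have aad : a <= a + d by rewrite lerDl ltW.
rewrite (Rint_indic1 a0 aad adl).
by rewrite addrC addKr.
Qed.

Lemma int_on_indic1 a b : int_on l (\1_(`]a, b]%classic : set R)).
Proof.
have := @int_on_indic R l (fun=> 1) a b (@int_on_cst R l 1).
by apply: int_on_ext => t _; rewrite mul1r.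
Qed.

(** Average the bound [f x ^2 <= 2 f t ^2 + 2 (f x - f t)^2] over an interval of
    length [d] that has distance at most [d] from [x]. *)
Lemma H1_edge_sup f x d : edge_ok f -> 0 <= x <= l -> 0 < d -> d <= l ->
  f x ^+ 2 <= 2 * eM f / d + 2 * d * eT f.
Proof.
move=> hf xI d0 dl; have [a [a0 adl Ha]] := subinterval xI d0 dl.
have h1 : \int[mu]_(t in I) (f x ^+ 2 * (\1_(`]a, a + d]%classic : set R) t)) <=
   \int[mu]_(t in I) (2 * f t ^+ 2 + (2 * d * eT f) * (\1_(`]a, a + d]%classic : set R) t)).
  apply: Rint_le.
  - by apply: int_on_scale; exact: int_on_indic1.
  - by apply: int_on_lin; [exact: sqint_int|exact: int_on_indic1].
  - move=> t It; rewrite indicE mem_setE; case: (boolP (t \in _)) => /= tad.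
      have tI : 0 <= t <= l by apply/edge_itvP.
      have := H1_edge_holder hf tI xI.
      have := Ha t; rewrite in_itv/= in tad; move=> /(_ tad) h2.
      have := ler_wpM2r (dsqint_ge0 l f) h2.
      rewrite !mulr1.
      have : 0 <= (f x - 2 * f t) ^+ 2 by exact: sqr_ge0.
      nra.
    by rewrite !mulr0 addr0 mulr_ge0 ?sqr_ge0.
move: h1; rewrite RintegralZl//; last exact: int_on_indic1.
rewrite Rint_lin//; [|exact: sqint_int|exact: int_on_indic1].
rewrite Rint_subinterval// -/(sqint l f) => h1.
rewrite -(ler_pM2r d0) mulrDl divfK ?gt_eqF//; lra.
Qed.

Lemma powR_int p f : 2 < p -> p < 6 -> edge_ok f -> int_on l (fun x => `|f x| `^ p).
Proof.
move=> p2 p6 hf; apply: int_on_cont => x.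
apply: (@continuous_comp _ _ _ (f : subspace I -> R) (fun x => `|x| `^ p)).
  by case: hf => + _; apply.
exact: continuous_powR_norm.
Qed.

Lemma powint_le p f K : 2 < p -> p < 6 -> edge_ok f -> (forall x, 0 <= x <= l -> `|f x| <= K) ->
  eP p f <= K `^ (p - 2) * eM f.
Proof.
move=> p2 p6 hf fK; rewrite /sqint -RintegralZl//; last exact: sqint_int.
apply: Rint_le.
- exact: powR_int.
- by apply: int_on_scale; exact: sqint_int.
- by move=> x /edge_itvP /fK; exact: powR_le_sqr.
Qed.

(** The potential is continuous for the mass norm on functions with a common
    bound: [powR_sub_le] gives a factor [|f| |f - h|], which is split with
    weight [c]. *)
Lemma powint_sub_le p f h K c : 2 < p -> p < 6 -> edge_ok f -> edge_ok h -> 0 < c ->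
  (forall x, 0 <= x <= l -> `|f x| <= K) ->
  eP p f <= eP p h + 3 * K `^ (p - 2) * (c * eM f + eM (fun x => 1 * f x + -1 * h x) / c).
Proof.
move=> p2 p6 hf hh c0 fK; have hfh := H1_edge_lin 1 (-1) hf hh.
pose C := 3 * K `^ (p - 2).
have C0 : 0 <= C by rewrite mulr_ge0 ?powR_ge0.
rewrite [_ / c]mulrC -/C.
have -> : eP p h + C * (c * eM f + c^-1 * eM (fun x => 1 * f x + -1 * h x)) =
  \int[mu]_(x in I) (1 * `|h x| `^ p + C * (c * f x ^+ 2 + c^-1 * (1 * f x + -1 * h x) ^+ 2)).
  rewrite Rint_lin; [|exact: powR_int|by apply: int_on_lin; exact: sqint_int].
  by rewrite mul1r Rint_lin//; exact: sqint_int.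
apply: Rint_le.
- exact: powR_int.
- by apply: int_on_lin; [exact: powR_int|apply: int_on_lin; exact: sqint_int].
- move=> x /edge_itvP /fK fxK; have := powR_sub_le p2 p6 (h x) fxK.
  have -> : 1 * f x + -1 * h x = f x - h x by ring.
  suff : 6 * K `^ (p - 2) * (`|f x| * `|f x - h x|) <= C * (c * f x ^+ 2 + c^-1 * (f x - h x) ^+ 2) by lra.
  have -> : 6 * K `^ (p - 2) * (`|f x| * `|f x - h x|) = C * (2 * (`|f x| * `|f x - h x|)) by rewrite /C; ring.
  rewrite ler_wpM2l// -(real_normK (num_real (f x))) -(real_normK (num_real (f x - h x))).
  set u := `|f x|; set v := `|_ - _|.
  rewrite -subr_ge0.
  have -> : c * u ^+ 2 + c^-1 * v ^+ 2 - 2 * (u * v) = (c * u - v) ^+ 2 / c by field; rewrite gt_eqF.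
  by rewrite divr_ge0 ?sqr_ge0// ltW.
Qed.

Lemma powint_scale p f a : 2 < p -> p < 6 -> edge_ok f -> 0 <= a ->
  eP p (fun x => a * f x + 0 * f x) = a `^ p * eP p f.
Proof.
move=> p2 p6 hf a0; rewrite /powint -RintegralZl//; last exact: powR_int.
by apply: Rint_ext => x _; rewrite mul0r addr0 normrM powRM// ger0_norm.
Qed.

(** By the Hoelder bound [f] stays above [c] on a subinterval of length [d]. *)
Lemma powint_ge_sub p f x d c : 2 < p -> p < 6 -> edge_ok f -> 0 <= x <= l -> 0 < d -> d <= l ->
  0 <= c -> 2 * c <= `|f x| -> d * eT f <= c ^+ 2 -> c `^ p * d <= eP p f.
Proof.
move=> p2 p6 hf xI d0 dl c0 fxc dT; have [a [a0 adl Ha]] := subinterval xI d0 dl.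
rewrite -{1}(Rint_subinterval a0 d0 adl) -RintegralZl//; last exact: int_on_indic1.
apply: Rint_le.
- by apply: int_on_scale; exact: int_on_indic1.
- exact: powR_int.
- move=> t It; rewrite indicE mem_setE; case: (boolP (t \in _)) => /= tad; last first.
    by rewrite mulr0 powR_ge0.
  have tI : 0 <= t <= l by apply/edge_itvP.
  rewrite mulr1 powR_le_mono//; first by lra.
  have := H1_edge_holder hf tI xI.
  have := Ha t; rewrite in_itv/= in tad; move=> /(_ tad) h2.
  have h3 := ler_wpM2r (dsqint_ge0 l f) h2.
  move=> h4; have h5 : `|f x - f t| ^+ 2 <= c ^+ 2 by rewrite real_normK ?num_real//; lra.
  have h6 : `|f x - f t| <= c by move: h5; rewrite ler_pXn2r ?nnegrE.
  have := ler_distD 0 (f x) (f t); rewrite subr0 sub0r normrN.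
  have := lerB_dist (f x) (f t); lra.
Qed.

Lemma powint_ge p f c : 2 < p -> p < 6 -> edge_ok f -> 0 <= c ->
  (forall x, 0 <= x <= l -> c <= `|f x|) -> c `^ p * l <= eP p f.
Proof.
move=> p2 p6 hf c0 fc; rewrite -(Rint_cst _ (ltW l0)); apply: Rint_le.
- exact: int_on_cst.
- exact: powR_int.
- by move=> x /edge_itvP /fc; apply: powR_le_mono => //; lra.
Qed.

Lemma sqint_ge f c : edge_ok f -> 0 <= c ->
  (forall x, 0 <= x <= l -> c <= `|f x|) -> c ^+ 2 * l <= eM f.
Proof.
move=> hf c0 fc; rewrite -(Rint_cst _ (ltW l0)); apply: Rint_le.
- exact: int_on_cst.
- exact: sqint_int.
- by move=> x /edge_itvP /fc h; rewrite -(real_normK (num_real (f x))) ler_pXn2r ?nnegrE.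
Qed.

Lemma sqint_le f K : edge_ok f -> (forall x, 0 <= x <= l -> `|f x| <= K) -> eM f <= K ^+ 2 * l.
Proof.
move=> hf fK; rewrite -(Rint_cst _ (ltW l0)); apply: Rint_le.
- exact: sqint_int.
- exact: int_on_cst.
- move=> x /edge_itvP /fK h; rewrite -(real_normK (num_real (f x))) ler_pXn2r ?nnegrE//.
  exact: le_trans h.
Qed.

Section Cutoff.
Variables (a b : R) (f : R -> R).
Hypothesis hf : edge_ok f.
Hypothesis ab01 : forall x, 0 <= x <= l -> 0 <= a + b * x <= 1.

(** Pointwise, [t^2 + (1 - t)^2 <= 1] for [t] in [[0, 1]]. *)
Lemma sqint_cut : eM (fun x => (a + b * x) * f x) + eM (fun x => ((1 - a) + - b * x) * f x) <= eM f.
Proof.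
have h1 := H1_edge_affineM a b hf; have h2 := H1_edge_affineM (1 - a) (- b) hf.
have := Rint_lin 1 1 (sqint_int h1) (sqint_int h2); rewrite !mul1r => <-.
apply: Rint_le.
- by apply: int_on_lin; exact: sqint_int.
- exact: sqint_int.
- move=> x /edge_itvP /ab01 /andP[h3 h4]; rewrite !mul1r !exprMn -mulrDl.
  rewrite ler_piMl ?sqr_ge0//.
  have -> : 1 - a + - b * x = 1 - (a + b * x) by ring.
  nra.
Qed.

(** By the Leibniz rule and [(s + t)^2 <= 2 s^2 + 2 t^2]. *)
Lemma dsqint_cut : eT (fun x => (a + b * x) * f x) <= 2 * eT f + 2 * b ^+ 2 * eM f.
Proof.
have h1 := H1_edge_affineM a b hf.
rewrite (dsqintE l0 h1.1 (weak_deriv_affine a b (H1_edge_L2 hf) (weak_derivP hf))).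
have hd := H1_edge_L2d hf.
rewrite /dsqint -Rint_lin; [|by case: hd|exact: sqint_int].
have := weak_deriv_L2 (weak_deriv_affine a b (H1_edge_L2 hf) (weak_derivP hf)).
case=> _ i1; apply: Rint_le => //.
- by apply: int_on_lin; [case: hd|exact: sqint_int].
- move=> x /edge_itvP /ab01 /andP[h3 h4]; rewrite mul1r.
  set u := a + b * x in h3 h4 *; set v := weak_deriv l f x.
  have : 0 <= (u * v - b * f x) ^+ 2 by exact: sqr_ge0.
  have : 0 <= (1 - u ^+ 2) * v ^+ 2 by rewrite mulr_ge0 ?sqr_ge0// subr_ge0 exprn_ile1.
  lra.
Qed.

End Cutoff.

Lemma dsqint_affine a b : eT (fun x => a + b * x) = b ^+ 2 * l.
Proof.
have h1 := H1_edge_affine l0 a b.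
have := weak_deriv_affine a b (L2_cst l 1) (weak_deriv_cst1 l0).
have -> : (fun x => (a + b * x) * 1) = (fun x => a + b * x) by apply/funext => x; rewrite mulr1.
move=> w; rewrite (dsqintE l0 h1.1 w) /sqint -(Rint_cst _ (ltW l0)).
by apply: Rint_ext => x _; ring.
Qed.

(** Elimination of the mixed coefficient between the vectors [f - g] and
    [f - (1 + c) g]; the second has nonnegative square. *)
Lemma quadratic_sub_le (A B X q1 q2 c : R) : 0 < c -> 0 <= q2 ->
  q2 = 1 ^+ 2 * A + 2 * 1 * - (1 + c) * X + (- (1 + c)) ^+ 2 * B ->
  q1 = 1 ^+ 2 * A + 2 * 1 * -1 * X + (-1) ^+ 2 * B ->
  A <= (1 + c) * B + (1 + c^-1) * q1.
Proof.
move=> c0 q20 h2 h1; rewrite -subr_ge0.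
have -> : (1 + c) * B + (1 + c^-1) * q1 - A = q2 / c by rewrite h2 h1; field; rewrite gt_eqF.
by rewrite divr_ge0// ltW.
Qed.

(** A substitute for the triangle inequality: as [c] is arbitrary, it passes to the
    limit when [g] tends to [f]. *)
Lemma dsqint_sub_le f g c : edge_ok f -> edge_ok g -> 0 < c ->
  eT f <= (1 + c) * eT g + (1 + c^-1) * eT (fun x => 1 * f x + -1 * g x).
Proof.
move=> hf hg c0; have [X HX] := dsqint_quadratic l0 hf hg.
exact: (quadratic_sub_le c0 (dsqint_ge0 l _) (HX 1 (- (1 + c))) (HX 1 (-1))).
Qed.

Lemma sqint_sub_le f g c : edge_ok f -> edge_ok g -> 0 < c ->
  eM f <= (1 + c) * eM g + (1 + c^-1) * eM (fun x => 1 * f x + -1 * g x).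
Proof.
move=> hf hg c0; have [X HX] := sqint_quadratic hf hg.
exact: (quadratic_sub_le c0 (sqint_ge0 l _) (HX 1 (- (1 + c))) (HX 1 (-1))).
Qed.

(** Elimination of the mixed coefficient with the vector [a f - b g]. *)
Lemma quadratic_lin_le (A B X q1 q2 a b : R) : 0 <= q2 ->
  q1 = a ^+ 2 * A + 2 * a * b * X + b ^+ 2 * B ->
  q2 = a ^+ 2 * A + 2 * a * - b * X + (- b) ^+ 2 * B ->
  q1 <= 2 * a ^+ 2 * A + 2 * b ^+ 2 * B.
Proof. by move=> q20 h1 h2; move: q20; rewrite h2 h1 sqrrN; nra. Qed.

Lemma dsqint_lin_le f g a b : edge_ok f -> edge_ok g ->
  eT (fun x => a * f x + b * g x) <= 2 * a ^+ 2 * eT f + 2 * b ^+ 2 * eT g.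
Proof.
move=> hf hg; have [X HX] := dsqint_quadratic l0 hf hg.
exact: (quadratic_lin_le (dsqint_ge0 l _) (HX a b) (HX a (- b))).
Qed.

Lemma sqint_lin_le f g a b : edge_ok f -> edge_ok g ->
  eM (fun x => a * f x + b * g x) <= 2 * a ^+ 2 * eM f + 2 * b ^+ 2 * eM g.
Proof.
move=> hf hg; have [X HX] := sqint_quadratic hf hg.
exact: (quadratic_lin_le (sqint_ge0 l _) (HX a b) (HX a (- b))).
Qed.

Lemma quadratic_parallelogram (A B X q1 q2 : R) :
  q1 = (2^-1) ^+ 2 * A + 2 * 2^-1 * 2^-1 * X + (2^-1) ^+ 2 * B ->
  q2 = 1 ^+ 2 * A + 2 * 1 * -1 * X + (-1) ^+ 2 * B ->
  q1 + 4^-1 * q2 = 2^-1 * A + 2^-1 * B.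
Proof. by move=> -> ->; field. Qed.

Lemma dsqint_parallelogram f g : edge_ok f -> edge_ok g ->
  eT (fun x => 2^-1 * f x + 2^-1 * g x) + 4^-1 * eT (fun x => 1 * f x + -1 * g x) =
  2^-1 * eT f + 2^-1 * eT g.
Proof.
move=> hf hg; have [X HX] := dsqint_quadratic l0 hf hg.
exact: (quadratic_parallelogram (HX _ _) (HX _ _)).
Qed.

Lemma sqint_parallelogram f g : edge_ok f -> edge_ok g ->
  eM (fun x => 2^-1 * f x + 2^-1 * g x) + 4^-1 * eM (fun x => 1 * f x + -1 * g x) =
  2^-1 * eM f + 2^-1 * eM g.
Proof.
move=> hf hg; have [X HX] := sqint_quadratic hf hg.
exact: (quadratic_parallelogram (HX _ _) (HX _ _)).
Qed.

Lemma quadratic_scale (A X q a : R) :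
  q = a ^+ 2 * A + 2 * a * 0 * X + 0 ^+ 2 * A -> q = a ^+ 2 * A.
Proof. by move=> ->; ring. Qed.

Lemma dsqint_scale f a : edge_ok f -> eT (fun x => a * f x + 0 * f x) = a ^+ 2 * eT f.
Proof. by move=> hf; have [X HX] := dsqint_quadratic l0 hf hf; exact: quadratic_scale (HX _ _). Qed.

Lemma sqint_scale f a : edge_ok f -> eM (fun x => a * f x + 0 * f x) = a ^+ 2 * eM f.
Proof. by move=> hf; have [X HX] := sqint_quadratic hf hf; exact: quadratic_scale (HX _ _). Qed.

End EdgeEstimates.

(** * Closedness of the weak derivative *)

Section Closure.
Variables (R : realType) (l : R).
Hypothesis l0 : 0 < l.
Local Notation mu := (@lebesgue_measure R).
Local Notation I := (`[0%R, l]%classic : set (measurableTypeR R)).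
Local Notation meas := (@measurable_fun _ _ (measurableTypeR R) R I).
Local Notation eM := (sqint l).
Local Notation eT := (dsqint l).
Local Notation edge_ok := (H1_edge l).
Implicit Types (f g h phi : R -> R) (a b c x y K d p : R) (N : set (measurableTypeR R)).

Let mI' : measurable I. Proof. exact: mI. Qed.
Hint Resolve mI' : core.

Lemma holder_continuous f B : (forall x y, 0 <= x <= l -> 0 <= y <= l -> (f y - f x) ^+ 2 <= `|y - x| * B) ->
  {within I, continuous f}.
Proof.
move=> H; apply/subspace_continuousP => x /edge_itvP xI.
apply/cvgrPdist_le => e e0.
have B0 : 0 <= B.
  have := H 0 l; rewrite lexx (ltW l0) lexx => /(_ isT isT); rewrite subr0 gtr0_norm// => h.
  by rewrite -(pmulr_rge0 _ l0); apply: le_trans h; exact: sqr_ge0.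
have d0 : 0 < e ^+ 2 / (B + 1) by rewrite divr_gt0 ?exprn_gt0// ltr_wpDl.
near=> y.
have yI : 0 <= y <= l by apply/edge_itvP; near: y; exact: withinT.
have h := H y x yI xI.
suff h2 : `|f x - f y| ^+ 2 <= e ^+ 2 by move: h2; rewrite ler_pXn2r ?nnegrE// ltW.
rewrite real_normK ?num_real//; apply: (le_trans h).
have : `|x - y| <= e ^+ 2 / (B + 1).
  near: y; apply: cvg_within; apply/nbhs_ballP; exists (e ^+ 2 / (B + 1)) => //= z.
  by rewrite /ball/= => /ltW.
rewrite ler_pdivlMr ?ltr_wpDl//; apply: le_trans.
by rewrite ler_wpM2l// lerDl.
Unshelve. all: by end_near. Qed.

(** The increments have summable integrals of absolute value, so the series of
    absolute values has a finite integral and converges almost everywhere. *)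
Lemma L2_cauchy_ae (g : nat -> R -> R) : (forall k, L2 l (g k)) ->
  (forall k, eM (fun x => 1 * g k.+1 x + -1 * g k x) <= 4^-1 ^+ k) ->
  exists N, [/\ measurable N, mu N = 0 & forall x, I x -> ~ N x -> cvgn (fun k => g k x)].
Proof.
move=> hg H.
pose h k x := `|1 * g k.+1 x + -1 * g k x|.
have Lh k : L2 l (h k) by apply: L2_norm; exact: L2_lin.
have ih k := L2_int (Lh k).
have mh k : measurable_fun I (EFin \o h k) by apply/measurable_EFinP; case: (Lh k).
have bnd k : \int[mu]_(x in I) h k x <= (l + 1) * 2^-1 ^+ k.
  (* the weight [2^-k] makes both terms of the bound geometric, as [4^-k / 2^-k = 2^-k] *)
  have c0 : 0 < (2^-1 : R) ^+ k by rewrite exprn_gt0.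
  apply: le_trans (Rint_abs_le (ltW l0) c0 (L2_lin 1 (-1) (hg k.+1) (hg k))) _.
  rewrite mulrDl [l * _]mulrC lerD2l mul1r.
  apply: le_trans (ler_wpM2r _ (H k)) _; first by rewrite invr_ge0 ltW.
  rewrite ler_pdivrMr// -exprMn.
  by have -> : (2^-1 * 2^-1 : R) = 4^-1 by field.
pose S x := (\sum_(0 <= k <oo) (h k x)%:E)%E.
have mS : measurable_fun I S.
  exact: (@ge0_emeasurable_sum _ _ _ I (fun k x => (h k x)%:E) xpredT (fun k x _ _ => normr_ge0 _) (fun k _ => mh k)).
have iS : (\int[mu]_(x in I) S x < +oo)%E.
  rewrite integral_nneseries//; last by move=> k x _; rewrite lee_fin normr_ge0.
  apply: (@le_lt_trans _ _ (\sum_(0 <= k <oo) ((l + 1) * 2^-1 ^+ k)%:E)%E).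
    apply: lee_nneseries => [k _ _|k _]; first by apply: integral_ge0 => x _; rewrite lee_fin normr_ge0.
    by rewrite -(fineK (integrable_fin_num mI' (ih k))) lee_fin; exact: bnd.
  have C := @is_cvg_geometric_series R (l + 1) 2^-1.
  have E : (fun n => \sum_(0 <= k < n) ((l + 1) * 2^-1 ^+ k)%:E)%E = EFin \o series (geometric (l + 1) 2^-1).
    by apply/funext => n /=; rewrite /series/= sumEFin.
  rewrite E; rewrite EFin_lim ?ltry//; apply: C.
  by rewrite ger0_norm// invf_lt1// ltr1n.
have intS : mu.-integrable I S.
  apply/integrableP; split => //; apply: le_lt_trans iS.
  apply: ge0_le_integral => //.
  - exact: measurableT_comp.
  - by move=> x _; rewrite gee0_abs//; apply: nneseries_ge0 => k _ _; rewrite lee_fin normr_ge0.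
have [N [mN N0 HN]] := integrable_ae mI' intS.
exists N; split => // x Ix xN.
have Sx : S x \is a fin_num by apply: contrapT => h1; apply: xN; apply: HN => /= /(_ Ix).
have C : cvgn (series (fun k => h k x)).
  apply: nondecreasing_is_cvgn.
    by apply/nondecreasing_seqP => n; rewrite /series/= big_nat_recr//= lerDl normr_ge0.
  exists (fine (S x)) => _ [n _ <-].
  rewrite -lee_fin fineK// /series/= -sumEFin.
  by apply: nneseries_lim_ge => k _; rewrite lee_fin normr_ge0.
have C2 : cvgn (series (fun k => 1 * g k.+1 x + -1 * g k x)) by apply: normed_cvg.
have E : (fun k => g k x) = (fun n => g 0 x + series (fun k => 1 * g k.+1 x + -1 * g k x) n).
  apply/funext; elim => [|n IH]; first by rewrite /series/= big_geq// addr0.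
  rewrite /series/= big_nat_recr//= addrA.
  by move: IH; rewrite /series/= => <-; ring.
by rewrite E; apply: is_cvgD => //; exact: is_cvg_cst.
Qed.

Lemma weak_deriv_ae f g h : is_weak_deriv l f g -> L2 l h -> ae_eq mu I g h -> is_weak_deriv l f h.
Proof.
move=> fg hh E; have hg := weak_deriv_L2 fg; split; first exact/edge_Lp2P.
move=> phi tphi; rewrite fg.2//; congr (- _); congr fine.
have hp := L2_cont (@cont_on R l _ (test_fun_cont tphi)).
have i1 := L2_mul hg hp; have i2 := L2_mul hh hp.
apply: ae_eq_integral => //.
- exact: (measurable_int _ i1).
- exact: (measurable_int _ i2).
- by case: E => N [mN N0 HN]; exists N; split => //; apply: subset_trans HN => t /= H1 H2; apply: H1 => It; rewrite H2.
Qed.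

(** The bound on the distances passes to the limit by the lemma of Fatou. *)
Lemma L2_fatou (g : nat -> R -> R) (gl : R -> R) b : (forall k, L2 l (g k)) ->
  (forall x, I x -> g k x @[k --> \oo] --> gl x) ->
  forall k, (forall j, (k <= j)%N -> eM (fun x => 1 * g j x + -1 * g k x) <= b) ->
  L2 l gl /\ eM (fun x => 1 * gl x + -1 * g k x) <= b.
Proof.
move=> hg C k H.
have mgl : meas gl by apply: (measurable_fun_cvg _ C) => j; case: (hg j).
pose F j x := ((1 * g j x + -1 * g k x) ^+ 2)%:E.
pose G x := ((1 * gl x + -1 * g k x) ^+ 2)%:E.
have mF j : measurable_fun I (F j).
  by have [_ i] := L2_lin 1 (-1) (hg j) (hg k); exact: (measurable_int _ i).
have mG : meas (fun x => (1 * gl x + -1 * g k x) ^+ 2).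
  apply: measurable_funX; apply: measurable_funD; apply: measurable_funM => //.
  by case: (hg k).
have GE x : I x -> limn_einf (F ^~ x) = G x.
  move=> Ix; have CF : F j x @[j --> \oo] --> G x.
    apply: cvg_EFin; first exact: nearW.
    apply: cvgM; (apply: cvgD; [|exact: cvg_cst]); (apply: cvgM; [exact: cvg_cst|exact: C]).
  by rewrite is_cvg_limn_einfE; [exact: cvg_lim|apply/cvg_ex; exists (G x)].
have le1 : (\int[mu]_(x in I) G x <= b%:E)%E.
  have := @fatou _ _ _ mu I mI' F mF (fun n x _ => sqr_ge0 _).
  have -> : (\int[mu]_(x in I) limn_einf (F ^~ x) = \int[mu]_(x in I) G x)%E.
    by apply: eq_integral => x xI; apply: GE; exact: set_mem xI.
  move=> h; apply: le_trans h _; rewrite limn_einf_lim.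
  apply: lime_le; first exact: is_cvg_einfs.
  exists k => // n /= kn; apply: le_trans (ereal_inf_lbound _) _; first by exists n => //=.
  have [_ i] := L2_lin 1 (-1) (hg n) (hg k).
  by rewrite -(fineK (integrable_fin_num mI' i)) lee_fin; exact: H.
have hd : L2 l (fun x => 1 * gl x + -1 * g k x).
  split; first by apply: measurable_funD; apply: measurable_funM => //; case: (hg k).
  apply/integrableP; split; first exact/measurable_EFinP.
  apply: le_lt_trans (ltry b); apply: le_trans le1; rewrite le_eqVlt; apply/orP; left; apply/eqP.
  by apply: eq_integral => x _; rewrite /= ger0_norm ?sqr_ge0.
split.
  apply: L2_ext (L2_lin 1 1 hd (hg k)) => x _; ring.
case: hd => _ i; move: le1.
by rewrite -(fineK (integrable_fin_num mI' i)) lee_fin.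
Qed.

(** Convergence of the integrals against a test function or its derivative,
    needed to pass to the limit in the definition of the weak derivative. *)
Lemma L2_weak (u : nat -> R -> R) v psi : (forall k, L2 l (u k)) -> L2 l v ->
  (forall k, eM (fun x => 1 * v x + -1 * u k x) <= 4^-1 ^+ k) ->
  {within I, continuous psi} ->
  \int[mu]_(x in I) (u k x * psi x) @[k --> \oo] --> \int[mu]_(x in I) (v x * psi x).
Proof.
move=> hu hv H cpsi.
have [C psiC] : exists C, forall x, I x -> `|psi x| <= C.
  have /compact_bounded [M [_ mrt]] := continuous_compact cpsi (@segment_compact R 0 l).
  exists (M + 1) => x Ix; apply: mrt; first by rewrite ltrDl.
  by exists x.
have hpsi := L2_cont cpsi.
pose w k x := psi x * (1 * v x + -1 * u k x).
have hw k : L2 l (w k).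
  by apply: L2_bounded psiC; [exact: L2_lin|case: hpsi].
have c0 k : 0 < (2^-1 : R) ^+ k by rewrite exprn_gt0.
have wb k : eM (w k) <= C ^+ 2 * 4^-1 ^+ k.
  have h2 := L2_lin 1 (-1) hv (hu k).
  apply: (@le_trans _ _ (C ^+ 2 * eM (fun x => 1 * v x + -1 * u k x))); last by rewrite ler_wpM2l ?sqr_ge0.
  rewrite /sqint -RintegralZl//; last by case: h2.
  apply: Rint_le; [by case: (hw k)|by apply: int_on_scale; case: h2|].
  move=> x Ix; rewrite /w exprMn ler_wpM2r ?sqr_ge0// -(real_normK (num_real (psi x))).
  have := psiC x Ix => h; rewrite ler_pXn2r ?nnegrE//.
  exact: le_trans h.
apply/cvgrPdist_le => e e0.
have G : (l + C ^+ 2) * 2^-1 ^+ k @[k --> \oo] --> (0 : R).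
  rewrite -(mulr0 (l + C ^+ 2)); apply: cvgM; first exact: cvg_cst.
  by apply: cvg_expr; rewrite ger0_norm// invf_lt1// ltr1n.
near=> k.
have i1 := L2_mul hv hpsi; have i2 := L2_mul (hu k) hpsi.
rewrite -RintegralB//.
rewrite (_ : \int[mu]_(x in I) _ = \int[mu]_(x in I) w k x); last by apply: Rint_ext => x _; rewrite /w; ring.
apply: le_trans (le_normr_Rintegral mI' (L2_int (hw k))) _.
apply: le_trans (Rint_abs_le (ltW l0) (c0 k) (hw k)) _.
apply: (@le_trans _ _ ((l + C ^+ 2) * 2^-1 ^+ k)).
  rewrite mulrDl [l * _]mulrC lerD2l ler_pdivrMr//.
  apply: le_trans (wb k) _.
  have -> : (4^-1 : R) ^+ k = 2^-1 ^+ k * 2^-1 ^+ k by rewrite -exprMn; congr (_ ^+ _); field.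
  by rewrite mulrA.
have : `|0 - (l + C ^+ 2) * 2^-1 ^+ k| <= e by near: k; move/cvgrPdist_le: G; apply.
by rewrite sub0r normrN; apply: le_trans; exact: ler_norm.
Unshelve. all: by end_near. Qed.

(** The weak derivatives form a Cauchy sequence, so they converge almost
    everywhere; they are set to zero on the exceptional null set, which changes
    neither the weak derivative property nor the integrals.  Their limit is a
    weak derivative of [fl] because both sides of the definition converge, and
    the geometric bounds persist by Fatou. *)
Lemma H1_edge_closed (f : nat -> R -> R) (fl : R -> R) : (forall k, edge_ok (f k)) ->
  (forall k j, (k <= j)%N -> eM (fun x => 1 * f j x + -1 * f k x) <= 4^-1 ^+ k) ->
  (forall k j, (k <= j)%N -> eT (fun x => 1 * f j x + -1 * f k x) <= 4^-1 ^+ k) ->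
  (forall x, 0 <= x <= l -> f k x @[k --> \oo] --> fl x) ->
  edge_ok fl /\ forall k, eM (fun x => 1 * fl x + -1 * f k x) <= 4^-1 ^+ k /\
    eT (fun x => 1 * fl x + -1 * f k x) <= 4^-1 ^+ k.
Proof.
move=> hf HM HT C.
pose g k := weak_deriv l (f k).
have fg k : is_weak_deriv l (f k) (g k) by exact: weak_derivP.
have hg k : L2 l (g k) by exact: H1_edge_L2d.
have TE k j : eT (fun x => 1 * f j x + -1 * f k x) = eM (fun x => 1 * g j x + -1 * g k x).
  apply: dsqintE => //; first by case: (H1_edge_lin 1 (-1) (hf j) (hf k)).
  by apply: weak_deriv_lin => //; exact: H1_edge_L2.
have [N [mN N0 HN]] : exists N, [/\ measurable N, mu N = 0 & forall x, I x -> ~ N x -> cvgn (fun k => g k x)].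
  by apply: L2_cauchy_ae => // k; rewrite -TE HT.
(* representatives that converge everywhere *)
pose g' k x := \1_(~` N) x * g k x.
have hg' k : L2 l (g' k).
  apply: (@L2_bounded _ _ _ _ 1) => //; first by apply: measurable_indic; exact: measurableC.
  by move=> x _; rewrite indicE; case: (_ \in _); rewrite ?normr1 ?normr0.
have gg' k : ae_eq mu I (g k) (g' k).
  exists N; split => // x /= h; apply: contrapT => xN; apply: h => Ix.
  by rewrite /g' indicE mem_set// mul1r.
have fg' k : is_weak_deriv l (f k) (g' k) by exact: weak_deriv_ae (gg' k).
have TE' k j : eT (fun x => 1 * f j x + -1 * f k x) = eM (fun x => 1 * g' j x + -1 * g' k x).
  apply: dsqintE => //; first by case: (H1_edge_lin 1 (-1) (hf j) (hf k)).
  by apply: weak_deriv_lin => //; exact: H1_edge_L2.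
pose gl x := limn (fun k => g' k x).
have Cg x : I x -> g' k x @[k --> \oo] --> gl x.
  move=> Ix; suff : cvgn (fun k => g' k x) by [].
  have [xN|xN] := pselect (N x).
    rewrite (_ : (fun k => _) = cst 0); first exact: is_cvg_cst.
    by apply/funext => k; rewrite /g' indicE memNset ?mul0r// => h; exact: h.
  rewrite (_ : (fun k => _) = (fun k => g k x)); first exact: HN.
  by apply/funext => k; rewrite /g' indicE mem_set// mul1r.
have hgl : L2 l gl by have [] := L2_fatou hg' Cg (k := 0) (fun j kj => (eq_ind _ (fun z => z <= 4^-1 ^+ 0) (HT 0 j kj) _ (TE' 0 j))).
have Mg k : eM (fun x => 1 * gl x + -1 * g' k x) <= 4^-1 ^+ k.
  by have [] := L2_fatou hg' Cg (k := k) (fun j kj => (eq_ind _ (fun z => z <= 4^-1 ^+ k) (HT k j kj) _ (TE' k j))).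
have Cf x : I x -> f k x @[k --> \oo] --> fl x by move=> /edge_itvP; exact: C.
have Lf k : L2 l (f k) by exact: H1_edge_L2.
have hfl : L2 l fl by have [] := L2_fatou Lf Cf (HM 0).
have Mf k : eM (fun x => 1 * fl x + -1 * f k x) <= 4^-1 ^+ k by have [] := L2_fatou Lf Cf (HM k).
have cfl : {within I, continuous fl}.
  pose B := 2 * eT (f 0) + 2.
  apply: (@holder_continuous _ B) => x y xI yI.
  have L : (f k y - f k x) ^+ 2 @[k --> \oo] --> (fl y - fl x) ^+ 2.
    by apply: cvgM; apply: cvgB; exact: C.
  apply: (cvgr_to_le L).
  near=> k.
  apply: le_trans (H1_edge_holder l0 (hf k) xI yI) _; rewrite ler_wpM2l//.
  have := HT 0 k (leq0n k); rewrite expr0.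
  move=> h; apply: le_trans (dsqint_sub_le l0 (hf k) (hf 0) ltr01) _.
  by rewrite invr1 /B lerD2l ler_piMr.
have wfl : is_weak_deriv l fl gl.
  split; first exact/edge_Lp2P.
  move=> phi tphi.
  have c1 : {within I, continuous phi} by apply: cont_on; exact: (test_fun_cont tphi).
  have c2 : {within I, continuous (derive1 phi)} by apply: cont_on; case: tphi.
  have A1 := L2_weak Lf hfl Mf c2; have A2 := cvgN (L2_weak hg' hgl Mg c1).
  apply: (cvg_unique (@norm_hausdorff _ R) A1).
  rewrite (_ : (fun k => _) = (fun k => - \int[mu]_(x in I) (g' k x * phi x))); first exact: A2.
  by apply/funext => k; rewrite (fg' k).2.
have okfl : edge_ok fl by split => //; exists gl.
split => // k; split => //.
rewrite (@dsqintE _ _ l0 _ (fun x => 1 * gl x + -1 * g' k x))//.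
  by case: (H1_edge_lin 1 (-1) okfl (hf k)).
by apply: weak_deriv_lin => //.
Unshelve. all: by end_near. Qed.

End Closure.

(** * Sums of nonnegative families *)

Section Sums.
Variables (R : realType) (T : choiceType).
Implicit Types (a b : T -> R) (F L : seq T) (C c : R).

(** Real-valued sums of nonnegative families: [rsum a] is meaningful only when
    [summable_fam a] holds. *)
Definition summable_fam a := (\esum_(t in [set: T]) (a t)%:E < +oo)%E.
Definition rsum a : R := fine (\esum_(t in [set: T]) (a t)%:E).

Lemma rsumE a : (forall t, 0 <= a t) -> summable_fam a ->
  (\esum_(t in [set: T]) (a t)%:E = (rsum a)%:E)%E.
Proof.
move=> a0 fa; rewrite /rsum fineK// ge0_fin_numE//.
by apply: esum_ge0 => t _; rewrite lee_fin.
Qed.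

Lemma rsum_ge0 a : (forall t, 0 <= a t) -> 0 <= rsum a.
Proof. by move=> a0; apply: fine_ge0; apply: esum_ge0 => t _; rewrite lee_fin. Qed.

(** The extended sum is the supremum of the finite partial sums. *)
Lemma rsum_bound a C : (forall t, 0 <= a t) -> (forall F, uniq F -> \sum_(t <- F) a t <= C) ->
  summable_fam a /\ rsum a <= C.
Proof.
move=> a0 H.
have le1 : (\esum_(t in [set: T]) (a t)%:E <= C%:E)%E.
  apply: ge_ereal_sup => _ [X [finX _] <-].
  by rewrite fsbig_finite//= sumEFin lee_fin; apply: H; exact: finmap.fset_uniq.
have fa : summable_fam a by exact: le_lt_trans le1 (ltry _).
by split => //; rewrite -lee_fin -rsumE.
Qed.

Lemma rsum_ge a F : (forall t, 0 <= a t) -> summable_fam a -> uniq F -> \sum_(t <- F) a t <= rsum a.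
Proof.
move=> a0 fa uF; rewrite -lee_fin -rsumE//; apply: esum_ge; exists [set` F]; first by [].
by rewrite -fsbig_seq//= sumEFin.
Qed.

Lemma rsum_term a t : (forall t, 0 <= a t) -> summable_fam a -> a t <= rsum a.
Proof. by move=> a0 fa; have := @rsum_ge a [:: t] a0 fa isT; rewrite big_seq1. Qed.

Lemma le_rsum a b : (forall t, 0 <= a t <= b t) -> summable_fam b ->
  summable_fam a /\ rsum a <= rsum b.
Proof.
move=> ab fb; have a0 t : 0 <= a t by have /andP[] := ab t.
apply: rsum_bound => // F uF; apply: (@le_trans _ _ (\sum_(t <- F) b t)).
  by apply: ler_sum => t _; have /andP[] := ab t.
apply: rsum_ge => // t; have /andP[h1 h2] := ab t; exact: le_trans h2.
Qed.

Lemma rsumD a b : (forall t, 0 <= a t) -> (forall t, 0 <= b t) -> summable_fam a -> summable_fam b ->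
  summable_fam (fun t => a t + b t) /\ rsum (fun t => a t + b t) = rsum a + rsum b.
Proof.
move=> a0 b0 fa fb.
have E : (\esum_(t in [set: T]) (a t + b t)%:E = (rsum a + rsum b)%:E)%E.
  by rewrite EFinD -rsumE// -rsumE// -esumD// => t _; rewrite lee_fin.
split; first by rewrite /summable_fam E ltry.
by rewrite {1}/rsum E.
Qed.

(** One inequality holds for every factor; applied to the inverse factor it gives
    the other one. *)
Lemma rsumZ c a : 0 <= c -> (forall t, 0 <= a t) -> summable_fam a ->
  summable_fam (fun t => c * a t) /\ rsum (fun t => c * a t) = c * rsum a.
Proof.
move=> c0 a0 fa.
have H c' a' : 0 <= c' -> (forall t, 0 <= a' t) -> summable_fam a' ->
    summable_fam (fun t => c' * a' t) /\ rsum (fun t => c' * a' t) <= c' * rsum a'.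
  move=> c'0 a'0 fa'; apply: rsum_bound => [t|F uF]; first exact: mulr_ge0.
  by rewrite -mulr_sumr ler_wpM2l// rsum_ge.
have [f1 h1] := H c a c0 a0 fa; split => //; apply/eqP; rewrite eq_le h1/=.
have [->|cn0] := eqVneq c 0.
  by rewrite mul0r; apply: rsum_ge0 => t; rewrite mul0r.
have cp : 0 < c by rewrite lt_neqAle eq_sym cn0.
have := (H c^-1 _ _ (fun t => mulr_ge0 c0 (a0 t)) f1).2.
rewrite invr_ge0 => /(_ c0).
have -> : (fun t => c^-1 * (c * a t)) = a by apply/funext => t; rewrite mulrA mulVf// mul1r.
by rewrite mulrC ler_pdivlMr// mulrC.
Qed.

Lemma rsum_le2 a1 a2 b : (forall t, 0 <= a1 t) -> (forall t, 0 <= a2 t) ->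
  summable_fam a1 -> summable_fam a2 -> summable_fam b ->
  (forall t, a1 t + a2 t <= b t) -> rsum a1 + rsum a2 <= rsum b.
Proof.
move=> p1 p2 s1 s2 sb H; have [_ <-] := rsumD p1 p2 s1 s2.
by have [] := @le_rsum (fun t => a1 t + a2 t) b (fun t => introT andP (conj (addr_ge0 (p1 t) (p2 t)) (H t))) sb.
Qed.

Lemma rsum_le22 a1 a2 b1 b2 c : 0 <= c -> (forall t, 0 <= a1 t) -> (forall t, 0 <= a2 t) ->
  (forall t, 0 <= b1 t) -> (forall t, 0 <= b2 t) ->
  summable_fam a1 -> summable_fam a2 -> summable_fam b1 -> summable_fam b2 ->
  (forall t, a1 t + a2 t <= b1 t + c * b2 t) -> rsum a1 + rsum a2 <= rsum b1 + c * rsum b2.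
Proof.
move=> c0 p1 p2 q1 q2 s1 s2 t1 t2 H; have [t3 <-] := rsumZ c0 q2 t2.
have [t4 <-] := rsumD q1 (fun t => mulr_ge0 c0 (q2 t)) t1 t3.
exact: rsum_le2.
Qed.

Lemma rsum_le13 a b1 b2 b3 c : 0 <= c -> (forall t, 0 <= a t) ->
  (forall t, 0 <= b1 t) -> (forall t, 0 <= b2 t) -> (forall t, 0 <= b3 t) ->
  summable_fam b1 -> summable_fam b2 -> summable_fam b3 ->
  (forall t, a t <= b1 t + b2 t + c * b3 t) -> rsum a <= rsum b1 + rsum b2 + c * rsum b3.
Proof.
move=> c0 p q1 q2 q3 t1 t2 t3 H; have [t4 <-] := rsumZ c0 q3 t3.
have [t5 <-] := rsumD q1 q2 t1 t2.
have [t6 <-] := rsumD (fun t => addr_ge0 (q1 t) (q2 t)) (fun t => mulr_ge0 c0 (q3 t)) t5 t4.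
by have [] := @le_rsum a _ (fun t => introT andP (conj (p t) (H t))) t6.
Qed.

Lemma rsum_supp a L : (forall t, 0 <= a t) -> uniq L -> (forall t, t \notin L -> a t = 0) ->
  summable_fam a /\ rsum a = \sum_(t <- L) a t.
Proof.
move=> a0 uL supp.
have [fa h] : summable_fam a /\ rsum a <= \sum_(t <- L) a t.
  apply: rsum_bound => // F uF.
  rewrite (bigID (mem L))/= [X in _ + X]big1 ?addr0; last by move=> t /supp.
  rewrite -big_filter (perm_big [seq t <- L | t \in F]); last first.
    apply: uniq_perm; rewrite ?filter_uniq// => t.
    by rewrite !mem_filter andbC.
  by rewrite big_filter [leRHS](bigID (mem F))/= lerDl sumr_ge0.
by split => //; apply/eqP; rewrite eq_le h rsum_ge.
Qed.

(** A lower semicontinuity of sums, in the form in which it is used: [b j] is the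
    squared norm of an approximation of the object measured by [a], and the
    hypothesis is the weighted triangle inequality.  On a finite set the errors
    [e j] tend to zero, and then so does [c]. *)
Lemma rsum_limit a (b : nat -> T -> R) (e : nat -> R) C k0 : (forall t, 0 <= a t) ->
  (forall j t, 0 <= b j t) ->
  (forall j, (k0 <= j)%N -> summable_fam (b j) /\ rsum (b j) <= C) ->
  e j @[j --> \oo] --> 0 ->
  (forall j t c, (k0 <= j)%N -> 0 < c -> a t <= (1 + c) * b j t + (1 + c^-1) * e j) ->
  summable_fam a /\ rsum a <= C.
Proof.
move=> a0 b0 bC e0 H; apply: rsum_bound => // F uF.
have C0 : 0 <= C by have [_] := bC k0 (leqnn _); apply: le_trans; exact: rsum_ge0.
apply/ler_addgt0Pr => d d0.
have c0 : 0 < d / (C + 1) by rewrite divr_gt0// ltr_wpDl.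
set c := d / (C + 1) in c0.
apply: (@le_trans _ _ ((1 + c) * C)); last first.
  rewrite mulrDl mul1r lerD2l /c mulrAC ler_pdivrMr ?ltr_wpDl//.
  by rewrite ler_pM2l// lerDl.
have L : (1 + c) * C + (size F)%:R * ((1 + c^-1) * e j) @[j --> \oo] --> (1 + c) * C + (size F)%:R * ((1 + c^-1) * 0).
  by apply: cvgD; [exact: cvg_cst|apply: cvgMr; apply: cvgMr].
rewrite !mulr0 addr0 in L; apply: (cvgr_to_ge L); near=> j.
have kj : (k0 <= j)%N by near: j; exact: nbhs_infty_ge.
apply: (@le_trans _ _ (\sum_(t <- F) ((1 + c) * b j t + (1 + c^-1) * e j))).
  by apply: ler_sum => t _; exact: H.
rewrite big_split/= -mulr_sumr; apply: lerD.
  rewrite ler_wpM2l//; first by rewrite addr_ge0// ltW.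
  by have [f1 h1] := bC j kj; apply: le_trans h1; exact: rsum_ge.
by rewrite big_const_seq count_predT iter_addr_0 mulr_natl.
Unshelve. all: by end_near. Qed.

End Sums.

Lemma rsum_reindex (R : realType) (T T' : choiceType) (f : T -> T') (a : T' -> R) : bijective f ->
  (forall t, 0 <= a t) ->
  (\esum_(t in [set: T']) (a t)%:E = \esum_(t in [set: T]) (a (f t))%:E)%E.
Proof.
move=> bf a0; apply: reindex_esum.
have := bf; rewrite -setTT_bijective; exact.
Qed.

Section Cells.
Variables (R : realType) (E : finType).
Implicit Types (i : int) (n : nat).

(** The heights of the vertices of the cell [i] are [i] and [i + 1], of absolute
    values [radius i] and [(radius i).+1] in some order.  With this asymmetric
    choice a cutoff depending on the absolute height varies on a single layer
    of cells. *)
Definition radius i : nat := match i with Posz n => n | Negz n => n end.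

Definition cells n : seq int := map Posz (iota 0 n) ++ map Negz (iota 0 n).

Lemma mem_cells n i : (i \in cells n) = (radius i < n)%N.
Proof.
rewrite mem_cat; case: i => k /=.
  rewrite mem_map; last by move=> ? ? [].
  rewrite mem_iota/= add0n; case: (k < n)%N => //=.
  by apply/negbTE/mapP => -[].
rewrite [X in _ || X]mem_map; last by move=> ? ? [].
rewrite mem_iota/= add0n; case: (k < n)%N; rewrite ?orbT// orbF.
by apply/negbTE/mapP => -[].
Qed.

Lemma uniq_cells n : uniq (cells n).
Proof.
rewrite cat_uniq !map_inj_uniq ?iota_uniq ?andbT/=; try by move=> ? ? [].
by apply/hasPn => _ /mapP[k _ ->]; apply/mapP => -[].
Qed.

Lemma size_cells n : size (cells n) = (2 * n)%N.
Proof. by rewrite size_cat !size_map size_iota addnn mul2n. Qed.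

Lemma rsum_cells (b : E -> R) n : (forall e, 0 <= b e) ->
  summable_fam (fun e : E * int => if (radius e.2 < n)%N then b e.1 else 0) /\
  rsum (fun e : E * int => if (radius e.2 < n)%N then b e.1 else 0) = (2 * n)%:R * \sum_(e : E) b e.
Proof.
move=> b0; pose L := [seq (e, i) | e <- enum E, i <- cells n].
have [|||f1 h1] := @rsum_supp R _ (fun e : E * int => if (radius e.2 < n)%N then b e.1 else 0) L.
- by move=> t; case: ifP.
- by apply: allpairs_uniq; rewrite ?enum_uniq ?uniq_cells// => -[? ?] [? ?] _ _ [-> ->].
- move=> [e i] /=; case: ifP => // h /negP[]; apply/allpairsP; exists (e, i).
  by rewrite mem_enum mem_cells.
split => //; rewrite h1 big_allpairs mulr_sumr big_enum/=.
apply: eq_bigr => e _; rewrite big_seq.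
rewrite (eq_bigr (fun=> b e)); last by move=> i; rewrite mem_cells => ->.
by rewrite -big_seq big_const_seq count_predT iter_addr_0 size_cells mulr_natl.
Qed.

End Cells.

(** * Mass and energy on a periodic graph *)

Section PeriodicGraph.
Local Open Scope quotient_scope.
Variables (R : realType) (V E : finType) (K : metric_graph R V E).
Variables (Dv Rv : set V) (sigma : V -> V).
Hypothesis DR : Dv `&` Rv = set0.
Hypothesis sigmaDR : set_bij Dv Rv sigma.
Local Notation G := (periodic_graph K Dv sigma).
Local Notation edge := (E * int)%type.
Local Notation ln e := (len K e.1).
Implicit Types (u v w : edge -> R -> R) (e : edge) (a b c x y d C : R).

Let l0 e : 0 < ln e. Proof. exact: len_gt0. Qed.

Definition edge_mass u e := sqint (ln e) (u e).
Definition edge_kin u e := dsqint (ln e) (u e).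
Definition edge_pot p u e := powint (ln e) p (u e).
Definition graph_mass u := rsum (edge_mass u).
Definition graph_kin u := rsum (edge_kin u).
Definition graph_pot p u := rsum (edge_pot p u).
Definition lin a b u v : edge -> R -> R := fun e x => a * u e x + b * v e x.
Definition graph_energy p u := 2^-1 * graph_kin u - p^-1 * graph_pot p u.

Lemma edge_mass_ge0 u e : 0 <= edge_mass u e. Proof. exact: sqint_ge0. Qed.
Lemma edge_kin_ge0 u e : 0 <= edge_kin u e. Proof. exact: dsqint_ge0. Qed.
Lemma edge_pot_ge0 p u e : 0 <= edge_pot p u e. Proof. exact: powint_ge0. Qed.
Hint Resolve edge_mass_ge0 edge_kin_ge0 edge_pot_ge0 : core.

Lemma mass_ge0 u : 0 <= graph_mass u. Proof. exact: rsum_ge0. Qed.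
Lemma kin_ge0 u : 0 <= graph_kin u. Proof. exact: rsum_ge0. Qed.
Lemma pot_ge0 p u : 0 <= graph_pot p u. Proof. exact: rsum_ge0. Qed.

(** The integrability conditions of [H1] in terms of real sums; measurability is
    automatic. *)
Lemma H1P u : H1 G u <-> [/\ graph_continuous G u, forall e, H1_edge (ln e) (u e),
  summable_fam (edge_mass u) & summable_fam (edge_kin u)].
Proof.
have ME : (forall e, H1_edge (ln e) (u e)) -> Lpow G 2 u = \esum_(e in [set: edge]) (edge_mass u e)%:E.
  move=> ok; apply: eq_esum => e _; rewrite edge_Lpow2E//; exact: (H1_edge_L2 (ok e)).
have TE : (forall e, H1_edge (ln e) (u e)) -> Lpow G 2 (graph_deriv G u) = \esum_(e in [set: edge]) (edge_kin u e)%:E.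
  move=> ok; apply: eq_esum => e _; rewrite edge_Lpow2E//; exact: (H1_edge_L2d (ok e)).
split.
  move=> [cu hu [_ Mu] [_ Tu]].
  have ok e : H1_edge (ln e) (u e).
    by split; [case: cu => + _; apply|case: (hu e)].
  rewrite (ME ok) in Mu; rewrite (TE ok) in Tu.
  by split; [exact: cu|exact: ok|exact: Mu|exact: Tu].
move=> [cu ok Mu Tu]; split => //.
- by move=> e; split; [apply/edge_Lp2P; exact: (H1_edge_L2 (ok e))|case: (ok e)].
- by split; [move=> e; apply/edge_Lp2P; exact: (H1_edge_L2 (ok e))|rewrite ME].
- by split; [move=> e; apply/edge_Lp2P; exact: (H1_edge_L2d (ok e))|rewrite TE].
Qed.

Lemma H1_ok u : H1 G u -> forall e, H1_edge (ln e) (u e).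
Proof. by move=> /H1P[]. Qed.

Lemma H1_summable_mass u : H1 G u -> summable_fam (edge_mass u). Proof. by move=> /H1P[]. Qed.
Lemma H1_summable_kin u : H1 G u -> summable_fam (edge_kin u). Proof. by move=> /H1P[]. Qed.
Lemma H1_cont u : H1 G u -> graph_continuous G u. Proof. by case. Qed.

Lemma Lpow_mass u : H1 G u -> Lpow G 2 u = (graph_mass u)%:E.
Proof.
move=> hu; rewrite -rsumE//; last exact: H1_summable_mass.
by apply: eq_esum => e _; rewrite edge_Lpow2E//; exact: (H1_edge_L2 (H1_ok hu e)).
Qed.

Lemma Lpow_kin u : H1 G u -> Lpow G 2 (graph_deriv G u) = (graph_kin u)%:E.
Proof.
move=> hu; rewrite -rsumE//; last exact: H1_summable_kin.
by apply: eq_esum => e _; rewrite edge_Lpow2E//; exact: (H1_edge_L2d (H1_ok hu e)).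
Qed.

Lemma graph_continuous_lin a b u v : (forall e, H1_edge (ln e) (lin a b u v e)) ->
  graph_continuous G u -> graph_continuous G v -> graph_continuous G (lin a b u v).
Proof.
move=> ok [_ cu] [_ cv]; split; first by move=> e; case: (ok e).
move=> h h' hh'; have := cu h h' hh'; have := cv h h' hh'.
by rewrite /end_val /lin => -> ->.
Qed.

Lemma H1_lin a b u v : H1 G u -> H1 G v -> H1 G (lin a b u v).
Proof.
move=> hu hv; have ou := H1_ok hu; have ov := H1_ok hv.
have ok e : H1_edge (ln e) (lin a b u v e) by apply: H1_edge_lin.
have ca : 0 <= 2 * a ^+ 2 by rewrite mulr_ge0 ?sqr_ge0.
have cb : 0 <= 2 * b ^+ 2 by rewrite mulr_ge0 ?sqr_ge0.
apply/H1P; split => //.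
- by apply: graph_continuous_lin => //; exact: H1_cont.
- have [f1 _] := rsumZ ca (edge_mass_ge0 u) (H1_summable_mass hu).
  have [f2 _] := rsumZ cb (edge_mass_ge0 v) (H1_summable_mass hv).
  have [f3 _] := rsumD (fun t => mulr_ge0 ca (edge_mass_ge0 u t)) (fun t => mulr_ge0 cb (edge_mass_ge0 v t)) f1 f2.
  have [] // := le_rsum (a := edge_mass (lin a b u v)) _ f3.
  by move=> e; rewrite edge_mass_ge0; exact: sqint_lin_le.
- have [f1 _] := rsumZ ca (edge_kin_ge0 u) (H1_summable_kin hu).
  have [f2 _] := rsumZ cb (edge_kin_ge0 v) (H1_summable_kin hv).
  have [f3 _] := rsumD (fun t => mulr_ge0 ca (edge_kin_ge0 u t)) (fun t => mulr_ge0 cb (edge_kin_ge0 v t)) f1 f2.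
  have [] // := le_rsum (a := edge_kin (lin a b u v)) _ f3.
  by move=> e; rewrite edge_kin_ge0; exact: dsqint_lin_le.
Qed.

Lemma mass_scale a u : H1 G u -> graph_mass (lin a 0 u u) = a ^+ 2 * graph_mass u.
Proof.
move=> hu; have [_ <-] := rsumZ (sqr_ge0 a) (edge_mass_ge0 u) (H1_summable_mass hu).
by congr rsum; apply/funext => e; apply: sqint_scale => //; exact: H1_ok.
Qed.

Lemma kin_scale a u : H1 G u -> graph_kin (lin a 0 u u) = a ^+ 2 * graph_kin u.
Proof.
move=> hu; have [_ <-] := rsumZ (sqr_ge0 a) (edge_kin_ge0 u) (H1_summable_kin hu).
by congr rsum; apply/funext => e; apply: dsqint_scale => //; exact: H1_ok.
Qed.

Lemma rsum_parallelogram (q1 q2 q3 q4 : edge -> R) : (forall e, 0 <= q1 e) -> (forall e, 0 <= q2 e) ->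
  (forall e, 0 <= q3 e) -> (forall e, 0 <= q4 e) ->
  summable_fam q1 -> summable_fam q2 -> summable_fam q3 -> summable_fam q4 ->
  (forall e, q1 e + 4^-1 * q2 e = 2^-1 * q3 e + 2^-1 * q4 e) ->
  rsum q1 + 4^-1 * rsum q2 = 2^-1 * rsum q3 + 2^-1 * rsum q4.
Proof.
move=> p1 p2 p3 p4 s1 s2 s3 s4 H.
have c4 : (0 : R) <= 4^-1 by rewrite invr_ge0.
have c2 : (0 : R) <= 2^-1 by rewrite invr_ge0.
have [t2 <-] := rsumZ c4 p2 s2; have [t3 <-] := rsumZ c2 p3 s3; have [t4 <-] := rsumZ c2 p4 s4.
have [_ <-] := rsumD p1 (fun t => mulr_ge0 c4 (p2 t)) s1 t2.
have [_ <-] := rsumD (fun t => mulr_ge0 c2 (p3 t)) (fun t => mulr_ge0 c2 (p4 t)) t3 t4.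
by congr rsum; apply/funext => e; exact: H.
Qed.

Lemma kin_parallelogram u v : H1 G u -> H1 G v ->
  graph_kin (lin 2^-1 2^-1 u v) + 4^-1 * graph_kin (lin 1 (-1) u v) = 2^-1 * graph_kin u + 2^-1 * graph_kin v.
Proof.
move=> hu hv.
apply: (rsum_parallelogram (edge_kin_ge0 _) (edge_kin_ge0 _) (edge_kin_ge0 _) (edge_kin_ge0 _)
  (H1_summable_kin (H1_lin _ _ hu hv)) (H1_summable_kin (H1_lin _ _ hu hv)) (H1_summable_kin hu) (H1_summable_kin hv)) => e.
exact: (dsqint_parallelogram (l0 e) (H1_ok hu e) (H1_ok hv e)).
Qed.

Lemma mass_parallelogram u v : H1 G u -> H1 G v ->
  graph_mass (lin 2^-1 2^-1 u v) + 4^-1 * graph_mass (lin 1 (-1) u v) = 2^-1 * graph_mass u + 2^-1 * graph_mass v.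
Proof.
move=> hu hv.
apply: (rsum_parallelogram (edge_mass_ge0 _) (edge_mass_ge0 _) (edge_mass_ge0 _) (edge_mass_ge0 _)
  (H1_summable_mass (H1_lin _ _ hu hv)) (H1_summable_mass (H1_lin _ _ hu hv)) (H1_summable_mass hu) (H1_summable_mass hv)) => e.
exact: (sqint_parallelogram (H1_ok hu e) (H1_ok hv e)).
Qed.

Lemma min_len : exists d, 0 < d /\ forall k : E, d <= len K k.
Proof.
exists (\big[Order.min/1]_(k : E) len K k); split.
  by apply: lt_bigmin => // k _; exact: len_gt0.
by move=> k; apply: bigmin_le_cond.
Qed.

Section MinLen.
Variable d : R.
Hypotheses (d0 : 0 < d) (dK : forall k : E, d <= len K k).

(** The edge containing the point may be long: only a piece of length [c] is
    used, which is why the shortest edge limits [c]. *)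
Lemma H1_sup u e x c : H1 G u -> 0 <= x <= ln e -> 0 < c -> c <= d ->
  u e x ^+ 2 <= 2 * graph_mass u / c + 2 * c * graph_kin u.
Proof.
move=> hu xI c0 cd; have cl : c <= ln e by apply: le_trans cd _.
apply: le_trans (H1_edge_sup (l0 e) (H1_ok hu e) xI c0 cl) _; apply: lerD.
  apply: ler_wpM2r; first by rewrite invr_ge0 ltW.
  apply: ler_wpM2l => //; exact: (rsum_term e (edge_mass_ge0 u) (H1_summable_mass hu)).
apply: ler_wpM2l; first by rewrite mulr_ge0// ltW.
exact: (rsum_term e (edge_kin_ge0 u) (H1_summable_kin hu)).
Qed.

Section Potential.
Variable p : R.
Hypotheses (p2 : 2 < p) (p6 : p < 6).

(** Pointwise [|u|^p <= C^(p - 2) u^2]. *)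
Lemma pot_le u C : H1 G u -> (forall e x, 0 <= x <= ln e -> `|u e x| <= C) ->
  summable_fam (edge_pot p u) /\ graph_pot p u <= C `^ (p - 2) * graph_mass u.
Proof.
move=> hu uC.
have [f1 <-] := rsumZ (powR_ge0 C (p - 2)) (edge_mass_ge0 u) (H1_summable_mass hu).
apply: le_rsum => // e; rewrite edge_pot_ge0; apply: powint_le => //; first exact: H1_ok.
exact: uC.
Qed.

Lemma H1_bounded u : H1 G u -> exists C, forall e x, 0 <= x <= ln e -> `|u e x| <= C.
Proof.
move=> hu; exists (Num.sqrt (2 * graph_mass u / d + 2 * d * graph_kin u)) => e x xI.
by rewrite -sqrtr_sqr ler_wsqrtr// H1_sup.
Qed.

Lemma H1_pot u : H1 G u -> summable_fam (edge_pot p u).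
Proof. by move=> hu; have [C uC] := H1_bounded hu; have [] := pot_le hu uC. Qed.

Lemma energyE u : H1 G u -> energy G p u = (graph_energy p u)%:E.
Proof.
move=> hu; rewrite /energy Lpow_kin// /graph_energy.
have -> : Lpow G p u = (graph_pot p u)%:E.
  rewrite -rsumE//; last exact: H1_pot.
  apply: eq_esum => e _; rewrite /edge_Lpow /edge_pot /powint /Rintegral fineK//.
  by apply: integrable_fin_num; [exact: mI|apply: powR_int => //; exact: H1_ok].
by rewrite -!EFinM -EFinB.
Qed.

Lemma pot_scale a u : 0 <= a -> H1 G u -> graph_pot p (lin a 0 u u) = a `^ p * graph_pot p u.
Proof.
move=> a0 hu; have [_ <-] := rsumZ (powR_ge0 a p) (edge_pot_ge0 p u) (H1_pot hu).
by congr rsum; apply/funext => e; apply: powint_scale => //; exact: H1_ok.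
Qed.

Lemma pot_sub_le u v C c : H1 G u -> H1 G v -> 0 < c ->
  (forall e x, 0 <= x <= ln e -> `|u e x| <= C) ->
  graph_pot p u <= graph_pot p v + 3 * C `^ (p - 2) * (c * graph_mass u + graph_mass (lin 1 (-1) u v) / c).
Proof.
move=> hu hv c0 uC; have hd := H1_lin 1 (-1) hu hv.
have c1 : 0 <= c^-1 by rewrite invr_ge0 ltW.
have C1 : 0 <= 3 * C `^ (p - 2) by rewrite mulr_ge0 ?powR_ge0.
rewrite [_ / c]mulrC.
have [f1 <-] := rsumZ (ltW c0) (edge_mass_ge0 u) (H1_summable_mass hu).
have [f2 <-] := rsumZ c1 (edge_mass_ge0 _) (H1_summable_mass hd).
have g1 e : 0 <= c * edge_mass u e by rewrite mulr_ge0// ltW.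
have g2 e : 0 <= c^-1 * edge_mass (lin 1 (-1) u v) e by rewrite mulr_ge0.
have [f3 <-] := rsumD g1 g2 f1 f2.
have g3 e : 0 <= c * edge_mass u e + c^-1 * edge_mass (lin 1 (-1) u v) e by rewrite addr_ge0.
have [f4 <-] := rsumZ C1 g3 f3.
have g4 e : 0 <= 3 * C `^ (p - 2) * (c * edge_mass u e + c^-1 * edge_mass (lin 1 (-1) u v) e) by rewrite mulr_ge0.
have [f5 <-] := rsumD (edge_pot_ge0 p v) g4 (H1_pot hv) f4.
have [] // := le_rsum (a := edge_pot p u) _ f5.
move=> e; rewrite edge_pot_ge0 [c^-1 * _]mulrC /=.
by apply: powint_sub_le => //; [exact: H1_ok|exact: H1_ok|exact: uC].
Qed.

End Potential.
End MinLen.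

(** * Translations, heights and cutoffs *)

Lemma ends_eq (x y : V * int) :
  (\pi_({eq_quot (glue_equiv Dv sigma)}) x = \pi_({eq_quot (glue_equiv Dv sigma)}) y) <->
  clos_refl_sym_trans (V * int) (paste Dv sigma) x y.
Proof.
split.
  by move=> /eqP; rewrite eqmodE => /asboolP.
by move=> h; apply/eqP; rewrite eqmodE; apply/asboolP.
Qed.

(** The pasting relation is defined in the same way in every cell. *)
Lemma glue_shift i (x y : V * int) : clos_refl_sym_trans (V * int) (paste Dv sigma) x y ->
  clos_refl_sym_trans (V * int) (paste Dv sigma) (x.1, x.2 + i) (y.1, y.2 + i).
Proof.
elim=> [{}x {}y [h1 h2]|{}x|{}x {}y _|{}x {}y z _ h1 _ h2].
- by apply: rst_step; split => //=; rewrite h2 /= addrAC.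
- exact: rst_refl.
- exact: rst_sym.
- exact: rst_trans h1 h2.
Qed.

Definition shift i u : edge -> R -> R := fun e => u (e.1, e.2 + i).

Lemma shift_bij i : bijective (fun e : edge => (e.1, e.2 + i)).
Proof.
by exists (fun e : edge => (e.1, e.2 - i)) => -[k j]; rewrite /= ?addrK ?subrK.
Qed.

Lemma rsum_shift i (q : edge -> R) : (forall e, 0 <= q e) ->
  rsum (fun e => q (e.1, e.2 + i)) = rsum q /\ (summable_fam q -> summable_fam (fun e => q (e.1, e.2 + i))).
Proof.
move=> q0; rewrite /rsum /summable_fam.
by rewrite (rsum_reindex (shift_bij i) q0).
Qed.

Lemma H1_shift i u : H1 G u -> H1 G (shift i u).
Proof.
move=> hu; have [cu ok Mu Tu] := (H1P u).1 hu; apply/H1P; split.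
- split; first by move=> e; case: (ok (e.1, e.2 + i)).
  move=> [[k j] b] [[k' j'] b'] /ends_eq/(glue_shift i)/ends_eq H.
  exact: (cu.2 ((k, j + i), b) ((k', j' + i), b') H).
- by move=> e; exact: (ok (e.1, e.2 + i)).
- exact: (rsum_shift i (edge_mass_ge0 u)).2.
- exact: (rsum_shift i (edge_kin_ge0 u)).2.
Qed.

Lemma mass_shift i u : graph_mass (shift i u) = graph_mass u.
Proof. exact: (rsum_shift i (edge_mass_ge0 u)).1. Qed.

Lemma En_shift p i u : graph_energy p (shift i u) = graph_energy p u.
Proof.
have h1 : graph_kin (shift i u) = graph_kin u by exact: (rsum_shift i (edge_kin_ge0 u)).1.
have h2 : graph_pot p (shift i u) = graph_pot p u by exact: (rsum_shift i (edge_pot_ge0 p u)).1.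
by rewrite /graph_energy h1 h2.
Qed.

(** A function on the vertices that is constant on glued vertices: a vertex in [Dv]
    of a cell is glued to a vertex in [Rv] of the next one, and this is the only
    identification. *)
Definition height (x : V * int) : int := x.2 + (x.1 \in Dv)%:R.

(** The target of a pasting lies in [Rv], so not in [Dv]. *)
Lemma glue_height (x y : V * int) : clos_refl_sym_trans (V * int) (paste Dv sigma) x y -> height x = height y.
Proof.
elim=> [{}x {}y [h1 ->]|//|//|{}x {}y z _ -> _ ->//].
rewrite /height /= mem_set// memNset ?addr0// => h2.
have h3 : Rv (sigma x.1) by case: sigmaDR => + _ _; apply.
by have : (Dv `&` Rv) (sigma x.1) by []; rewrite DR.
Qed.

Definition end_height (e : edge) (b : bool) := height (ends K e.1 b, e.2).

Lemma hgtE e (b : bool) : end_height e b = e.2 \/ end_height e b = e.2 + 1.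
Proof. by rewrite /end_height /height /=; case: (_ \in _); [right|left; rewrite addr0]. Qed.

Implicit Types F : int -> R.

Definition edge_slope F e := (F (end_height e true) - F (end_height e false)) / ln e.

(** The product of [u] with the function that is affine on the edges and takes the
    value [F] of the height at each vertex. *)
Definition cutoff F u : edge -> R -> R := fun e x => (F (end_height e false) + edge_slope F e * x) * u e x.

Lemma graph_continuous_cut F u : (forall e, H1_edge (ln e) (u e)) ->
  (forall h h', ends G h.1 h.2 = ends G h'.1 h'.2 -> end_val G u h = end_val G u h') ->
  graph_continuous G (cutoff F u) /\ forall e, H1_edge (ln e) (cutoff F u e).
Proof.
move=> ok cu.
have ok' e : H1_edge (ln e) (cutoff F u e) by exact: H1_edge_affineM.
split => //; split; first by move=> e; case: (ok' e).
have ev h : end_val G (cutoff F u) h = F (end_height h.1 h.2) * end_val G u h.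
  case: h => e [] /=; rewrite /end_val /cutoff /=; congr (_ * _).
    by rewrite /edge_slope divfK ?gt_eqF// addrC subrK.
  by rewrite mulr0 addr0.
move=> h h' hh'; rewrite !ev (cu h h' hh'); congr (_ * _).
by congr F; move: hh' => /ends_eq/glue_height.
Qed.

End PeriodicGraph.

(** * Cutting a function along a layer of cells *)

Section Truncation.
Variables (R : realType) (V E : finType) (K : metric_graph R V E).
Variables (Dv Rv : set V) (sigma : V -> V).
Hypothesis DR : Dv `&` Rv = set0.
Hypothesis sigmaDR : set_bij Dv Rv sigma.
Local Notation G := (periodic_graph K Dv sigma).
Local Notation edge := (E * int)%type.
Local Notation ln e := (len K e.1).
Local Notation massE := (edge_mass K).
Local Notation kinE := (edge_kin K).
Local Notation potE := (edge_pot K).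
Local Notation mass := (graph_mass K).
Local Notation kin := (graph_kin K).
Local Notation pot := (graph_pot K).
Local Notation En := (graph_energy K).
Local Notation cut := (cutoff K Dv).
Local Notation hgt := (end_height K Dv).
Local Notation slope := (edge_slope K Dv).
Implicit Types (u v w : edge -> R -> R) (e : edge) (a c x y d C : R) (b : bool) (j : int) (F : int -> R) (r n N : nat).

Let l0 e : 0 < ln e. Proof. exact: len_gt0. Qed.

Lemma hgt_radius e (b : bool) : `|hgt e b|%N = radius e.2 \/ `|hgt e b|%N = (radius e.2).+1.
Proof.
case: (hgtE K Dv e b) => ->; case: e => k [n|n] /=; [by left|by right| |].
  by right; rewrite addn1.
by left; rewrite NegzE -addn1 PoszD opprD subrK abszN absz_nat.
Qed.

(** On an edge the cutoff function is a convex combination of its values at the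
    ends. *)
Lemma affine_itv F e x (m M : R) : (forall b, m <= F (hgt e b) <= M) -> 0 <= x <= ln e ->
  m <= F (hgt e false) + slope F e * x <= M.
Proof.
move=> mM /andP[x0 xl]; have := mM true; have := mM false.
rewrite /edge_slope; set A := F (hgt e false); set B := F (hgt e true) => /andP[h1 h2] /andP[h3 h4].
have -> : A + (B - A) / ln e * x = A * (1 - x / ln e) + B * (x / ln e) by ring.
have t0 : 0 <= x / ln e by rewrite divr_ge0// ltW.
have t1 : x / ln e <= 1 by rewrite ler_pdivrMr// mul1r.
set t := x / ln e in t0 t1 *.
apply/andP; split; nra.
Qed.

Lemma cut_cst1 F u e : (forall b, F (hgt e b) = 1) -> cut F u e = u e.
Proof.
move=> H; apply/funext => x; rewrite /cutoff /edge_slope !H subrr !mul0r addr0; exact: mul1r.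
Qed.

Lemma cut_cst0 F u e : (forall b, F (hgt e b) = 0) -> cut F u e = (fun x => 0 * u e x + 0 * u e x).
Proof.
by move=> H; apply/funext => x; rewrite /cutoff /edge_slope !H subrr !mul0r addr0 mul0r.
Qed.

Lemma cut_opp F u e :
  cut (fun j => 1 - F j) u e = (fun x => (1 - F (hgt e false) + - slope F e * x) * u e x).
Proof.
by apply/funext => x; rewrite /cutoff /edge_slope; ring.
Qed.

Section Cut.
Variables (d : R).
Hypotheses (d0 : 0 < d) (dK : forall k : E, d <= len K k).
Variable u : edge -> R -> R.
Hypothesis hu : H1 G u.

Lemma slope_le F e : (forall j, 0 <= F j <= 1) -> slope F e ^+ 2 <= d^-1 ^+ 2.
Proof.
move=> F01; rewrite /edge_slope exprMn.
have h1 : (F (hgt e true) - F (hgt e false)) ^+ 2 <= 1.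
  have /andP[h1 h2] := F01 (hgt e true); have /andP[h3 h4] := F01 (hgt e false); nra.
have h2 : (ln e)^-1 ^+ 2 <= d^-1 ^+ 2.
  by rewrite ler_pXn2r ?nnegrE ?invr_ge0 ?(ltW (l0 e)) ?(ltW d0)// lef_pV2 ?posrE.
by apply: le_trans h2; rewrite ler_piMl ?sqr_ge0.
Qed.

Lemma edge_cut F e : (forall j, 0 <= F j <= 1) ->
  [/\ H1_edge (ln e) (cut F u e),
      massE (cut F u) e <= massE u e &
      kinE (cut F u) e <= 2 * kinE u e + 2 * d^-1 ^+ 2 * massE u e].
Proof.
move=> F01; have ok := H1_ok hu e.
have al x : 0 <= x <= ln e -> 0 <= F (hgt e false) + slope F e * x <= 1.
  by apply: affine_itv => b; exact: F01.
split; first exact: H1_edge_affineM.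
  by rewrite /edge_mass; apply: (le_trans _ (sqint_cut ok al)); rewrite lerDl; exact: sqint_ge0.
apply: le_trans (dsqint_cut (l0 e) ok al) _; rewrite lerD2l.
apply: ler_wpM2r; first exact: sqint_ge0.
by apply: ler_wpM2l => //; exact: slope_le.
Qed.

Lemma H1_cut F : (forall j, 0 <= F j <= 1) -> H1 G (cut F u).
Proof.
move=> F01; have [|cu ok] := graph_continuous_cut DR sigmaDR F (H1_ok hu).
  by case: (H1_cont hu).
apply/H1P; split => //.
- have [] // := le_rsum (a := massE (cut F u)) _ (H1_summable_mass hu).
  by move=> e; rewrite edge_mass_ge0; have [] := edge_cut e F01.
- have c0 : 0 <= 2 * d^-1 ^+ 2 by rewrite mulr_ge0 ?sqr_ge0.
  have c2 : (0 : R) <= 2 by [].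
  have [f1 _] := rsumZ c0 (edge_mass_ge0 K u) (H1_summable_mass hu).
  have [f2 _] := rsumZ c2 (edge_kin_ge0 K u) (H1_summable_kin hu).
  have [f3 _] := rsumD (fun t => mulr_ge0 c2 (edge_kin_ge0 K u t)) (fun t => mulr_ge0 c0 (edge_mass_ge0 K u t)) f2 f1.
  have [] // := le_rsum (a := kinE (cut F u)) _ f3.
  by move=> e; rewrite edge_kin_ge0; have [] := edge_cut e F01.
Qed.

(** The cutoff by [below r] is 1 on the cells of radius less than [r], 0 on those of
    radius larger than [r], and varies on the layer of radius [r]. *)
Definition below r j : R := if (`|j| <= r)%N then 1 else 0.

Lemma below01 r j : 0 <= below r j <= 1.
Proof. by rewrite /below; case: ifP; rewrite ?lexx ?ler01. Qed.

Lemma above01 r j : 0 <= 1 - below r j <= 1.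
Proof. by have := below01 r j; lra. Qed.

Lemma below_in r e b : (radius e.2 < r)%N -> below r (hgt e b) = 1.
Proof.
by move=> h; rewrite /below; case: (hgt_radius e b) => ->; rewrite ?h// (ltnW h).
Qed.

Lemma below_out r e b : (r < radius e.2)%N -> below r (hgt e b) = 0.
Proof.
move=> h; rewrite /below; case: (hgt_radius e b) => ->; rewrite leqNgt ?h//.
by rewrite (leq_trans h).
Qed.

Definition shell (q : edge -> R) r e := if radius e.2 == r then q e else 0.

Lemma shell_ge0 q r e : (forall e, 0 <= q e) -> 0 <= shell q r e.
Proof. by move=> q0; rewrite /shell; case: ifP. Qed.

Local Notation inner r := (cut (below r) u).
Local Notation outer r := (cut (fun j => 1 - below r j) u).

Lemma edge_functionals0 f e p : 2 < p -> p < 6 -> H1_edge (ln e) f ->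
  [/\ sqint (ln e) (fun x => 0 * f x + 0 * f x) = 0, dsqint (ln e) (fun x => 0 * f x + 0 * f x) = 0 &
      powint (ln e) p (fun x => 0 * f x + 0 * f x) = 0].
Proof.
move=> p2 p6 ok; split.
- by rewrite sqint_scale// expr0n mul0r.
- by rewrite dsqint_scale// expr0n mul0r.
- by rewrite powint_scale// powR0 ?mul0r// gt_eqF// (lt_trans _ p2).
Qed.

Section CutEnergy.
Variables (p C : R).
Hypotheses (p2 : 2 < p) (p6 : p < 6).
Hypothesis uC : forall e x, 0 <= x <= ln e -> `|u e x| <= C.
Variable r : nat.

Let q e := massE u e + kinE u e.
Let q0 e : 0 <= q e. Proof. by rewrite addr_ge0 ?edge_mass_ge0 ?edge_kin_ge0. Qed.

(** Off the layer one of the two parts is the whole function and the other is zero.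
    On the layer all terms are bounded by the mass and kinetic terms there. *)
Lemma edge_split e :
  [/\ massE (inner r) e + massE (outer r) e <= massE u e,
      kinE (inner r) e + kinE (outer r) e <= kinE u e + (3 + 4 * d^-1 ^+ 2) * shell q r e &
      potE p u e <= potE p (inner r) e + potE p (outer r) e + C `^ (p - 2) * shell q r e].
Proof.
have ok := H1_ok hu e; have [z1 z2 z3] := edge_functionals0 p2 p6 ok.
have M0 := edge_mass_ge0 K u e; have T0 := edge_kin_ge0 K u e.
rewrite /shell; case: ltngtP => h.
- rewrite /edge_mass /edge_kin /edge_pot.
  have -> : inner r e = u e by apply: cut_cst1 => b; exact: below_in.
  have -> : outer r e = (fun x => 0 * u e x + 0 * u e x).
    by apply: cut_cst0 => b; rewrite below_in// subrr.
  by rewrite z1 z2 z3 !mulr0 !addr0.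
- rewrite /edge_mass /edge_kin /edge_pot.
  have -> : outer r e = u e by apply: cut_cst1 => b; rewrite below_out// subr0.
  have -> : inner r e = (fun x => 0 * u e x + 0 * u e x).
    by apply: cut_cst0 => b; rewrite below_out.
  by rewrite z1 z2 z3 !mulr0 !addr0 !add0r.
- have [_ _ k1] := edge_cut e (below01 r).
  have [_ _ k2] := edge_cut e (above01 r).
  have al x : 0 <= x <= ln e -> 0 <= below r (hgt e false) + slope (below r) e * x <= 1.
    by apply: affine_itv => b; exact: below01.
  split.
  + have := sqint_cut ok al.
    by rewrite -cut_opp.
  + apply: (le_trans (lerD k1 k2)); rewrite /q.
    have := mulr_ge0 (sqr_ge0 d^-1) T0; move: M0 T0 (d^-1 ^+ 2) => {k1 k2}.
    by move: (massE u e) (kinE u e) => m t m0 t0 D; lra.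
  + have P1 := edge_pot_ge0 K p (inner r) e; have P2 := edge_pot_ge0 K p (outer r) e.
    have := powint_le p2 p6 ok (@uC e).
    have : 0 <= C `^ (p - 2) * kinE u e by rewrite mulr_ge0 ?powR_ge0.
    rewrite /q mulrDr => h1 h2; apply: (le_trans h2).
    by apply: ler_wpDl (addr_ge0 P1 P2) _; exact: ler_wpDr h1 (lexx _).
Qed.

Lemma summable_shell : summable_fam (shell q r).
Proof.
have [f1 _] := rsumD (edge_mass_ge0 K u) (edge_kin_ge0 K u) (H1_summable_mass hu) (H1_summable_kin hu).
have [] // := le_rsum (a := shell q r) _ f1.
move=> e; rewrite shell_ge0//= /shell; case: ifP => // _; exact: q0.
Qed.

Lemma mass_split : mass (inner r) + mass (outer r) <= mass u.
Proof.
have hi := H1_cut (below01 r); have ho := H1_cut (above01 r).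
apply: (rsum_le2 (edge_mass_ge0 K _) (edge_mass_ge0 K _) (H1_summable_mass hi) (H1_summable_mass ho) (H1_summable_mass hu)) => e.
by have [] := edge_split e.
Qed.

Lemma energy_split_arith (k k1 k2 P P1 P2 X c1 c2 c3 : R) : 0 <= c3 ->
  k1 + k2 <= k + c1 * X -> P <= P1 + P2 + c2 * X ->
  2^-1 * k1 - c3 * P1 + (2^-1 * k2 - c3 * P2) <= 2^-1 * k - c3 * P + (2^-1 * c1 + c3 * c2) * X.
Proof. by move=> h1 h2 /(ler_wpM2l h1); lra. Qed.

(** The error is controlled by the mass and kinetic terms of the layer only. *)
Lemma En_split : En p (inner r) + En p (outer r) <=
  En p u + (2^-1 * (3 + 4 * d^-1 ^+ 2) + p^-1 * C `^ (p - 2)) * rsum (shell q r).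
Proof.
have hi := H1_cut (below01 r); have ho := H1_cut (above01 r).
have sh0 e : 0 <= shell q r e by exact: shell_ge0.
have c1 : 0 <= 3 + 4 * d^-1 ^+ 2 by rewrite addr_ge0// mulr_ge0// sqr_ge0.
have c2 : 0 <= C `^ (p - 2) by exact: powR_ge0.
have kin_le : kin (inner r) + kin (outer r) <= kin u + (3 + 4 * d^-1 ^+ 2) * rsum (shell q r).
  apply: (rsum_le22 c1 (edge_kin_ge0 K _) (edge_kin_ge0 K _) (edge_kin_ge0 K _) sh0 (H1_summable_kin hi) (H1_summable_kin ho)
    (H1_summable_kin hu) summable_shell) => e.
  by have [] := edge_split e.
have pot_le : pot p u <= pot p (inner r) + pot p (outer r) + C `^ (p - 2) * rsum (shell q r).
  apply: (rsum_le13 c2 (edge_pot_ge0 K p _) (edge_pot_ge0 K p _) (edge_pot_ge0 K p _) sh0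
    (H1_pot d0 dK p2 p6 hi) (H1_pot d0 dK p2 p6 ho) summable_shell) => e.
  by have [] := edge_split e.
have p0 : 0 <= p^-1 by rewrite invr_ge0 ltW// (lt_trans _ p2).
exact: energy_split_arith p0 kin_le pot_le.
Qed.

(** The inner part vanishes on the cells of radius larger than [r]. *)
Lemma mass_inner_tail : mass (inner r) + rsum (fun e => if (r < radius e.2)%N then massE u e else 0) <= mass u.
Proof.
have hi := H1_cut (below01 r).
have g0 e : 0 <= (if (r < radius e.2)%N then massE u e else 0) by case: ifP => _ //; exact: edge_mass_ge0.
have gu e : 0 <= (if (r < radius e.2)%N then massE u e else 0) <= massE u e.
  by rewrite g0; case: ifP => _; rewrite ?lexx ?edge_mass_ge0.
have [f1 _] := le_rsum gu (H1_summable_mass hu).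
apply: (rsum_le2 (edge_mass_ge0 K _) g0 (H1_summable_mass hi) f1 (H1_summable_mass hu)) => e; case: ifP => h.
  have [z1 _ _] := edge_functionals0 p2 p6 (H1_ok hu e).
  rewrite {1}/edge_mass cut_cst0 ?z1 ?add0r// => b; exact: below_out.
by rewrite addr0; have [] := edge_cut e (below01 r).
Qed.

(** The inner part agrees with [u] on the cells of radius less than [r]. *)
Lemma pot_inner_ge e : (radius e.2 < r)%N -> potE p u e <= pot p (inner r).
Proof.
move=> h; have hi := H1_cut (below01 r).
have -> : potE p u e = potE p (inner r) e.
  by rewrite /edge_pot cut_cst1// => b; exact: below_in.
exact: (rsum_term e (edge_pot_ge0 K p _) (H1_pot d0 dK p2 p6 hi)).
Qed.

End CutEnergy.
End Cut.

(** The layers of radius 1 to [N] are disjoint. *)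
Lemma shell_pigeonhole (q : edge -> R) N : (forall e, 0 <= q e) -> summable_fam q -> (0 < N)%N ->
  exists r, [/\ (0 < r)%N, (r <= N)%N & N%:R * rsum (shell q r) <= rsum q].
Proof.
move=> q0 sq N0.
have sh0 r e : 0 <= shell q r e by exact: shell_ge0.
have ss r : summable_fam (shell q r).
  have [] // := le_rsum (a := shell q r) _ sq.
  by move=> e; rewrite sh0 /shell; case: ifP => _; rewrite ?lexx ?q0.
pose S N e := if (0 < radius e.2 <= N)%N then q e else 0.
have S0 M e : 0 <= S M e by rewrite /S; case: ifP.
have sS M : summable_fam (S M) /\ rsum (S M) <= rsum q.
  by apply: le_rsum => // e; rewrite S0 /S; case: ifP => _; rewrite ?lexx ?q0.
have SE M : rsum (S M) = \sum_(i < M) rsum (shell q i.+1).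
  elim: M => [|M IH].
    have [|_ ->] := @rsum_supp R _ (S 0%N) [::] (S0 0%N) isT; last by rewrite big_ord0 big_nil.
    by move=> e _; rewrite /S; case: (radius e.2).
  rewrite big_ord_recr/= -IH.
  have [_ <-] := rsumD (S0 M) (sh0 M.+1) (sS M).1 (ss M.+1).
  congr rsum; apply/funext => e; rewrite /S /shell.
  have [->|h] := eqVneq (radius e.2) M.+1; first by rewrite leqnn ltnn /= add0r.
  by rewrite addr0 (leq_eqVlt _ M.+1) (negbTE h) ltnS.
apply: contrapT => H.
have : rsum q < rsum q; last by rewrite ltxx.
have NR : (0 : R) < N%:R by rewrite ltr0n.
apply: (@lt_le_trans _ _ (rsum (S N))); last exact: (sS N).2.
rewrite SE.
apply: (@le_lt_trans _ _ (\sum_(i < N) (rsum q / N%:R))).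
  by rewrite sumr_const card_ord -[leRHS]mulr_natr divfK// gt_eqF.
apply: ltr_sum; first by apply/hasP; exists (Ordinal N0); rewrite ?mem_index_enum.
move=> i _; rewrite ltr_pdivrMr// mulrC ltNge; apply/negP => h; apply: H.
by exists i.+1; split.
Qed.

End Truncation.

(** * Coercivity and scaling *)

(** The inequality of Young with exponents [1/r] and [1/(1 - r)]. *)
Lemma powR_sublinear (R : realType) (a r eps : R) : 0 <= a -> 0 < r -> r < 1 -> 0 < eps ->
  exists C, forall y, 0 <= y -> a * y `^ r <= eps * y + C.
Proof.
move=> a0 r0 r1 e0.
pose q := (1 - r)^-1; have q0 : 0 < q by rewrite invr_gt0 subr_gt0.
exists ((a * eps `^ (- r)) `^ q / q) => y y0.
have ri0 : 0 < r^-1 by rewrite invr_gt0.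
have conj : r^-1^-1 + q^-1 = 1 by rewrite !invrK addrC subrK.
have A0 : 0 <= a * eps `^ (- r) by rewrite mulr_ge0// powR_ge0.
have := conjugate_powR (powR_ge0 (eps * y) r) A0 ri0 q0 conj.
rewrite -powRrM divff ?gt_eqF// powRr1 ?mulr_ge0 ?(ltW e0)// invrK.
have -> : (eps * y) `^ r * (a * eps `^ (- r)) = a * y `^ r.
  rewrite powRM ?(ltW e0)// powRN mulrA; field.
  by rewrite gt_eqF// powR_gt0.
by move=> h; apply: (le_trans h); rewrite lerD2r ler_piMr ?(ltW r1)// mulr_ge0// ltW.
Qed.

Section Coercivity.
Variables (R : realType) (V E : finType) (K : metric_graph R V E).
Variables (Dv Rv : set V) (sigma : V -> V).
Local Notation G := (periodic_graph K Dv sigma).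
Local Notation edge := (E * int)%type.
Local Notation ln e := (len K e.1).
Local Notation mass := (graph_mass K).
Local Notation kin := (graph_kin K).
Local Notation pot := (graph_pot K).
Local Notation En := (graph_energy K).
Implicit Types (u v w : edge -> R -> R) (e : edge) (a c x y C : R) (b : bool) (j : int).
Variables (d p mu : R).
Hypotheses (d0 : 0 < d) (dK : forall k : E, d <= len K k).
Hypotheses (p2 : 2 < p) (p6 : p < 6) (mu0 : 0 < mu).

Definition sup_bound B := Num.sqrt (2 * mu / d + 2 * d * B).

Lemma sup_boundP u B e x : H1 G u -> mass u <= mu -> kin u <= B -> 0 <= x <= ln e ->
  `|u e x| <= sup_bound B.
Proof.
move=> hu hm hk xI; rewrite -sqrtr_sqr ler_wsqrtr//.
apply: le_trans (H1_sup dK hu xI d0 (lexx d)) _; apply: lerD.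
  by apply: ler_wpM2r; [rewrite invr_ge0 ltW|rewrite ler_pM2l].
by apply: ler_wpM2l => //; rewrite mulr_ge0// ltW.
Qed.

(** The estimate [H1_sup] with [c = d / (1 + kin u)^(1/2)], which is of the order of
    the optimal choice. *)
Lemma sup_sqr_le_kin u e x : H1 G u -> mass u <= mu -> 0 <= x <= ln e ->
  u e x ^+ 2 <= (2 * mu / d + 2 * d) * (1 + kin u) `^ 2^-1.
Proof.
move=> hu hm xI; set T := kin u; have T0 : 0 <= T by exact: kin_ge0.
have Y0 : 0 <= 1 + T by rewrite addr_ge0.
set y := (1 + T) `^ 2^-1.
have yy : y * y = 1 + T.
  by rewrite /y powR12_sqrt// -expr2 sqr_sqrtr.
have y1 : 1 <= y.
  have := @powR_le_mono R 2^-1 1 (1 + T); rewrite powR1; apply; rewrite ?invr_ge0 ?lerDl//.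
have y0 : 0 < y by exact: lt_le_trans y1.
have c0 : 0 < d / y by rewrite divr_gt0.
have cd : d / y <= d by rewrite ler_pdivrMr// ler_peMr// ltW.
apply: le_trans (H1_sup dK hu xI c0 cd) _; rewrite [leRHS]mulrDl; apply: lerD.
  rewrite invf_div mulrA mulrAC ler_pM2r//; apply: ler_wpM2r; first by rewrite invr_ge0 ltW.
  by rewrite ler_pM2l.
rewrite -/T -!mulrA ler_pM2l// ler_pM2l// mulrC ler_pdivrMr// yy.
by rewrite lerDr.
Qed.

(** The potential is at most a multiple of [(1 + kin u)^((p - 2)/4)], and
    [(p - 2)/4 < 1]. *)
Lemma coercive : exists C, forall u, H1 G u -> mass u <= mu -> kin u <= 4 * En p u + C.
Proof.
pose c := 2 * mu / d + 2 * d; pose s := 2^-1 * (p - 2).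
have c0 : 0 <= c by rewrite addr_ge0 ?mulr_ge0 ?invr_ge0// ltW.
have s0 : 0 < s by rewrite mulr_gt0// subr_gt0.
have s2 : s < 2 by have := p6; rewrite /s; lra.
have p0 : 0 < p by rewrite (lt_trans _ p2).
have a0 : 0 <= mu * c `^ s / p by rewrite divr_ge0 ?(ltW p0)// mulr_ge0 ?powR_ge0// ltW.
have r0 : 0 < 2^-1 * s by rewrite mulr_gt0.
have r1 : 2^-1 * s < 1 by lra.
have e0 : (0 : R) < 4^-1 by rewrite invr_gt0.
have [C HC] := powR_sublinear a0 r0 r1 e0.
exists (1 + 4 * C) => u hu hm.
have T0 : 0 <= kin u by exact: kin_ge0.
have Y0 : 0 <= 1 + kin u by rewrite addr_ge0.
have := HC (1 + kin u) Y0.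
have A0 : 0 <= c * (1 + kin u) `^ 2^-1 by rewrite mulr_ge0// powR_ge0.
have B e x : 0 <= x <= ln e -> `|u e x| <= Num.sqrt (c * (1 + kin u) `^ 2^-1).
  by move=> xI; rewrite -sqrtr_sqr ler_wsqrtr// sup_sqr_le_kin.
have [_ hP] := pot_le p2 p6 hu B.
have : pot p u / p <= mu * c `^ s / p * (1 + kin u) `^ (2^-1 * s).
  rewrite mulrAC ler_pM2r ?invr_gt0//; apply: (le_trans hP).
  have -> : Num.sqrt (c * (1 + kin u) `^ 2^-1) `^ (p - 2) = c `^ s * (1 + kin u) `^ (2^-1 * s).
    by rewrite -powR12_sqrt// -powRrM powRM ?powR_ge0// -powRrM.
  rewrite mulrC -mulrA; apply: ler_wpM2r => //.
  by rewrite mulr_ge0// powR_ge0.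
rewrite /graph_energy mulrC.
set P := p^-1 * pot p u; set Q := mu * c `^ s / p * _; set T := kin u.
by move: P Q T => P Q T h1 h2; lra.
Qed.

Lemma scaled_energy_arith (t k S i P : R) : t != 0 ->
  t^-1 * (2^-1 * (t * k) - i * (t * S * P)) = 2^-1 * k - S * (i * P).
Proof. by move=> t0; field. Qed.

Section Scaling.
Variable I : R.
Hypothesis Imin : forall u, H1 G u -> mass u = mu -> I <= En p u.

(** Apply the minimality to the multiple of [w] of mass [mu]: its kinetic term is
    multiplied by [mu / mass w] and its potential term by a larger power. *)
Lemma En_scaled w : H1 G w -> 0 < mass w ->
  mass w / mu * I + ((mu / mass w) `^ (2^-1 * p - 1) - 1) * (p^-1 * pot p w) <= En p w.
Proof.
move=> hw m0; set m := mass w in m0 *.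
set th := mu / m; have th0 : 0 < th by rewrite divr_gt0.
pose a := th `^ 2^-1; have a0 : 0 <= a by exact: powR_ge0.
have aa : a ^+ 2 = th by rewrite /a powR12_sqrt ?ltW// sqr_sqrtr// ltW.
have ap : a `^ p = th * th `^ (2^-1 * p - 1).
  rewrite /a -powRrM -{2}[th]powRr1 ?ltW// -powRD; first by rewrite addrC subrK.
  by rewrite (gt_eqF th0) implybT.
have hz := H1_lin a 0 hw hw.
have mz : mass (lin a 0 w w) = mu by rewrite (mass_scale a hw) aa /th divfK// gt_eqF.
have := Imin hz mz; rewrite /graph_energy (kin_scale a hw) (pot_scale d0 dK p2 p6 a0 hw) aa ap.
have th1 : 0 <= th^-1 by rewrite invr_ge0 ltW.
move=> /(ler_wpM2l th1).
have -> : m / mu = th^-1 by rewrite invf_div.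
set S := th `^ _.
have -> : th^-1 * (2^-1 * (th * kin w) - p^-1 * (th * S * pot p w)) = 2^-1 * kin w - S * (p^-1 * pot p w).
  by apply: scaled_energy_arith; rewrite gt_eqF.
by move: (th^-1 * I) (p^-1 * pot p w) (kin w) => X Y T; lra.
Qed.

Hypothesis I0 : I < 0.

(** The gain in [En_scaled] is nonnegative when the mass is at most [mu]. *)
Lemma En_ge_part w : H1 G w -> mass w <= mu -> mass w / mu * I <= En p w.
Proof.
move=> hw hm; have := mass_ge0 K w; rewrite le_eqVlt => /predU1P[m0|m0].
  rewrite -m0 !mul0r.
  have [C wC] := H1_bounded d0 dK hw.
  have [_] := pot_le p2 p6 hw wC; rewrite -m0 mulr0 => P0.
  have : p^-1 * pot p w <= 0 by rewrite mulr_ge0_le0// invr_ge0 ltW// (lt_trans _ p2).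
  by have := kin_ge0 K w; rewrite /graph_energy; move: (p^-1 * _) (kin w) => *; lra.
apply: le_trans (En_scaled hw m0); rewrite lerDl mulr_ge0//.
  rewrite subr_ge0; have := @powR_le_mono R (2^-1 * p - 1) 1 (mu / mass w).
  rewrite powR1; apply => //; first by have := p2; lra.
  by rewrite ler_pdivlMr// mul1r.
by rewrite mulr_ge0 ?pot_ge0// invr_ge0 ltW// (lt_trans _ p2).
Qed.

Lemma En_ge w : H1 G w -> mass w <= mu -> I <= En p w.
Proof.
move=> hw hm; apply: le_trans (En_ge_part hw hm).
have : mass w / mu <= 1 by rewrite ler_pdivrMr// mul1r.
by move: (mass w / mu) I0 => t; nra.
Qed.

End Scaling.
End Coercivity.

(** * A function of negative energy *)

Section Tent.
Variables (R : realType) (V E : finType) (K : metric_graph R V E).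
Variables (Dv Rv : set V) (sigma : V -> V).
Hypothesis DR : Dv `&` Rv = set0.
Hypothesis sigmaDR : set_bij Dv Rv sigma.
Local Notation G := (periodic_graph K Dv sigma).
Local Notation edge := (E * int)%type.
Local Notation ln e := (len K e.1).
Local Notation massE := (edge_mass K).
Local Notation kinE := (edge_kin K).
Local Notation potE := (edge_pot K).
Local Notation mass := (graph_mass K).
Local Notation kin := (graph_kin K).
Local Notation pot := (graph_pot K).
Local Notation En := (graph_energy K).
Local Notation cut := (cutoff K Dv).
Local Notation hgt := (end_height K Dv).
Local Notation slope := (edge_slope K Dv).
Implicit Types (u v w : edge -> R -> R) (e : edge) (a c x y C : R) (b : bool) (j : int) (n : nat).
Variables (d p mu : R).
Hypotheses (d0 : 0 < d) (dK : forall k : E, d <= len K k).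
Hypotheses (p2 : 2 < p) (p6 : p < 6) (mu0 : 0 < mu).

Let l0 e : 0 < ln e. Proof. exact: len_gt0. Qed.

(** A tent of height [2n] as a function of the height of the vertices; the
    subtraction of natural numbers truncates it at zero. *)
Definition hat n j : R := (2 * n - `|j|)%:R.

Definition hatfun n : edge -> R -> R := cut (hat n) (fun _ _ => 1).

Lemma hatE n e b : hat n (hgt e b) = (2 * n - radius e.2)%:R \/ hat n (hgt e b) = (2 * n - (radius e.2).+1)%:R.
Proof. by rewrite /hat; case: (hgt_radius K Dv e b) => ->; [left|right]. Qed.

Lemma hat_step n e : (hat n (hgt e true) - hat n (hgt e false)) ^+ 2 <= 1.
Proof.
have H (k : nat) : ((2 * n - k)%:R - (2 * n - k.+1)%:R : R) ^+ 2 <= 1.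
  rewrite subnS; case: (2 * n - k)%N => [|m] /=; first by rewrite subrr expr0n.
  by rewrite -natr1 addrC addKr expr1n.
case: (hatE n e true) => ->; case: (hatE n e false) => ->; rewrite ?subrr ?expr0n//.
by rewrite -sqrrN opprB.
Qed.

Lemma hatfun_ok n : graph_continuous G (hatfun n) /\ forall e, H1_edge (ln e) (hatfun n e).
Proof. by apply: (graph_continuous_cut DR sigmaDR) => // e; exact: H1_edge_cst1. Qed.

Lemma hatfun_edge n e : hatfun n e = (fun x => hat n (hgt e false) + slope (hat n) e * x).
Proof. by apply/funext => x; rewrite /hatfun /cutoff mulr1. Qed.

Lemma hatfun_out n e : (2 * n <= radius e.2)%N ->
  [/\ massE (hatfun n) e = 0, kinE (hatfun n) e = 0 & potE p (hatfun n) e = 0].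
Proof.
move=> h; rewrite /edge_mass /edge_kin /edge_pot.
have -> : hatfun n e = (fun x => 0 * 1 + 0 * 1).
  apply: cut_cst0 => b; case: (hatE n e b) => ->; apply/eqP; rewrite pnatr_eq0 subn_eq0//.
  exact: leq_trans h _.
exact: (edge_functionals0 p2 p6 (H1_edge_cst1 (l0 e))).
Qed.

Lemma hatfun_le n e : massE (hatfun n) e <= (2 * n)%:R ^+ 2 * ln e /\ kinE (hatfun n) e <= (ln e)^-1.
Proof.
have [_ ok] := hatfun_ok n; split.
  apply: sqint_le => // x xI; rewrite hatfun_edge.
  have /(_ xI) : 0 <= x <= ln e -> 0 <= hat n (hgt e false) + slope (hat n) e * x <= (2 * n)%:R.
    apply: affine_itv => b; case: (hatE n e b) => ->; rewrite ler0n ler_nat leq_subr//.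
  by move=> /andP[h1 h2]; rewrite ger0_norm.
rewrite /edge_kin hatfun_edge dsqint_affine//.
rewrite /edge_slope exprMn mulrAC -mulrA.
have -> : ln e * (ln e)^-1 ^+ 2 = (ln e)^-1 by rewrite expr2 mulrA divff ?mul1r// gt_eqF.
apply: ler_piMl; [by rewrite invr_ge0 ltW|exact: hat_step].
Qed.

Lemma hatfun_ge n e : (radius e.2 < n)%N ->
  n%:R ^+ 2 * ln e <= massE (hatfun n) e /\ n%:R `^ p * ln e <= potE p (hatfun n) e.
Proof.
move=> h; have [_ ok] := hatfun_ok n.
have H x : 0 <= x <= ln e -> n%:R <= `|hatfun n e x|.
  move=> xI; rewrite hatfun_edge.
  have /(_ xI) : 0 <= x <= ln e -> n%:R <= hat n (hgt e false) + slope (hat n) e * x <= (2 * n)%:R.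
    apply: affine_itv => b; case: (hatE n e b) => ->; rewrite !ler_nat leq_subr andbT;
    by rewrite mul2n -addnn -addnBA ?leq_addr// ltnW.
  by move=> /andP[h1 h2]; rewrite ger0_norm// (le_trans _ h1).
by split; [apply: sqint_ge|apply: powint_ge].
Qed.

Lemma hatfun_H1 n : H1 G (hatfun n) /\
  (mass (hatfun n) <= (2 * (2 * n))%:R * ((2 * n)%:R ^+ 2 * \sum_(k : E) len K k) /\
   kin (hatfun n) <= (2 * (2 * n))%:R * \sum_(k : E) (len K k)^-1).
Proof.
have lK (k : E) : 0 < len K k by exact: len_gt0.
have M0 (k : E) : 0 <= (2 * n)%:R ^+ 2 * len K k by rewrite mulr_ge0 ?sqr_ge0// ltW.
have T0 (k : E) : 0 <= (len K k)^-1 by rewrite invr_ge0 ltW.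
have [s1 e1] := rsum_cells (2 * n) M0; have [s2 e2] := rsum_cells (2 * n) T0.
have [cu ok] := hatfun_ok n.
have [s3 h3] : summable_fam (massE (hatfun n)) /\ rsum (massE (hatfun n)) <=
   rsum (fun e : edge => if (radius e.2 < 2 * n)%N then (2 * n)%:R ^+ 2 * ln e else 0).
  apply: le_rsum => // e; rewrite edge_mass_ge0/=; case: ltnP => h; first by case: (hatfun_le n e).
  by case: (hatfun_out h) => ->.
have [s4 h4] : summable_fam (kinE (hatfun n)) /\ rsum (kinE (hatfun n)) <=
   rsum (fun e : edge => if (radius e.2 < 2 * n)%N then (ln e)^-1 else 0).
  apply: le_rsum => // e; rewrite edge_kin_ge0/=; case: ltnP => h; first by case: (hatfun_le n e).
  by case: (hatfun_out h) => _ ->.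
split; first by apply/H1P.
by rewrite mulr_sumr -e1 -e2.
Qed.

Lemma hatfun_lower n :
  (2 * n)%:R * (n%:R ^+ 2 * \sum_(k : E) len K k) <= mass (hatfun n) /\
  (2 * n)%:R * (n%:R `^ p * \sum_(k : E) len K k) <= pot p (hatfun n).
Proof.
have lK (k : E) : 0 < len K k by exact: len_gt0.
have [hH _] := hatfun_H1 n.
have M0 (k : E) : 0 <= n%:R ^+ 2 * len K k by rewrite mulr_ge0 ?sqr_ge0// ltW.
have P0 (k : E) : 0 <= n%:R `^ p * len K k by rewrite mulr_ge0 ?powR_ge0// ltW.
have [s1 e1] := rsum_cells n M0; have [s2 e2] := rsum_cells n P0.
rewrite -mulr_sumr in e1; rewrite -mulr_sumr in e2; rewrite -e1 -e2; split.
  apply: (le_rsum _ (H1_summable_mass hH)).2 => e; case: ltnP => h; last by rewrite lexx edge_mass_ge0.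
  by rewrite M0/=; case: (hatfun_ge h).
apply: (le_rsum _ (H1_pot d0 dK p2 p6 hH)).2 => e; case: ltnP => h; last by rewrite lexx edge_pot_ge0.
by rewrite P0/=; case: (hatfun_ge h).
Qed.

(** The tent has kinetic term of order [n], mass of order [n^3] and potential
    term of order [n^(p + 1)].  After scaling to mass [mu] the quotient of the
    potential and the kinetic term is of order [n ^ q] with [q = 3 - p/2 > 0]. *)
Lemma negative_energy : (exists k : E, True) -> exists u, [/\ H1 G u, mass u = mu & En p u < 0].
Proof.
move=> [k0 _].
have lK (k : E) : 0 < len K k by exact: len_gt0.
set S := \sum_(k : E) len K k; set Q := \sum_(k : E) (len K k)^-1.
have S0 : 0 < S.
  rewrite /S (bigD1 k0)//= ltr_pwDl// sumr_ge0// => k _; exact: ltW.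
have Q0 : 0 <= Q by rewrite sumr_ge0// => k _; rewrite invr_ge0 ltW.
pose s := 2^-1 * (p - 2); pose q := 2 - s.
have s0 : 0 <= s by have := p2; rewrite /s; lra.
have q0 : 0 < q by have := p6; rewrite /q /s; lra.
have p0 : 0 < p by rewrite (lt_trans _ p2).
pose A := (mu / (16 * S)) `^ s; have A0 : 0 < A by rewrite powR_gt0// divr_gt0// mulr_gt0.
(* the energy is negative as soon as [n ^ q] exceeds this quotient *)
pose X := p * Q / (A * S); have X0 : 0 <= X by rewrite divr_ge0 ?mulr_ge0// ltW.
have [n [n0 hn]] : exists n, (0 < n)%N /\ X < n%:R `^ q.
  pose Y := X `^ q^-1; have Y0 : 0 <= Y by exact: powR_ge0.
  exists (Num.truncn Y).+1; split => //.
  have h : Y < (Num.truncn Y).+1%:R by rewrite truncnS_gt.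
  have -> : X = Y `^ q by rewrite /Y -powRrM mulVf ?gt_eqF// powRr1.
  by apply: gt0_ltr_powR; rewrite ?nnegrE// ltW// (le_lt_trans Y0).
have nR : 0 < n%:R :> R by rewrite ltr0n.
have [hH [hM hT]] := hatfun_H1 n; have [hm hP] := hatfun_lower n.
have m0 : 0 < mass (hatfun n).
  by apply: lt_le_trans hm; rewrite !mulr_gt0 ?exprn_gt0// natrM mulr_gt0.
set m := mass (hatfun n) in m0 hM hm.
pose th := mu / m; have th0 : 0 < th by rewrite divr_gt0.
pose a := th `^ 2^-1; have a0 : 0 <= a by exact: powR_ge0.
have aa : a ^+ 2 = th by rewrite /a powR12_sqrt ?ltW// sqr_sqrtr// ltW.
have ap : a `^ p = th * th `^ s.
  rewrite /a -powRrM -{2}[th]powRr1 ?ltW// -powRD.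
    by congr (_ `^ _); rewrite /s; field.
  by rewrite (gt_eqF th0) implybT.
exists (lin a 0 (hatfun n) (hatfun n)); split.
- exact: H1_lin.
- by rewrite (mass_scale a hH) aa /th divfK// gt_eqF.
rewrite /graph_energy (kin_scale a hH) (pot_scale d0 dK p2 p6 a0 hH) aa ap.
pose D := ((n%:R ^+ 3)^-1 : R) `^ s; have D0 : 0 <= D by exact: powR_ge0.
have ths : A * D <= th `^ s.
  rewrite /A /D -powRM ?divr_ge0 ?mulr_ge0 ?(ltW S0) ?(ltW mu0)// ?invr_ge0 ?exprn_ge0//.
  apply: powR_le_mono => //.
    by rewrite mulr_ge0// ?invr_ge0 ?exprn_ge0// divr_ge0 ?mulr_ge0 ?(ltW S0) ?(ltW mu0).
  rewrite /th -mulrA ler_pM2l// -invfM lef_pV2 ?posrE//; last by rewrite !mulr_gt0 ?exprn_gt0.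
  apply: (le_trans hM); rewrite !natrM -/S.
  by rewrite le_eqVlt; apply/orP; left; apply/eqP; ring.
have DN : D * n%:R `^ p = n%:R `^ q.
  rewrite /D -(powR_mulrn 3 (ltW nR)) -powRN -powRrM -powRD; last by rewrite (gt_eqF nR) implybT.
  by congr (_ `^ _); rewrite /q /s; field.
suff H : 2^-1 * kin (hatfun n) < th `^ s * (p^-1 * pot p (hatfun n)).
  rewrite -(@pmulr_rlt0 _ th^-1) ?invr_gt0// scaled_energy_arith ?gt_eqF//.
  by rewrite subr_lt0.
have pi0 : 0 < p^-1 by rewrite invr_gt0.
have n2 : 0 < (2 * n)%:R :> R by rewrite ltr0n muln_gt0.
apply: (@lt_le_trans _ _ (A * D * (p^-1 * ((2 * n)%:R * (n%:R `^ p * S))))); last first.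
  apply: ler_pM => //; first by rewrite mulr_ge0// ltW.
    by rewrite !mulr_ge0 ?powR_ge0// ltW.
  by rewrite ler_pM2l.
have -> : A * D * (p^-1 * ((2 * n)%:R * (n%:R `^ p * S))) = (2 * n)%:R * (p^-1 * (A * S * n%:R `^ q)).
  by rewrite -DN; ring.
apply: (@le_lt_trans _ _ ((2 * n)%:R * Q)).
  have := hT; rewrite -/Q natrM -mulrA; move: (kin _) ((2 * n)%:R * Q) => T B; lra.
rewrite ltr_pM2l// mulrC ltr_pdivlMr// mulrC.
by move: hn; rewrite /X ltr_pdivrMr ?mulr_gt0// [ltRHS]mulrC.
Qed.

End Tent.

(** * Tightness of near-minimizers *)

Section Tightness.
Variables (R : realType) (V E : finType) (K : metric_graph R V E).
Variables (Dv Rv : set V) (sigma : V -> V).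
Hypothesis DR : Dv `&` Rv = set0.
Hypothesis sigmaDR : set_bij Dv Rv sigma.
Local Notation G := (periodic_graph K Dv sigma).
Local Notation edge := (E * int)%type.
Local Notation ln e := (len K e.1).
Local Notation massE := (edge_mass K).
Local Notation kinE := (edge_kin K).
Local Notation mass := (graph_mass K).
Local Notation kin := (graph_kin K).
Local Notation pot := (graph_pot K).
Local Notation En := (graph_energy K).
Implicit Types (u v w : edge -> R -> R) (e : edge) (a c x y C : R) (b : bool) (j : int) (n N : nat).
Variables (d p mu : R).
Hypotheses (d0 : 0 < d) (dK : forall k : E, d <= len K k).
Hypotheses (p2 : 2 < p) (p6 : p < 6) (mu0 : 0 < mu).
Variable I : R.
Hypothesis Imin : forall u, H1 G u -> mass u = mu -> I <= En p u.
Hypothesis I0 : I < 0.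

Definition mass_tail n u e := if (n < radius e.2)%N then massE u e else 0.

Lemma tail_ge0 n u e : 0 <= mass_tail n u e.
Proof. by rewrite /mass_tail; case: ifP => _ //; exact: edge_mass_ge0. Qed.

Lemma summable_tail n u : H1 G u -> summable_fam (mass_tail n u).
Proof.
move=> hu; have [] // := le_rsum (a := mass_tail n u) _ (H1_summable_mass hu).
by move=> e; rewrite tail_ge0 /mass_tail; case: ifP => _; rewrite ?lexx ?edge_mass_ge0.
Qed.

Lemma tail_mono n N u : H1 G u -> (n <= N)%N -> rsum (mass_tail N u) <= rsum (mass_tail n u).
Proof.
move=> hu nN; apply: (le_rsum _ (summable_tail n hu)).2 => e; rewrite tail_ge0 /mass_tail.
case: ltnP => h; first by rewrite (leq_ltn_trans nN h)/=.
by case: ifP => _ //=; exact: edge_mass_ge0.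
Qed.

(** The energies of the two parts add up to at least [I] plus the gain of the inner
    part. *)
Lemma dichotomy_arith (m m' S P ei eo eu eps shl : R) :
  0 <= m' -> m + m' <= mu -> m / mu * I + S * P <= ei -> m' / mu * I <= eo ->
  ei + eo <= eu + shl -> eu < I + eps -> shl <= eps -> S * P < 2 * eps.
Proof.
move=> m0 mm h1 h2 h3 h4 h5.
have : m / mu + m' / mu <= 1 by rewrite -mulrDl ler_pdivrMr// mul1r.
move: (m / mu) (m' / mu) (S * P) h1 h2 I0 => x y z h1 h2 h6 h7.
have : I <= (x + y) * I by nra.
lra.
Qed.

(** The energy of [u] is almost the sum of the energies of its inner and outer
    parts.  These are at least [I] in total, and more by a definite amount if
    the inner part has mass less than [mu - eta], because its potential is
    bounded from below by the values of [u] in the cell 0. *)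
Lemma tightness (c eta : R) : 0 < c -> 0 < eta -> exists eps N, 0 < eps /\
  forall u, H1 G u -> mass u = mu -> En p u < I + eps ->
  (exists (k : E) x, 0 <= x <= len K k /\ 2 * c <= `|u (k, 0) x|) ->
  rsum (mass_tail N u) <= eta.
Proof.
move=> c0 eta0.
have p0 : 0 < p by rewrite (lt_trans _ p2).
have [C1 HC1] := coercive Dv sigma d0 dK p2 p6 mu0.
pose B := `|4 * (I + 1) + C1|; have B0 : 0 <= B by exact: normr_ge0.
have B1 : 0 < B + 1 by rewrite ltr_wpDl.
pose C := sup_bound d mu B.
(* on an interval of this length the functions vary by at most [c] *)
pose d' := Num.min d (c ^+ 2 / (B + 1)).
have d'0 : 0 < d' by rewrite lt_min d0 divr_gt0// exprn_gt0.
pose P0 := c `^ p * d'; have P00 : 0 < P0 by rewrite mulr_gt0// powR_gt0.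
(* the constant in the error of [En_split] *)
pose A := 2^-1 * (3 + 4 * d^-1 ^+ 2) + p^-1 * C `^ (p - 2).
have A0 : 0 <= A.
  by rewrite addr_ge0 ?mulr_ge0 ?powR_ge0 ?invr_ge0 ?(ltW p0)// addr_ge0// mulr_ge0// sqr_ge0.
pose s := 2^-1 * p - 1; have s0 : 0 < s by have := p2; rewrite /s; lra.
have [eta_mu|eta_mu] := leP mu eta.
  exists 1, 0%N; split => // u hu hm _ _; apply: le_trans eta_mu; rewrite -hm.
  apply: (le_rsum _ (H1_summable_mass hu)).2 => e.
  by rewrite tail_ge0 /mass_tail; case: ifP => _; rewrite ?lexx ?edge_mass_ge0.
(* the gain factor in [En_scaled] for the mass [mu - eta] *)
pose D := (mu / (mu - eta)) `^ s - 1.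
have m10 : 0 < mu - eta by rewrite subr_gt0.
have D0 : 0 < D.
  have q1 : 1 < mu / (mu - eta) by rewrite ltr_pdivlMr// mul1r gtrBl.
  have -> : D = (mu / (mu - eta)) `^ s - 1 `^ s by rewrite powR1.
  rewrite subr_gt0; apply: gt0_ltr_powR; rewrite ?nnegrE//.
  by rewrite (le_trans ler01)// ltW.
have PP0 : 0 < p^-1 * P0 by rewrite mulr_gt0// invr_gt0.
pose eps := Num.min 1 (D * (p^-1 * P0) / 2).
have e0 : 0 < eps by rewrite lt_min ltr01 divr_gt0// mulr_gt0.
have e1 : eps <= 1 by rewrite ge_min lexx.
have e2 : 2 * eps <= D * (p^-1 * P0) by rewrite mulrC -ler_pdivlMr// ge_min lexx orbT.
pose N := (Num.truncn (A * (mu + B) / eps)).+1.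
have NR : A * (mu + B) / eps < N%:R by exact: truncnS_gt.
exists eps, N; split => // u hu hm hE [k [x [xI ux]]].
have hB : kin u <= B.
  apply: le_trans (ler_norm _); apply: (le_trans (HC1 u hu _)); first by rewrite hm.
  by move: hE e1; move: (En p u) => *; lra.
have uC e y : 0 <= y <= ln e -> `|u e y| <= C.
  by move=> yI; apply: (sup_boundP d0 dK hu) => //; rewrite hm.
pose q e := massE u e + kinE u e.
have q0 e : 0 <= q e by rewrite addr_ge0 ?edge_mass_ge0 ?edge_kin_ge0.
have [sq qE] := rsumD (edge_mass_ge0 K u) (edge_kin_ge0 K u) (H1_summable_mass hu) (H1_summable_kin hu).
have [r [r0 rN hr]] := shell_pigeonhole q0 sq (ltn0Sn _ : (0 < N)%N).
have shell_le : A * rsum (shell q r) <= eps.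
  have NR0 : 0 < N%:R :> R by rewrite ltr0n.
  rewrite -(ler_pM2l NR0) mulrCA.
  apply: (@le_trans _ _ (A * (mu + B))).
    apply: ler_wpM2l => //; apply: (le_trans hr); rewrite qE -/(mass u) hm lerD2l//.
  by rewrite -ler_pdivrMr// ltW.
have hi := H1_cut DR sigmaDR d0 dK hu (below01 R r).
have ho := H1_cut DR sigmaDR d0 dK hu (above01 R r).
set ui := cutoff K Dv (below R r) u in hi.
set uo := cutoff K Dv _ u in ho.
have hE2 := En_split DR sigmaDR d0 dK hu p2 p6 uC r.
rewrite -/ui -/uo in hE2.
have hms := mass_split DR sigmaDR d0 dK hu p2 p6 uC r.
rewrite -/ui -/uo hm in hms.
have mo0 := mass_ge0 K uo; have mi0 := mass_ge0 K ui.
have him : mass ui <= mu by apply: le_trans hms; rewrite lerDl.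
have hom : mass uo <= mu by apply: le_trans hms; rewrite lerDr.
have hP : P0 <= pot p ui.
  apply: le_trans (pot_inner_ge DR sigmaDR d0 dK hu p2 p6 (e := (k, 0)) r0).
  apply: (powint_ge_sub (len_gt0 K k) p2 p6 (H1_ok hu (k, 0)) xI d'0 _ (ltW c0) ux).
    by rewrite ge_min dK.
  apply: (@le_trans _ _ (d' * (B + 1))).
    rewrite ler_pM2l//; apply: (@le_trans _ _ (kin u)).
      exact: (rsum_term (k, 0) (edge_kin_ge0 K u) (H1_summable_kin hu)).
    by apply: (le_trans hB); rewrite lerDl.
  by rewrite -ler_pdivlMr// ge_min lexx orbT.
have mi1 : 0 < mass ui.
  rewrite lt_neqAle mi0 andbT; apply/eqP => m00.
  have [C2 uC2] := H1_bounded d0 dK hi.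
  have [_] := pot_le p2 p6 hi uC2; rewrite -m00 mulr0 => h.
  by have := lt_le_trans P00 (le_trans hP h); rewrite ltxx.
have hEi := En_scaled d0 dK p2 p6 mu0 Imin hi mi1.
have hEo := En_ge_part d0 dK p2 p6 mu0 Imin ho hom.
have := dichotomy_arith mo0 hms hEi hEo hE2 hE shell_le.
rewrite -/s => small.
have mi_ge : mu - eta <= mass ui.
  rewrite leNgt; apply/negP => lt.
  have le1 : D <= (mu / mass ui) `^ s - 1.
    rewrite lerD2r; apply: powR_le_mono => //; first exact: ltW.
      by rewrite divr_ge0// ltW.
    by rewrite ler_pM2l// lef_pV2 ?posrE// ltW.
  have le2 : p^-1 * P0 <= p^-1 * pot p ui by rewrite ler_pM2l// invr_gt0.
  have := ler_pM (ltW D0) (ltW PP0) le1 le2.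
  by move=> /(le_trans e2) h; have := le_lt_trans h small; rewrite ltxx.
have ht := mass_inner_tail DR sigmaDR d0 dK hu p2 p6 r.
rewrite -/ui hm in ht.
apply: (le_trans (tail_mono hu rN)); rewrite /mass_tail.
by rewrite -(lerD2l (mass ui)); apply: (le_trans ht); rewrite -lerBlDr.
Qed.

End Tightness.

(** * Compactness of near-minimizers *)

Lemma ultra_fmap (T S : Type) (U : set_system T) (f : T -> S) : UltraFilter U -> UltraFilter (f @ U).
Proof.
move=> UU; split; first exact: fmap_proper_filter.
move=> H PH sH; apply/seteqP; split => // A HA.
have [//|UA] := in_ultra_setVsetC (f @^-1` A) UU.
exfalso; apply: (@filter_not_empty _ H).
by rewrite -(setICr A); apply: filterI => //; exact: sH.
Qed.

(** Along an ultrafilter a bounded function converges, by compactness of closed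
    intervals. *)
Lemma ultra_cvg_bounded (R : realType) (T : Type) (U : set_system T) (f : T -> R) (C : R) :
  UltraFilter U -> (\forall u \near U, `|f u| <= C) -> cvg (f @ U).
Proof.
move=> UU fC; have FU := ultra_fmap f UU.
have := @segment_compact R (- C) C; rewrite compact_ultra => /(_ (f @ U) FU) [|l [_ fl]].
  by apply: filterS fC => u /=; rewrite in_itv/= ler_norml.
by apply/cvg_ex; exists l.
Qed.

Section Compactness.
Variables (R : realType) (V E : finType) (K : metric_graph R V E).
Variables (Dv Rv : set V) (sigma : V -> V).
Hypothesis DR : Dv `&` Rv = set0.
Hypothesis sigmaDR : set_bij Dv Rv sigma.
Local Notation G := (periodic_graph K Dv sigma).
Local Notation edge := (E * int)%type.
Local Notation ln e := (len K e.1).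
Local Notation massE := (edge_mass K).
Local Notation kinE := (edge_kin K).
Local Notation mass := (graph_mass K).
Local Notation kin := (graph_kin K).
Local Notation pot := (graph_pot K).
Local Notation En := (graph_energy K).
Implicit Types (u v w : edge -> R -> R) (e : edge) (a x y C : R) (b : bool) (n N : nat).
Variables (d p mu : R).
Hypotheses (d0 : 0 < d) (dK : forall k : E, d <= len K k).
Hypotheses (p2 : 2 < p) (p6 : p < 6) (mu0 : 0 < mu).
Variable I : R.
Hypothesis Imin : forall u, H1 G u -> mass u = mu -> I <= En p u.
Hypothesis I0 : I < 0.

Let l0 e : 0 < ln e. Proof. exact: len_gt0. Qed.

Variables (c : R).
Hypothesis c0 : 0 < c.

Definition minimizing (eps : R) : set (edge -> R -> R) :=
  [set u | [/\ H1 G u, mass u = mu, En p u < I + eps &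
     exists (k : E) x, 0 <= x <= len K k /\ 2 * c <= `|u (k, 0) x| ]].

Variable U : set_system (edge -> R -> R).
Hypothesis UU : UltraFilter U.
Hypothesis US : forall eps, 0 < eps -> U (minimizing eps).

Lemma H1_near : \forall u \near U, H1 G u.
Proof. by apply: filterS (US ltr01) => u []. Qed.

Lemma near_bounds : exists B C, [/\ 0 < B, 0 <= C & \forall u \near U, [/\ H1 G u, mass u = mu, kin u <= B &
  forall e x, 0 <= x <= ln e -> `|u e x| <= C]].
Proof.
have [C1 HC1] := coercive Dv sigma d0 dK p2 p6 mu0.
pose B := `|4 * (I + 1) + C1| + 1.
have B0 : 0 < B by rewrite ltr_wpDl.
exists B, (sup_bound d mu B); split => //; first exact: sqrtr_ge0.
apply: filterS (US ltr01) => u [hu hm hE _].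
have hB : kin u <= B.
  apply: (@le_trans _ _ `|4 * (I + 1) + C1|); last by rewrite lerDl.
  apply: le_trans (ler_norm _); apply: (le_trans (HC1 u hu _)); first by rewrite hm.
  by rewrite lerD2r ler_pM2l// ltW.
split => // e x xI; apply: (sup_boundP d0 dK hu) => //; by rewrite hm.
Qed.

(** The pointwise limit along the ultrafilter, which turns out to be a ground state. *)
Definition ulim e x : R := lim ((fun u : edge -> R -> R => u e x) @ U).

Lemma ulim_cvg e x : 0 <= x <= ln e -> (fun u : edge -> R -> R => u e x) @ U --> ulim e x.
Proof.
move=> xI; have [B [C [_ _ H]]] := near_bounds.
apply: (@ultra_cvg_bounded _ _ U _ C); apply: filterS H => u [_ _ _]; exact.
Qed.

Lemma holder_le B e u x y : H1 G u -> kin u <= B -> 0 <= x <= ln e -> 0 <= y <= ln e ->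
  (u e y - u e x) ^+ 2 <= `|y - x| * B.
Proof.
move=> hu hB xI yI; apply: le_trans (H1_edge_holder (l0 e) (H1_ok hu e) xI yI) _.
apply: ler_wpM2l => //; apply: le_trans hB.
exact: (rsum_term e (edge_kin_ge0 K u) (H1_summable_kin hu)).
Qed.

Lemma ulim_holder B e x y : (\forall u \near U, H1 G u /\ kin u <= B) ->
  0 <= x <= ln e -> 0 <= y <= ln e -> (ulim e y - ulim e x) ^+ 2 <= `|y - x| * B.
Proof.
move=> H xI yI.
have L : (fun u : edge -> R -> R => (u e y - u e x) ^+ 2) @ U --> (ulim e y - ulim e x) ^+ 2.
  by rewrite expr2; apply: cvgM; apply: cvgB; exact: ulim_cvg.
apply: (cvgr_to_le L); apply: filterS H => u [hu hB]; exact: holder_le.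
Qed.

(** It is enough to control finitely many equidistant points of the edge, as all
    functions and the limit satisfy the same Hoelder bound. *)
Lemma ulim_uniform e (dl : R) : 0 < dl ->
  \forall u \near U, forall x, 0 <= x <= ln e -> `|u e x - ulim e x| <= dl.
Proof.
move=> dl0; have [B [C [B0 _ H]]] := near_bounds.
have l0e := l0 e.
(* over a distance [h] the functions vary by at most [dl / 3] *)
pose h := (dl / 3) ^+ 2 / B.
have dl3 : 0 < dl / 3 by rewrite divr_gt0.
have h0 : 0 < h by rewrite divr_gt0// exprn_gt0.
pose n := (Num.truncn (ln e / h)).+1.
have n0 : 0 < n%:R :> R by rewrite ltr0n.
have hn : ln e / n%:R <= h.
  by rewrite ler_pdivrMr// mulrC -ler_pdivrMr// ltW// truncnS_gt.
pose node (i : 'I_n.+1) : R := i%:R * (ln e / n%:R).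
have nodeI i : 0 <= node i <= ln e.
  rewrite mulr_ge0 ?divr_ge0 ?(ltW l0e)//= /node mulrCA ler_piMr ?(ltW l0e)//.
  by rewrite ler_pdivrMr// mul1r ler_nat -ltnS.
have near_nodes : \forall u \near U, forall i, `|u e (node i) - ulim e (node i)| <= dl / 3.
  apply: filter_forall => i; have /cvgrPdist_le /(_ _ dl3) := ulim_cvg (nodeI i).
  by apply: filterS => u; rewrite distrC.
have HB : \forall u \near U, H1 G u /\ kin u <= B by apply: filterS H => u [].
near=> u => x xI.
have [hu hB] : H1 G u /\ kin u <= B by near: u.
have un : forall i, `|u e (node i) - ulim e (node i)| <= dl / 3 by near: u.
have [i hi] : exists i, `|x - node i| <= h.
  have /andP[x0 xl] := xI.
  pose m := Num.truncn (x / (ln e / n%:R)).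
  have ln0 : 0 < ln e / n%:R by rewrite divr_gt0.
  have q0 : 0 <= x / (ln e / n%:R) by rewrite divr_ge0// ltW.
  have /andP[m1 m2] := truncn_itv q0.
  rewrite -/m in m1 m2.
  have mn : (m < n.+1)%N.
    rewrite ltnS -(ler_nat R); apply: (le_trans m1).
    by rewrite ler_pdivrMr// mulrCA divff ?gt_eqF// mulr1.
  exists (Ordinal mn); rewrite /node /=.
  move: m1 m2; rewrite ler_pdivlMr// ltr_pdivrMr// => m1 m2.
  rewrite ger0_norm ?subr_ge0//; apply: le_trans hn.
  by apply: ltW; move: m2; rewrite -natr1 mulrDl mul1r addrC -ltrBlDr.
have osc (f : edge -> R -> R) : (f e x - f e (node i)) ^+ 2 <= `|x - node i| * B ->
    `|f e x - f e (node i)| <= dl / 3.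
  move=> hf; rewrite -(@ler_pXn2r _ 2)// ?nnegrE ?(ltW dl3)// real_normK ?num_real//.
  apply: (le_trans hf); apply: (@le_trans _ _ (h * B)); first by rewrite ler_pM2r.
  by rewrite /h divfK// gt_eqF.
have o1 := osc u (holder_le hu hB (nodeI i) xI).
have o2 := osc ulim (ulim_holder HB (nodeI i) xI).
have := un i; move: o1 o2; rewrite !ler_norml.
move: (u e x) (u e (node i)) (ulim e x) (ulim e (node i)) => a1 a2 a3 a4.
move=> /andP[h1 h2] /andP[h3 h4] /andP[h5 h6]; apply/andP; split; lra.
Unshelve. all: by end_near. Qed.

Definition diff u v := lin 1 (-1) u v.

Lemma summable_diff u v : H1 G u -> H1 G v -> summable_fam (massE (diff u v)).
Proof. by move=> hu hv; exact: H1_summable_mass (H1_lin 1 (-1) hu hv). Qed.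

(** The cells up to radius [n] contribute through the uniform distance [dl], the
    others through the two tails. *)
Lemma mass_diff_le u v n (dl eta : R) : 0 <= dl -> H1 G u -> H1 G v ->
  (forall e, (radius e.2 < n)%N -> forall x, 0 <= x <= ln e -> `|u e x - v e x| <= dl) ->
  rsum (mass_tail K n u) <= eta -> rsum (mass_tail K n v) <= eta ->
  (forall e, radius e.2 = n -> forall x, 0 <= x <= ln e -> `|u e x - v e x| <= dl) ->
  mass (diff u v) <= (2 * n.+1)%:R * (dl ^+ 2 * \sum_(k : E) len K k) + 4 * eta.
Proof.
move=> dl0 hu hv H1' tu tv H2'.
have lK (k : E) : 0 < len K k by exact: len_gt0.
have b0 (k : E) : 0 <= dl ^+ 2 * len K k by rewrite mulr_ge0 ?sqr_ge0// ltW.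
have [s1 e1] := rsum_cells n.+1 b0.
rewrite -mulr_sumr in e1; rewrite -e1.
have q1 (e : edge) : 0 <= (if (radius e.2 < n.+1)%N then dl ^+ 2 * ln e else 0) by case: ifP.
have c2 : (0 : R) <= 2 by [].
have [s2 e2] := rsumD (tail_ge0 K n u) (tail_ge0 K n v) (summable_tail n hu) (summable_tail n hv).
have q2 e : 0 <= mass_tail K n u e + mass_tail K n v e by rewrite addr_ge0 ?tail_ge0.
have [s3 e3] := rsumZ c2 q2 s2.
have q3 e : 0 <= 2 * (mass_tail K n u e + mass_tail K n v e) by rewrite mulr_ge0.
have [s4 e4] := rsumD q1 q3 s1 s3.
have [_ h] : summable_fam (massE (diff u v)) /\ mass (diff u v) <= rsum (fun e : edge =>
    (if (radius e.2 < n.+1)%N then dl ^+ 2 * ln e else 0) + 2 * (mass_tail K n u e + mass_tail K n v e)).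
  apply: le_rsum => // e; rewrite edge_mass_ge0/=.
  have [h|h] := ltnP (radius e.2) n.+1.
    apply: (@le_trans _ _ (dl ^+ 2 * ln e)); last by rewrite lerDl.
    apply: sqint_le => //; first exact: H1_ok (H1_lin 1 (-1) hu hv) e.
    move=> x xI; rewrite /diff /lin mul1r mulN1r.
    by move: h; rewrite ltnS leq_eqVlt => /orP[/eqP/H2'|/H1']; apply.
  rewrite add0r /mass_tail h mulrDr.
  have := sqint_lin_le 1 (-1) (H1_ok hu e) (H1_ok hv e).
  by rewrite sqrrN expr1n !mulr1.
apply: (le_trans h); rewrite e4 e3 e2 lerD2l.
by move: tu tv; move: (rsum (mass_tail K n u)) (rsum (mass_tail K n v)) => ? ?; lra.
Qed.

Lemma close_arith (a1 a2 a3 t : R) : - (t / 2) <= a2 - a3 <= t / 2 -> - (t / 2) <= a1 - a3 <= t / 2 ->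
  - t <= a1 - a2 <= t.
Proof. by move=> /andP[h1 h2] /andP[h3 h4]; apply/andP; split; lra. Qed.

Lemma four_eighths (x : R) : 4 * (x / 8) <= x / 2.
Proof. by lra. Qed.

(** Tightness reduces the question to finitely many edges, where the convergence
    is uniform. *)
Lemma near_cauchy_mass (dl : R) : 0 < dl -> exists2 A, U A & forall u v, A u -> A v -> mass (diff u v) <= dl.
Proof.
move=> dl0.
have eta0 : 0 < dl / 8 by rewrite divr_gt0.
have [eps [N [eps0 HN]]] := tightness DR sigmaDR d0 dK p2 p6 mu0 Imin I0 c0 eta0.
pose S := \sum_(k : E) len K k; pose M := (2 * N.+1)%:R * S.
have S0 : 0 <= S by apply: sumr_ge0 => k _; rewrite ltW ?len_gt0.
have M0 : 0 <= M by rewrite mulr_ge0.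
pose t := Num.sqrt (dl / 2 / (M + 1)).
have t0 : 0 < t by rewrite sqrtr_gt0 !divr_gt0// ltr_wpDl.
have tt : t ^+ 2 * M <= dl / 2.
  rewrite sqr_sqrtr; last by rewrite !divr_ge0 ?(ltW dl0)// addr_ge0.
  by rewrite mulrAC ler_pdivrMr ?ltr_wpDl// ler_pM2l ?divr_gt0// lerDl.
have t2 : 0 < t / 2 by rewrite divr_gt0.
have near_cells : \forall u \near U, forall e, (radius e.2 <= N)%N ->
    forall x, 0 <= x <= ln e -> `|u e x - ulim e x| <= t / 2.
  have HH : \forall u \near U, forall k : E, forall i : 'I_(size (cells N.+1)),
      forall x, 0 <= x <= len K k -> `|u (k, nth 0 (cells N.+1) i) x - ulim (k, nth 0 (cells N.+1) i) x| <= t / 2.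
    by apply: filter_forall => k; apply: filter_forall => i; exact: (ulim_uniform (k, _)).
  apply: filterS HH => u H [k j] /= jN x xI.
  have jc : j \in cells N.+1 by rewrite mem_cells ltnS.
  have ic : (index j (cells N.+1) < size (cells N.+1))%N by rewrite index_mem.
  by have := H k (Ordinal ic) x xI; rewrite /= nth_index.
exists (minimizing eps `&` [set u | forall e, (radius e.2 <= N)%N ->
    forall x, 0 <= x <= ln e -> `|u e x - ulim e x| <= t / 2]).
  by apply: filterI => //; exact: US.
move=> u v [[hu mu' Eu nu] cu] [[hv mv Ev nv] cv].
have close e : (radius e.2 <= N)%N -> forall x, 0 <= x <= ln e -> `|u e x - v e x| <= t.
  move=> h x xI; have := cu e h x xI; have := cv e h x xI; rewrite !ler_norml.
  by move=> /close_arith h1 /h1.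
apply: (le_trans (mass_diff_le (n := N) (ltW t0) hu hv _ (HN u hu mu' Eu nu) (HN v hv mv Ev nv) _)).
- by move=> e h; apply: close; exact: ltnW.
- by move=> e h; apply: close; rewrite h.
rewrite mulrCA -/S -/M [leRHS]splitr; apply: lerD => //.
exact: four_eighths.
Qed.

Lemma diff_mid_left u v : diff u (lin 2^-1 2^-1 u v) = lin 2^-1 0 (diff u v) (diff u v).
Proof. by apply/funext => e; apply/funext => x; rewrite /diff /lin; lra. Qed.

Lemma diff_mid_right u v : diff v (lin 2^-1 2^-1 u v) = lin (- 2^-1) 0 (diff u v) (diff u v).
Proof. by apply/funext => e; apply/funext => x; rewrite /diff /lin; lra. Qed.

(** The parallelogram identity for the kinetic terms, with the energy of the midpoint
    bounded from below by [I]. *)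
Lemma kin_cauchy_arith (ku kv kw kd Pu Pv Pw q eps X : R) : 0 <= q ->
  kw + 4^-1 * kd = 2^-1 * ku + 2^-1 * kv ->
  2^-1 * ku - q * Pu < I + eps -> 2^-1 * kv - q * Pv < I + eps -> I <= 2^-1 * kw - q * Pw ->
  Pu <= Pw + X -> Pv <= Pw + X -> kd <= 8 * (eps + q * X).
Proof. by move=> q0 h1 h2 h3 h4 /(ler_wpM2l q0) h5 /(ler_wpM2l q0) h6; lra. Qed.

Lemma mid_le_arith (x y : R) : 0 <= y -> x + 4^-1 * y = 2^-1 * mu + 2^-1 * mu -> x <= mu.
Proof. by lra. Qed.

Lemma quarter_le (x y : R) : x <= y -> 2^-1 ^+ 2 * x <= y / 4.
Proof. by lra. Qed.

Lemma half_quarter (x y : R) : 0 <= y -> x <= y -> x / 4 <= y / 2.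
Proof. by lra. Qed.

Lemma eighths (x : R) : 8 * (x / 16 + x / 16) <= x.
Proof. by lra. Qed.

(** The midpoint of two near-minimizers has mass at most [mu], hence energy at least
    [I]; a large kinetic distance would lower the kinetic term of the midpoint,
    while the potentials differ little. *)
Lemma near_cauchy (dl : R) : 0 < dl -> exists2 A, U A &
  forall u v, A u -> A v -> mass (diff u v) <= dl /\ kin (diff u v) <= dl.
Proof.
move=> dl0; have [B [C [B0 C0 HB]]] := near_bounds.
have p0 : 0 < p by rewrite (lt_trans _ p2).
have q0 : 0 < p^-1 by rewrite invr_gt0.
pose D := 3 * C `^ (p - 2); have D0 : 0 <= D by rewrite mulr_ge0// powR_ge0.
pose eps := dl / 16; have eps0 : 0 < eps by rewrite divr_gt0.
(* the weight in [pot_sub_le]: both of its terms become at most [p eps / 2] after the factor [D] *)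
pose a := p * eps / (D + 1) / mu / 2; have D1 : 0 < D + 1 by rewrite ltr_wpDl.
have a0 : 0 < a by rewrite !divr_gt0// mulr_gt0.
pose dm := Num.min dl (a * (p * eps / (D + 1))).
have dm0 : 0 < dm by rewrite lt_min dl0 mulr_gt0// divr_gt0// mulr_gt0.
have [A UA HA] := near_cauchy_mass dm0.
exists (A `&` minimizing eps `&` [set u | [/\ H1 G u, mass u = mu, kin u <= B &
  forall e x, 0 <= x <= ln e -> `|u e x| <= C]]).
  by apply: filterI => //; apply: filterI => //; exact: US.
move=> u v [[Au [hu hmu Eu _]] [_ _ _ uC]] [[Av [hv hmv Ev _]] [_ _ _ vC]].
have md := HA u v Au Av; split; first by rewrite (le_trans md)// ge_min lexx.
have hd := H1_lin 1 (-1) hu hv; have hw := H1_lin 2^-1 2^-1 hu hv.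
set w := lin 2^-1 2^-1 u v in hw.
have mw : mass w <= mu.
  have := mass_parallelogram hu hv; rewrite -/w hmu hmv.
  exact: mid_le_arith (mass_ge0 K _).
have Ew := En_ge d0 dK p2 p6 mu0 Imin I0 hw mw.
have dE : mass (diff u w) <= dm / 4 /\ mass (diff v w) <= dm / 4.
  by rewrite diff_mid_left diff_mid_right !(mass_scale _ hd) sqrrN; split; exact: quarter_le md.
have small (m' : R) : m' <= dm / 4 -> D * (a * mu + m' / a) <= p * eps.
  move=> hm'.
  have h1 : a * mu = p * eps / (D + 1) / 2.
    by rewrite /a mulrAC divfK// gt_eqF.
  have h2 : m' / a <= p * eps / (D + 1) / 2.
    rewrite ler_pdivrMr//; apply: (le_trans hm').
    rewrite [leRHS]mulrAC [X in X / 2]mulrC; apply: half_quarter.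
      by rewrite mulr_ge0// ?(ltW a0)// divr_ge0 ?mulr_ge0// ltW.
    by rewrite ge_min lexx orbT.
  apply: (@le_trans _ _ (D * (p * eps / (D + 1)))).
    by apply: ler_wpM2l => //; rewrite [leRHS]splitr h1 lerD2l.
  by rewrite mulrA ler_pdivrMr// mulrC ler_pM2l ?mulr_gt0// lerDl.
have Pu := pot_sub_le d0 dK p2 p6 hu hw a0 uC.
have Pv := pot_sub_le d0 dK p2 p6 hv hw a0 vC.
rewrite -/(diff _ _) hmu in Pu; rewrite -/(diff _ _) hmv in Pv.
have Pu' : pot p u <= pot p w + p * eps by apply: (le_trans Pu); rewrite lerD2l; exact: small dE.1.
have Pv' : pot p v <= pot p w + p * eps by apply: (le_trans Pv); rewrite lerD2l; exact: small dE.2.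
have := kin_cauchy_arith (ltW q0) (kin_parallelogram hu hv) Eu Ev Ew Pu' Pv'.
rewrite mulrA mulVf ?gt_eqF// mul1r => h; apply: (le_trans h).
exact: eighths.
Qed.

Lemma geom_cvg0 (a : R) : a * 4^-1 ^+ k @[k --> \oo] --> (0 : R).
Proof.
rewrite -(mulr0 a); apply: cvgMr; apply: cvg_expr.
by rewrite ger0_norm ?invr_ge0// invf_lt1// ltr1n.
Qed.

(** Every set of near-minimizers of a given precision is in the ultrafilter, so the
    [k]-th term can be taken in the first [k] of them at once. *)
Lemma minimizing_sequence : exists w : nat -> edge -> R -> R, exists B C : R, 0 <= C /\
  [/\ forall k, [/\ H1 G (w k), mass (w k) = mu, kin (w k) <= B &
        forall e x, 0 <= x <= ln e -> `|w k e x| <= C],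
      forall k, En p (w k) < I + 4^-1 ^+ k,
      forall k j, (k <= j)%N -> mass (diff (w j) (w k)) <= 4^-1 ^+ k /\ kin (diff (w j) (w k)) <= 4^-1 ^+ k &
      forall e x, 0 <= x <= ln e -> w k e x @[k --> \oo] --> ulim e x].
Proof.
have g0 k : (0 : R) < 4^-1 ^+ k by rewrite exprn_gt0// invr_gt0.
have [B [C [B0 C0 HB]]] := near_bounds.
have /choice[A HA] k : exists A, U A /\ forall u v, A u -> A v ->
    mass (diff u v) <= 4^-1 ^+ k /\ kin (diff u v) <= 4^-1 ^+ k.
  by have [A UA HA] := near_cauchy (g0 k); exists A.
pose Q := [set u | [/\ H1 G u, mass u = mu, kin u <= B & forall e x, 0 <= x <= ln e -> `|u e x| <= C]].
pose S k := [set u | forall i : 'I_k.+1, A i u] `&` (minimizing (4^-1 ^+ k) `&` Q).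
have US' k : U (S k).
  apply: filterI; last by apply: filterI => //; exact: US.
  by apply: filter_forall => i; exact: (HA i).1.
have /choice[w Hw] k : exists w, S k w by exact: (filter_ex (US' k)).
have wA k j : (k <= j)%N -> A k (w j).
  by move=> kj; have [h _] := Hw j; exact: (h (Ordinal (kj : (k < j.+1)%N))).
exists w, B, C; split => //; split.
- by move=> k; have [_ [_]] := Hw k.
- by move=> k; have [_ [[]]] := Hw k.
- by move=> k j kj; apply: (HA k).2; exact: wA.
move=> e x xI; pose a : R := 2 / d + 2 * d.
have a0 : 0 < a by rewrite addr_gt0// ?divr_gt0 ?mulr_gt0.
have near_w k : (ulim e x - w k e x) ^+ 2 <= a * 4^-1 ^+ k.
  have L : (fun u : edge -> R -> R => (u e x - w k e x) ^+ 2) @ U --> (ulim e x - w k e x) ^+ 2.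
    by rewrite expr2; apply: cvgM; apply: cvgB; (exact: ulim_cvg || exact: cvg_cst).
  apply: (cvgr_to_le L); apply: filterS (filterI (HA k).1 H1_near) => u [Au hu].
  have [_ [_ [hw _ _ _]]] := Hw k.
  have [hm hk] := (HA k).2 u (w k) Au (wA k k (leqnn k)).
  have := H1_sup dK (H1_lin 1 (-1) hu hw) xI d0 (lexx d).
  rewrite /lin mul1r mulN1r => h; apply: (le_trans h).
  rewrite /a [leRHS]mulrDl; apply: lerD; last by apply: ler_wpM2l => //; rewrite mulr_ge0// ltW.
  by rewrite [leRHS]mulrAC; apply: ler_wpM2r; [rewrite invr_ge0 ltW|rewrite ler_pM2l].
apply/cvgrPdist_le => eps eps0.
have e2 : 0 < eps ^+ 2 by rewrite exprn_gt0.
have /cvgrPdist_le /(_ _ e2) := geom_cvg0 a.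
apply: filterS => k; rewrite sub0r normrN ger0_norm; last by rewrite mulr_ge0// ltW.
move=> h; rewrite -(@ler_pXn2r _ 2)// ?nnegrE ?(ltW eps0)// real_normK ?num_real//.
exact: le_trans (near_w k) h.
Qed.

Lemma mass_diffC u v : H1 G u -> H1 G v -> mass (diff u v) = mass (diff v u).
Proof.
move=> hu hv; have hd := H1_lin 1 (-1) hv hu.
have -> : diff u v = lin (-1) 0 (diff v u) (diff v u).
  by apply/funext => e; apply/funext => x; rewrite /diff /lin; ring.
by rewrite (mass_scale _ hd) sqrrN expr1n mul1r.
Qed.

Lemma half_quarters (x y : R) : x * (y / 2) = x * y / 4 + x * y / 4.
Proof. by lra. Qed.

Lemma energy_limit_arith (T P Q t e : R) : e <= t / 2 -> 2^-1 * T - P < I + e -> P <= Q + t / 2 ->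
  T <= 2 * (I + t + Q).
Proof. by lra. Qed.

Lemma energy_of_kin_arith (T Q t : R) : T <= 2 * (I + t + Q) -> 2^-1 * T - Q <= I + t.
Proof. by lra. Qed.

(** On each edge the limit is in [H^1] by closedness.  Mass and kinetic term are lower
    semicontinuous and no potential is lost in the limit, so the energy of the
    limit is at most [I] and its mass at most [mu]; a smaller mass would give an
    energy above [I]. *)
Lemma ulim_minimizer : [/\ H1 G ulim, mass ulim = mu & En p ulim <= I].
Proof.
have [w [B [C [C0 [Hw Ew cw lw]]]]] := minimizing_sequence.
have g0 k : (0 : R) < 4^-1 ^+ k by rewrite exprn_gt0// invr_gt0.
have gl : (4^-1 : R) ^+ k @[k --> \oo] --> (0 : R).
  by have := geom_cvg0 1; under eq_cvg do rewrite mul1r.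
have hw k : H1 G (w k) by have [] := Hw k.
have Mterm k j e : (k <= j)%N -> sqint (ln e) (fun x => 1 * w j e x + -1 * w k e x) <= 4^-1 ^+ k.
  move=> kj; apply: le_trans (cw k j kj).1.
  exact: (rsum_term e (edge_mass_ge0 K _) (summable_diff (hw j) (hw k))).
have Tterm k j e : (k <= j)%N -> dsqint (ln e) (fun x => 1 * w j e x + -1 * w k e x) <= 4^-1 ^+ k.
  move=> kj; apply: le_trans (cw k j kj).2.
  exact: (rsum_term e (edge_kin_ge0 K _) (H1_summable_kin (H1_lin 1 (-1) (hw j) (hw k)))).
have closed e := H1_edge_closed (l0 e) (fun k => H1_ok (hw k) e) (fun k j => Mterm k j e)
  (fun k j => Tterm k j e) (lw e).
have ok e : H1_edge (ln e) (ulim e) by have [] := closed e.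
have okw k e : H1_edge (ln e) (w k e) by exact: H1_ok.
have [sM hM] : summable_fam (massE ulim) /\ rsum (massE ulim) <= mu.
  apply: (@rsum_limit _ _ _ (fun k => massE (w k)) (fun k => 4^-1 ^+ k) mu 0%N) => //.
  - exact: edge_mass_ge0.
  - by move=> k e; exact: edge_mass_ge0.
  - by move=> k _; split; [exact: H1_summable_mass|have [_ <-] := Hw k].
  move=> k e a _ a0; apply: le_trans (sqint_sub_le (ok e) (okw k e) a0) _.
  rewrite lerD2l; apply: ler_wpM2l; first by rewrite addr_ge0// invr_ge0 ltW.
  by have [_ /(_ k) []] := closed e.
have Tlim Cb k0 : (forall k, (k0 <= k)%N -> kin (w k) <= Cb) ->
    summable_fam (kinE ulim) /\ rsum (kinE ulim) <= Cb.
  move=> HC; apply: (@rsum_limit _ _ _ (fun k => kinE (w k)) (fun k => 4^-1 ^+ k) Cb k0) => //.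
  - exact: edge_kin_ge0.
  - by move=> k e; exact: edge_kin_ge0.
  - by move=> k kk; split; [exact: H1_summable_kin|exact: HC].
  move=> k e a _ a0; apply: le_trans (dsqint_sub_le (l0 e) (ok e) (okw k e) a0) _.
  rewrite lerD2l; apply: ler_wpM2l; first by rewrite addr_ge0// invr_ge0 ltW.
  by have [_ /(_ k) []] := closed e.
have [sT _] : summable_fam (kinE ulim) /\ rsum (kinE ulim) <= B.
  by apply: (Tlim B 0%N) => k _; have [] := Hw k.
have hL : H1 G ulim.
  apply/H1P; split => //; split; first by move=> e; case: (ok e).
  move=> h h' hh'.
  have evI (g : edge * bool) : 0 <= (if g.2 then ln g.1 else 0) <= ln g.1.
    by case: g.2; rewrite lexx (ltW (l0 _)).
  have c1 := lw h.1 _ (evI h); have c2 := lw h'.1 _ (evI h').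
  have wE k : w k h.1 (if h.2 then ln h.1 else 0) = w k h'.1 (if h'.2 then ln h'.1 else 0).
    exact: ((H1_cont (hw k)).2 h h' hh').
  have wE' := funext wE; rewrite wE' in c1.
  by apply: (cvg_unique _ c1 c2); exact: norm_hausdorff.
have Mdiff k : mass (diff ulim (w k)) <= 4^-1 ^+ k.
  have [] // := @rsum_limit _ _ (massE (diff ulim (w k))) (fun j => massE (diff (w j) (w k)))
    (fun j => 4^-1 ^+ j) (4^-1 ^+ k) k _ _ _ gl _.
  - exact: edge_mass_ge0.
  - by move=> j e; exact: edge_mass_ge0.
  - move=> j kj; split; first exact (summable_diff (hw j) (hw k)).
    exact (cw k j kj).1.
  move=> j e a kj a0.
  have ok1 := H1_ok (H1_lin 1 (-1) hL (hw k)) e; have ok2 := H1_ok (H1_lin 1 (-1) (hw j) (hw k)) e.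
  apply: le_trans (sqint_sub_le ok1 ok2 a0) _.
  rewrite lerD2l; apply: ler_wpM2l; first by rewrite addr_ge0// invr_ge0 ltW.
  have [_ /(_ j) [h _]] := closed e; apply: le_trans h.
  rewrite le_eqVlt; apply/orP; left; apply/eqP; congr sqint.
  by apply/funext => x; rewrite /lin; ring.
have p0 : 0 < p by rewrite (lt_trans _ p2).
pose D := 3 * C `^ (p - 2); have D0 : 0 <= D by rewrite mulr_ge0// powR_ge0.
have En_le : En p ulim <= I.
  apply/ler_addgt0Pr => t t0.
  have t1 : 0 < p * t / 4 / (D + 1) by rewrite !divr_gt0 ?mulr_gt0// ltr_wpDl.
  set s := p * t / 4 / (D + 1) in t1.
  have a0 : 0 < s / mu by rewrite divr_gt0.
  have near_small : \forall k \near \oo, (4^-1 : R) ^+ k <= t / 2 /\ (4^-1 : R) ^+ k <= s / mu * s.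
    have t2 : 0 < t / 2 by rewrite divr_gt0.
    have s2 : 0 < s / mu * s by rewrite mulr_gt0.
    have /cvgrPdist_le /(_ _ t2) h1 := gl; have /cvgrPdist_le /(_ _ s2) h2 := gl.
    apply: filterS (filterI h1 h2) => k /=.
    by rewrite sub0r normrN (ger0_norm (ltW (g0 k))).
  have [k0 _ Hk0] := near_small.
  have kin_le k : (k0 <= k)%N -> kin (w k) <= 2 * (I + t + p^-1 * pot p ulim).
    move=> /Hk0 /= [h1 h2]; have [_ hm _ wC] := Hw k.
    have Pk := pot_sub_le d0 dK p2 p6 (hw k) hL a0 wC.
    rewrite -/(diff _ _) (mass_diffC (hw k) hL) hm divfK ?gt_eqF// in Pk.
    have h3 : mass (diff ulim (w k)) / (s / mu) <= s.
      by rewrite ler_pdivrMr// mulrC; exact: le_trans (Mdiff k) h2.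
    have Pk' : p^-1 * pot p (w k) <= p^-1 * pot p ulim + t / 2.
      rewrite ler_pdivrMl// mulrDr mulVKf ?gt_eqF//; apply: (le_trans Pk); rewrite lerD2l -/D.
      apply: (@le_trans _ _ (D * (s + s))); first by apply: ler_wpM2l => //; rewrite lerD2l.
      rewrite half_quarters.
      rewrite mulrDr; have : D * s <= p * t / 4.
        by rewrite /s mulrA ler_pdivrMr ?ltr_wpDl// mulrC ler_pM2l ?divr_gt0 ?mulr_gt0// lerDl.
      by move=> h; exact: lerD.
    exact: energy_limit_arith h1 (Ew k) Pk'.
  have [_ hk] := Tlim _ _ kin_le.
  exact: energy_of_kin_arith hk.
split => //; apply/eqP; rewrite eq_le hM /=.
have := le_trans (En_ge_part d0 dK p2 p6 mu0 Imin hL hM) En_le.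
by rewrite -{2}(mul1r I) (ler_nM2r I0) ler_pdivlMr// mul1r.
Qed.

End Compactness.

(** * Existence of ground states *)

Section Existence.
Variables (R : realType) (V E : finType) (K : metric_graph R V E).
Variables (Dv Rv : set V) (sigma : V -> V).
Hypothesis DR : Dv `&` Rv = set0.
Hypothesis sigmaDR : set_bij Dv Rv sigma.
Local Notation G := (periodic_graph K Dv sigma).
Local Notation edge := (E * int)%type.
Local Notation ln e := (len K e.1).
Local Notation mass := (graph_mass K).
Local Notation En := (graph_energy K).
Implicit Types (u v w : edge -> R -> R) (e : edge) (a c x y C : R) (b : bool) (n N : nat).
Variables (d p mu : R).
Hypotheses (d0 : 0 < d) (dK : forall k : E, d <= len K k).
Hypotheses (p2 : 2 < p) (p6 : p < 6) (mu0 : 0 < mu).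
Variable I : R.
Hypothesis Imin : forall u, H1 G u -> mass u = mu -> I <= En p u.
Hypothesis I0 : I < 0.
Hypothesis Iapprox : forall eps, 0 < eps -> exists u, [/\ H1 G u, mass u = mu & En p u < I + eps].

Lemma nonvanishing_arith (T P : R) : 0 <= T -> P <= - I / 2 -> I / 2 <= 2^-1 * T - P.
Proof. by lra. Qed.

(** A function bounded by [2 c] has a potential of at most [(2 c)^(p - 2) mu], which
    for small [c] is too little for an energy below [I / 2]. *)
Lemma nonvanishing : exists2 c, 0 < c & forall u, H1 G u -> mass u = mu -> En p u < I / 2 ->
  exists e x, 0 <= x <= ln e /\ 2 * c <= `|u e x|.
Proof.
have p0 : 0 < p by rewrite (lt_trans _ p2).
have q0 : 0 < p - 2 by rewrite subr_gt0.
pose X := p * (- I / 2) / mu.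
have X0 : 0 < X by rewrite divr_gt0// mulr_gt0// divr_gt0// oppr_gt0.
(* chosen so that [(2 c)^(p - 2) mu / p = - I / 2] *)
pose c := X `^ (p - 2)^-1 / 2; have c0 : 0 < c by rewrite divr_gt0// powR_gt0.
exists c => // u hu hm hE; apply: contrapT => H.
have B e x : 0 <= x <= ln e -> `|u e x| <= 2 * c.
  move=> xI; rewrite leNgt; apply/negP => h; apply: H; exists e, x; split => //; exact: ltW.
have [_] := pot_le p2 p6 hu B.
rewrite /c mulrCA divff// mulr1 -powRrM mulVf ?gt_eqF// powRr1 ?(ltW X0)// hm /X divfK ?gt_eqF//.
rewrite -ler_pdivrMl// => hP.
by have := le_lt_trans (nonvanishing_arith (kin_ge0 K u) hP) hE; rewrite ltxx.
Qed.

Lemma half_arith (m : R) : m <= - I / 2 -> I + m <= I / 2.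
Proof. by lra. Qed.

(** The sets of near-minimizers generate a proper filter; each is nonempty because
    a translation moves a point where the function is large into the cell 0. *)
Lemma exists_minimizer : exists u, [/\ H1 G u, mass u = mu & En p u <= I].
Proof.
have [c c0 Hc] := nonvanishing.
pose S := minimizing K Dv sigma p mu I c.
have S_neq0 eps : 0 < eps -> S eps !=set0.
  move=> eps0; have h0 : 0 < Num.min eps (- I / 2) by rewrite lt_min eps0 divr_gt0// oppr_gt0.
  have [u [hu hm hE]] := Iapprox h0.
  have E1 : En p u < I + eps by apply: (lt_le_trans hE); rewrite lerD2l ge_min lexx.
  have E2 : En p u < I / 2.
    by apply: (lt_le_trans hE); apply: half_arith; rewrite ge_min lexx orbT.
  have [e [x [xI ux]]] := Hc u hu hm E2.
  exists (shift e.2 u); split.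
  - exact: H1_shift.
  - by rewrite mass_shift.
  - by rewrite En_shift.
  - by exists e.1, x; split => //; rewrite /shift /= add0r -surjective_pairing.
have S_mono (a a' : R) : a <= a' -> S a `<=` S a'.
  move=> ab u [hu hm hE nu]; split => //; apply: (lt_le_trans hE); rewrite lerD2l//.
pose F := filter_from [set eps : R | 0 < eps] S.
have FF : Filter F.
  apply: filter_from_filter; first by exists 1 => /=.
  move=> a a' /= a0 a0'; exists (Num.min a a'); first by rewrite /= lt_min a0.
  by move=> u Su; split; apply: S_mono Su; rewrite ge_min lexx ?orbT.
have PF : ProperFilter F by apply: filter_from_proper => eps; exact: S_neq0.
have [U [UU FU]] := ultraFilterLemma PF.
have US eps : 0 < eps -> U (S eps) by move=> e0; apply: FU; exists eps.
by exists (ulim U); apply: (ulim_minimizer DR sigmaDR d0 dK p2 p6 mu0 Imin I0 c0 UU).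
Qed.

End Existence.

(** Without edges, connected vertices are equal. *)
Lemma connected_edge (R : realType) (V E : choiceType) (K : metric_graph R V E) (v w : V) :
  connected_graph K -> v <> w -> exists k : E, True.
Proof.
move=> /(_ v w) vw; apply: contra_notP => nE.
by elim: vw => [x y [k _]|//|//|x y z _ -> _ ->//]; case: nE; exists k.
Qed.

Theorem theorem1p1 (R : realType) (V E : finType) (K : metric_graph R V E)
    (Dv Rv : set V) (sigma : V -> V)
    (K_connected : connected_graph K)
    (Dv_neq0 : Dv !=set0) (Rv_neq0 : Rv !=set0)
    (DvRv_disjoint : Dv `&` Rv = set0)
    (sigma_bij : set_bij Dv Rv sigma)
    (deg3 : exists v, degree_ge (periodic_graph K Dv sigma) 3 v)
    (p : R) (p_gt2 : 2 < p) (p_lt6 : p < 6)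
    (mu : R) (mu_gt0 : 0 < mu) :
  let G := periodic_graph K Dv sigma in
  ((-oo < ground_energy G p mu)%E /\ (ground_energy G p mu < 0)%E) /\
  exists u, H1_mass G mu u /\ energy G p u = ground_energy G p mu.
Proof.
move=> G.
have [v Dvv] := Dv_neq0; have [w Rww] := Rv_neq0.
have vw : v <> w.
  move=> vw; suff : (Dv `&` Rv) v by rewrite DvRv_disjoint.
  by split => //; rewrite vw.
have k0 := connected_edge K_connected vw.
have [d [d0 dK]] := min_len K.
pose A := [set graph_energy K p u | u in [set u | H1 G u /\ graph_mass K u = mu]].
have [u0 [hu0 mu0' E0]] := negative_energy DvRv_disjoint sigma_bij d0 dK p_gt2 p_lt6 mu_gt0 k0.
have [C HC] := coercive Dv sigma d0 dK p_gt2 p_lt6 mu_gt0.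
have A0 : A !=set0 by exists (graph_energy K p u0), u0.
have Alb : has_lbound A.
  exists (- C / 4) => _ [u [hu hm] <-].
  have := HC u hu; rewrite hm => /(_ (lexx _)); have := kin_ge0 K u.
  by move: (graph_kin K u) (graph_energy K p u) => T X; lra.
pose I := inf A.
have Imin u : H1 G u -> graph_mass K u = mu -> I <= graph_energy K p u.
  by move=> hu hm; apply: ge_inf => //; exists u.
have I0 : I < 0 by apply: le_lt_trans E0; exact: Imin.
have Iapprox eps : 0 < eps -> exists u, [/\ H1 G u, graph_mass K u = mu & graph_energy K p u < I + eps].
  move=> eps0; have [_ [u [hu hm] <-] hE] := inf_adherent eps0 (conj A0 Alb).
  by exists u.
have massP u : H1_mass G mu u <-> H1 G u /\ graph_mass K u = mu.
  split=> -[hu hm]; split => //; last by rewrite Lpow_mass// hm.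
  by move: hm; rewrite Lpow_mass// => -[].
have gE : ground_energy G p mu = I%:E.
  rewrite /ground_energy /I -ereal_inf_EFin//; congr ereal_inf.
  apply/seteqP; split => [_ [u /massP[hu hm] <-]|_ [_ [u [hu hm] <-] <-]].
    by exists (graph_energy K p u); [exists u|rewrite (energyE d0 dK p_gt2 p_lt6 hu)].
  by exists u; [apply/massP|rewrite (energyE d0 dK p_gt2 p_lt6 hu)].
rewrite gE ltNyr lte_fin; split; first by [].
have [u [hu hm hE]] := exists_minimizer DvRv_disjoint sigma_bij d0 dK p_gt2 p_lt6 mu_gt0 Imin I0 Iapprox.
exists u; split; first by apply/massP.
by rewrite (energyE d0 dK p_gt2 p_lt6 hu); congr EFin; apply/eqP; rewrite eq_le hE Imin.
Qed.
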